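(* Let $U_0\in\mathcal H$. Then the evolution problem $U_t=\mathcal A U$, $U(0)=U_0$, has a unique solution $U\in C^0(\mathbb R_+,\mathcal H)$. Moreover, if $U_0\in D(\mathcal A)$, then $U\in C^0(\mathbb R_+,D(\mathcal A))\cap C^1(\mathbb R_+,\mathcal H)$.
   Context: Parameters: $\rho>0$, $0<\tilde\alpha<1$, $\wp\ge 0$, $\eta(\xi)=|\xi|^{(2\tilde\alpha-1)/2}$ for $\xi\in\mathbb R$, and $\zeta=\rho\pi^{-1}\sin(\tilde\alpha\pi)$. All functions are complex-valued. The function $\tau\in C([0,1])\cap C^1((0,1])$ satisfies $\tau(0)=0$, $\tau(x)>0$ for all $x\in(0,1]$, $m_\tau:=\sup_{0<x\le 1}\frac{x|\tau'(x)|}{\tau(x)}<2$, and $\tau\in C^{[m_\tau]}([0,1])$, where $[\cdot]$ is the integer part. Spaces: $H^1_\tau(0,1)=\{\psi\in L^2(0,1):\psi \text{ locally absolutely continuous in }(0,1],\ \sqrt{\tau}\,\psi_x\in L^2(0,1)\}$; $H^1_{0,\tau}(0,1)=\{\psi\in H^1_\tau(0,1):\psi(0)=0\}$; $H^2_\tau(0,1)=\{\psi\in H^1_\tau(0,1):\tau\psi_x\in H^1(0,1)\}$; $W^1_\tau(0,1)=H^1_{0,\tau}(0,1)$ if $0\le m_\tau<1$ and $W^1_\tau(0,1)=H^1_\tau(0,1)$ if $1\le m_\tau<2$. State space: $\mathcal H=L^2(0,1)\times L^2(\mathbb R)$ with inner product $\langle(\psi,\vartheta),(\tilde\psi,\tilde\vartheta)\rangle_{\mathcal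 H}=\int_0^1\psi\overline{\tilde\psi}\,dx+\zeta\int_{-\infty}^{+\infty}\vartheta\overline{\tilde\vartheta}\,d\xi$. The operator $\mathcal A$ is $\mathcal A(\psi,\vartheta)=\big(i(\tau\psi_x)_x,\ -(\xi^2+\wp)\vartheta+\eta(\xi)\psi(1)\big)$ with domain $D(\mathcal A)$ the set of $(\psi,\vartheta)\in\mathcal H$ such that $\psi\in H^2_\tau(0,1)\cap W^1_\tau(0,1)$, $(\tau\psi_x)(1)=i\zeta\int_{-\infty}^{+\infty}\eta(\xi)\vartheta(\xi)\,d\xi$, $-(\xi^2+\wp)\vartheta+\eta(\xi)\psi(1)\in L^2(\mathbb R)$ and $|\xi|\vartheta\in L^2(\mathbb R)$; $D(\mathcal A)$ carries the graph norm. For $U_0\in\mathcal H$ not in $D(\mathcal A)$, ''solution'' means mild solution in the sense of semigroup theory. *)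

(* Defs.v *)
From mathcomp Require Import all_boot all_order all_algebra.
From mathcomp Require Import all_classical all_reals all_analysis.
From mathcomp Require Import complex.

Set Implicit Arguments.
Unset Strict Implicit.
Unset Printing Implicit Defensive.

Import Order.TTheory GRing.Theory Num.Theory.
Import numFieldNormedType.Exports.

Local Open Scope classical_set_scope.
Local Open Scope complex_scope.
Local Open Scope ring_scope.

Section real_functions.
Context {R : realType}.
Implicit Types (D : set R) (f : R -> R).

(* Derivative of [f] relative to [D]: one-sided at the end points of an
   interval, the usual derivative inside. *)
Definition diff_quotient f (x y : R) : R := (f y - f x) / (y - x).

Definition derivable_within D f (x : R) : Prop :=
  cvg (diff_quotient f x y @[y --> within D x^']).

Definition derive_within D f (x : R) : R :=
  lim (diff_quotient f x y @[y --> within D x^']).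

Fixpoint Ck_on D (k : nat) f : Prop :=
  match k with
  | 0 => {within D, continuous f}
  | k'.+1 => [/\ {within D, continuous f},
                 forall x, D x -> derivable_within D f x &
                 Ck_on D k' (derive_within D f)]
  end.

End real_functions.

Section complex_functions.
Context {R : realType}.
Local Notation C := R[i].
Local Notation mu := (@lebesgue_measure R).
Implicit Types (D : set R) (f g : R -> C).

Definition cabs (z : C) : R := ComplexField.Normc.normc z.

Definition Cintegral D f : C :=
  Complex (Rintegral mu D (fun x => complex.Re (f x)))
          (Rintegral mu D (fun x => complex.Im (f x))).

(* Elements of L^2(D) are represented by Borel functions; equality in L^2(D)
   is [ae_eq mu D]. *)
Definition L2 D f : Prop :=
  [/\ measurable_fun D (fun x => complex.Re (f x)),
      measurable_fun D (fun x => complex.Im (f x)) &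
      (\int[mu]_(x in D) (cabs (f x) ^+ 2)%:E < +oo)%E].

Definition abs_continuous (a b : R) f : Prop :=
  forall e : R, 0 < e -> exists2 d : R, 0 < d &
    forall (n : nat) (l r : 'I_n -> R),
      (forall i, [/\ a <= l i, l i <= r i & r i <= b]) ->
      trivIset [set: 'I_n] (fun i => `]l i, r i[%classic) ->
      \sum_(i < n) (r i - l i) < d ->
      \sum_(i < n) cabs (f (r i) - f (l i)) < e.

(* Local absolute continuity in (0,1]. *)
Definition loc_abs_continuous f : Prop :=
  forall a b : R, 0 < a -> a < b -> b <= 1 -> abs_continuous a b f.

Definition ae_derivative D f f' : Prop :=
  {ae mu, forall x, D x ->
     is_derive (x : R) (1 : R) (fun y => complex.Re (f y)) (complex.Re (f' x)) /\
     is_derive (x : R) (1 : R) (fun y => complex.Im (f y)) (complex.Im (f' x))}.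

Definition I01 : set R := `]0, 1[%classic.

(* [w] is the absolutely continuous representative of an element of H^1(0,1)
   and [dw] is (a Borel version of) its derivative. *)
Definition H1 (w dw : R -> C) : Prop :=
  [/\ abs_continuous 0 1 w, ae_derivative I01 w dw & L2 I01 dw].

End complex_functions.

Section weighted_spaces.
Context {R : realType}.
Local Notation C := R[i].
Local Notation mu := (@lebesgue_measure R).
Variable tau : R -> R.

Definition m_tau : \bar R :=
  ereal_sup [set (x * `|derive_within `]0, 1]%classic tau x| / tau x)%:E
            | x in `]0, 1]%classic].

Definition admissible_tau : Prop :=
  [/\ Ck_on `[0, 1]%classic 0 tau, Ck_on `]0, 1]%classic 1 tau, tau 0 = 0 &
      forall x, 0 < x <= 1 -> 0 < tau x] /\
  ((m_tau < 2%:E)%E /\ Ck_on `[0, 1]%classic (Num.truncn (fine m_tau)) tau).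

(* In the following predicates [psi] is the locally absolutely continuous
   representative, so that its point values on (0,1] make sense, and [dpsi] is
   (a Borel version of) psi_x, determined up to a.e. equality by [psi]. *)
Definition H1tau_der (psi dpsi : R -> C) : Prop :=
  [/\ L2 I01 psi, loc_abs_continuous psi, ae_derivative I01 psi dpsi &
      L2 I01 (fun x => (Num.sqrt (tau x))%:C * dpsi x)].

Definition H1tau (psi : R -> C) : Prop := exists dpsi, H1tau_der psi dpsi.

(* psi(0) = 0 is the vanishing at 0 of the continuous extension of [psi]. *)
Definition H10tau (psi : R -> C) : Prop :=
  H1tau psi /\ cabs (psi x) @[x --> 0^'+] --> (0 : R).

(* [w] is the continuous representative of tau psi_x in H^1(0,1) and [dw] is
   (a Borel version of) (tau psi_x)_x. *)
Definition H2tau_der (psi w dw : R -> C) : Prop :=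
  exists dpsi, [/\ H1tau_der psi dpsi,
    ae_eq mu I01 w (fun x => (tau x)%:C * dpsi x) & H1 w dw].

Definition W1tau (psi : R -> C) : Prop :=
  if (m_tau < 1%:E)%E then H10tau psi else H1tau psi.

End weighted_spaces.

Section operator.
Context {R : realType}.
Local Notation C := R[i].
Local Notation mu := (@lebesgue_measure R).
Variables (rho alpha wp : R) (tau : R -> R).

(* Representatives of elements of L^2(0,1) x L^2(R). *)
Definition state : Type := ((R -> C) * (R -> C))%type.

Implicit Types (U V F J : state).

Definition eta (xi : R) : R := `|xi| `^ ((2 * alpha - 1) / 2).

Definition zeta : R := rho * pi^-1 * sin (alpha * pi).

Definition inH U : Prop := L2 I01 U.1 /\ L2 setT U.2.

Definition eqH U V : Prop := ae_eq mu I01 U.1 V.1 /\ ae_eq mu setT U.2 V.2.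

Definition innerH U V : C :=
  Cintegral I01 (fun x => U.1 x * (V.1 x)^*%C) +
  zeta%:C * Cintegral setT (fun xi => U.2 xi * (V.2 xi)^*%C).

Definition normH U : R := Num.sqrt (complex.Re (innerH U U)).

(* Second component of A(psi, theta), where [c] = psi(1). *)
Definition A2 (theta : R -> C) (c : C) (xi : R) : C :=
  - (xi ^+ 2 + wp)%:C * theta xi + (eta xi)%:C * c.

(* [U] is in D(A), and [psi], [w], [dw] are the precise versions of the first
   component of [U], of its flux tau psi_x and of (tau psi_x)_x. *)
Definition domA_with U (psi w dw : R -> C) : Prop :=
  [/\ inH U, ae_eq mu I01 psi U.1, H2tau_der tau psi w dw & W1tau tau psi] /\
  [/\ w 1 = 'i%C * zeta%:C * Cintegral setT (fun xi => (eta xi)%:C * U.2 xi),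
      L2 setT (A2 U.2 (psi 1)) &
      L2 setT (fun xi => `|xi|%:C * U.2 xi)].

Definition domA U : Prop := exists psi w dw, domA_with U psi w dw.

(* The graph of A: [U] is in D(A) and A U = [F] in H. *)
Definition graphA U F : Prop :=
  exists psi w dw, domA_with U psi w dw /\
    [/\ inH F, ae_eq mu I01 F.1 (fun x => 'i%C * dw x) &
        ae_eq mu setT F.2 (A2 U.2 (psi 1))].

Definition Rplus : set R := [set t | 0 <= t].

(* C^0(R_+, H) *)
Definition C0H (U : R -> state) : Prop :=
  forall t, 0 <= t -> inH (U t) /\
    normH (U s - U t) @[s --> within Rplus (nbhs t)] --> (0 : R).

Definition derivH (U : R -> state) (t : R) V : Prop :=
  normH ((s - t)^-1%:C *: (U s - U t) - V) @[s --> within Rplus t^']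
    --> (0 : R).

(* C^1(R_+, H) *)
Definition C1H (U : R -> state) : Prop :=
  C0H U /\ exists V : R -> state,
    C0H V /\ forall t, 0 <= t -> derivH U t (V t).

(* C^0(R_+, D(A)), for the graph norm; [F] is A U. *)
Definition C0DA (U : R -> state) : Prop :=
  exists F : R -> state, forall t, 0 <= t -> graphA (U t) (F t) /\
    normH (U s - U t) + normH (F s - F t) @[s --> within Rplus (nbhs t)]
      --> (0 : R).

(* [J] is the H-valued Riemann integral of [U] over [0, t]. *)
Definition is_RintegralH (U : R -> state) (t : R) J : Prop :=
  forall e : R, 0 < e -> exists2 d : R, 0 < d &
    forall (n : nat) (p c : nat -> R), p 0%N = 0 -> p n = t ->
      (forall k, (k < n)%N ->
         p k <= c k <= p k.+1 /\ p k.+1 - p k < d) ->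
      normH (\sum_(k < n) (p k.+1 - p k)%:C *: U (c k) - J) < e.

(* Mild solution: U(t) = U0 + A (int_0^t U(s) ds) for all t >= 0. *)
Definition mild_solution U0 (U : R -> state) : Prop :=
  C0H U /\ eqH (U 0) U0 /\
  forall t, 0 <= t -> exists J, is_RintegralH U t J /\ graphA J (U t - U0).

Definition classical_solution U0 (U : R -> state) : Prop :=
  [/\ C0DA U, C1H U, eqH (U 0) U0 &
      forall t, 0 <= t -> exists F, graphA (U t) F /\ derivH U t F].

End operator.

Arguments state R : clear implicits.

(* Main.v *)
From HB Require Import structures.
From mathcomp Require Import all_boot all_order all_algebra.
From mathcomp Require Import all_classical all_reals all_analysis.
From mathcomp Require Import measurable_realfun.
From mathcomp Require Import complex ring lra.
Require Import Defs.

(**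
The operator is maximal dissipative on the state space, so that the problem is
solved by the contraction semigroup that it generates (Lumer-Phillips).  A state
is handled as a quadruple of real functions, and the real part of the inner
product as a positive semidefinite real form on such quadruples, whose null
vectors are the functions that vanish almost everywhere.

Dissipativity.  For [(psi, theta)] in the domain and [w = tau psi_x], integration
by parts turns the real part of [<i w', psi>] into that of [i w(1) conj(psi(1))],
which by the boundary condition is minus that of
[zeta (int eta theta) conj(psi(1))] and cancels the coupling term of the second
component; what remains is [- zeta int (xi^2 + wp) |theta|^2].  The delicate point
is the boundary term at 0 ([green]).  If [m_tau < 1], then [psi] tends to 0 and [w]
is bounded.  Otherwise [tau] is differentiable at 0, so [tau(x) = O(x)]; then
[|w|^2 / tau], which is integrable, forces [w(0) = 0], hence [w = O(sqrt x)] because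
[w'] is square integrable ([flux_small]), and a nonzero limit of [w conj(psi)]
would make [|psi|^2] at least a multiple of the nonintegrable [1 / x].

Maximality ([generator_max]).  In [U - h A U = F] the second component is
[theta = (f + h eta psi(1)) / (1 + h (xi^2 + wp))].  The flux
[w = c - int_x^1 w'] is taken as the unknown of the first component: multiplying
[psi - i h w' = f] by the derivative of a test function [chi], and integrating by
parts with [psi_x = w / tau], leaves the form [int w conj(chi) / tau] together with
[h i] times [int w' conj(chi')] and a multiple of [w(1) conj(chi(1))].  Written for
[v = w / sqrt tau] the admissible [w] form a closed subspace, and the form is
coercive after multiplication by [1 - i] ([complex_riesz]).  The function [psi]
is then recovered by integrating [w / tau] from 1 ([weak_to_strong]); testing
against the constant 1, which is admissible when [1 / tau] is integrable, gives
[psi(0) = 0] for [m_tau < 1].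

Semigroup.  The implicit Euler approximations with [2^n] steps converge, since
on the domain of [A^2] halving the step changes them by [O(2^-n)] ([euler_cvg]).
The limit [S t x] satisfies [S t x - S s x = (t - s) S s (A x) + O((t - s)^2)] there,
which makes it the Riemann integral of its derivative; closedness and density
extend this to all data ([S_mild], [S_deriv]).  Uniqueness holds because [|W|^2] is
nonincreasing along a solution ([dissipative_uniq]), applied to the integrated
difference of two mild solutions ([mild_uniq]).

The analysis on the line rests on the fundamental theorem of calculus for
absolutely continuous functions ([AC_FTC]), obtained from Cousin's lemma.
*)

Set Implicit Arguments.
Unset Strict Implicit.
Unset Printing Implicit Defensive.

Import Order.TTheory GRing.Theory Num.Theory.
Import numFieldNormedType.Exports.

Local Open Scope classical_set_scope.
Local Open Scope ring_scope.

(** * A tactic for linear identities *)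

(** [lmodule] proves an equation between linear combinations in a module by
    comparing the coefficients of the atoms, each by [field]. *)
Inductive lexp (R : Type) : Type :=
  | LVar of nat
  | LAdd of lexp R & lexp R
  | LOpp of lexp R
  | LScale of R & lexp R
  | LZero.

Fixpoint leval (R : pzRingType) (H : lmodType R) (env : seq H) (e : lexp R) : H :=
  match e with
  | LVar n => nth 0 env n
  | LAdd a b => leval env a + leval env b
  | LOpp a => - leval env a
  | LScale c a => c *: leval env a
  | LZero => 0
  end.

Fixpoint lcoef (R : pzRingType) (i : nat) (e : lexp R) : R :=
  match e with
  | LVar n => if n == i then 1 else 0
  | LAdd a b => lcoef i a + lcoef i b
  | LOpp a => - lcoef i a
  | LScale c a => c * lcoef i a
  | LZero => 0
  end.

Fixpoint lcoef_eq (R : pzRingType) (n : nat) (a b : lexp R) : Prop :=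
  if n is n'.+1 then lcoef n' a = lcoef n' b /\ lcoef_eq n' a b else True.

Lemma levalE (R : pzRingType) (H : lmodType R) (env : seq H) (e : lexp R) :
  leval env e = \sum_(i < size env) lcoef i e *: nth 0 env i.
Proof.
elim: e => [n|a IHa b IHb|a IHa|c a IHa|] /=.
- have [nn|nn] := ltnP n (size env).
    rewrite (bigD1 (Ordinal nn))//= eqxx scale1r big1 ?addr0// => i ni.
    case: eqVneq => [e|]; last by rewrite scale0r.
    by move: ni; rewrite -val_eqE/= e eqxx.
  rewrite nth_default// big1// => i _.
  case: eqVneq => [e|]; last by rewrite scale0r.
  by move: nn; rewrite e leqNgt ltn_ord.
- by rewrite IHa IHb -big_split; apply: eq_bigr => i _; rewrite scalerDl.
- by rewrite IHa -sumrN; apply: eq_bigr => i _; rewrite scaleNr.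
- by rewrite IHa scaler_sumr; apply: eq_bigr => i _; rewrite scalerA.
- by rewrite big1// => i _; rewrite scale0r.
Qed.

Lemma leval_eq (R : pzRingType) (H : lmodType R) (env : seq H) (a b : lexp R) :
  lcoef_eq (size env) a b -> leval env a = leval env b.
Proof.
rewrite !levalE => h; apply: eq_bigr => i _; congr (_ *: _).
elim: (size env) i h => [|n IH] [i /= iN] //= [h0 hn].
move: iN; rewrite ltnS leq_eqVlt => /predU1P[-> //|iN].
exact: (IH (Ordinal iN)).
Qed.

Ltac lm_index x env :=
  lazymatch env with
  | x :: _ => constr:(O)
  | _ :: ?env' => let n := lm_index x env' in constr:(S n)
  end.

Ltac lm_mem x env :=
  lazymatch env with
  | x :: _ => constr:(true)
  | _ :: ?env' => lm_mem x env'
  | _ => constr:(false)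
  end.

Ltac lm_atoms t env :=
  lazymatch t with
  | (?a + ?b)%R => let env' := lm_atoms a env in lm_atoms b env'
  | (- ?a)%R => lm_atoms a env
  | (?c *: ?a)%R => lm_atoms a env
  | 0%R => env
  | ?x => let m := lm_mem x env in
          lazymatch m with true => env | false => constr:(x :: env) end
  end.

Ltac lm_reify R t env :=
  lazymatch t with
  | (?a + ?b)%R => let a' := lm_reify R a env in
                   let b' := lm_reify R b env in constr:(@LAdd R a' b')
  | (- ?a)%R => let a' := lm_reify R a env in constr:(@LOpp R a')
  | (?c *: ?a)%R => let a' := lm_reify R a env in constr:(@LScale R c a')
  | 0%R => constr:(@LZero R)
  | ?x => let n := lm_index x env in constr:(@LVar R n)
  end.

Ltac lm_leaf t :=
  lazymatch t with
  | (?a + _)%R => lm_leaf a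
  | (- ?a)%R => lm_leaf a
  | (_ *: ?a)%R => lm_leaf a
  | ?x => x
  end.

Ltac lmodule :=
  lazymatch goal with
  | |- ?a = ?b =>
    let x := lm_leaf a in
    lazymatch type of x with
    | @GRing.Lmodule.sort ?R ?H =>
      let env0 := lm_atoms a (@nil (GRing.Lmodule.sort H)) in
      let env := lm_atoms b env0 in
      let a' := lm_reify (GRing.PzRing.sort R) a env in
      let b' := lm_reify (GRing.PzRing.sort R) b env in
      refine (@leval_eq R H env a' b' _);
      simpl; repeat split; try (by []); try ring; try (field; try done)
    end
  end.

(** * Real Hilbert spaces *)

Lemma expr_small (R : realType) (q C e : R) : 0 <= q < 1 -> 0 < e ->
  exists n0, forall n, (n0 <= n)%N -> C * q ^+ n < e.
Proof.
move=> /andP[q0 q1] e0.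
have qn : `|q| < 1 by rewrite ger0_norm.
have /cvgrPdist_lt /(_ e e0) : (fun n => C * q ^+ n) @ \oo --> C * 0.
  by apply: cvgMr; exact: cvg_expr.
case=> n0 _ h; exists n0 => n /h /=.
by rewrite mulr0 sub0r normrN => /(le_lt_trans (ler_norm _)).
Qed.

(** The form is only positive semidefinite, so that functions need not be
    identified almost everywhere: elements at distance zero play the role of
    equal elements.  Completeness is required for geometrically fast Cauchy
    sequences, which is what the pointwise construction of limits in L2
    provides and which implies completeness. *)
Record hilbert (R : realType) (H : lmodType R) := Hilbert {
  ip : H -> H -> R ;
  ipC : forall x y, ip x y = ip y x ;
  ipP : forall a x y z, ip (a *: x + y) z = a * ip x z + ip y z ;
  ip_ge0 : forall x, 0 <= ip x x ;
  ip_fast : forall x : nat -> H,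
    (forall n, ip (x n.+1 - x n) (x n.+1 - x n) <= (1 / 16) ^+ n) ->
    exists y, forall e, 0 < e ->
      exists n0, forall n, (n0 <= n)%N -> ip (x n - y) (x n - y) < e }.

Definition nrm (R : realType) (H : lmodType R) (hs : hilbert H) (x : H) : R :=
  Num.sqrt (ip hs x x).

Definition tends (R : realType) (H : lmodType R) (hs : hilbert H)
    (x : nat -> H) (y : H) :=
  forall e, 0 < e -> exists n0, forall n, (n0 <= n)%N -> nrm hs (x n - y) < e.

Section hilbert_theory.
Context {R : realType} {H : lmodType R} (hs : hilbert H).
Local Notation "<< x , y >>" := (ip hs x y).
Local Notation N := (nrm hs).
Implicit Types (x y z : H) (a : R).

Lemma ipDl x y z : <<x + y, z>> = <<x, z>> + <<y, z>>.
Proof. by rewrite -[x]scale1r ipP mul1r scale1r. Qed.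

Lemma ip0l z : <<0, z>> = 0.
Proof. by have := ipDl 0 0 z; rewrite addr0; lra. Qed.

Lemma ipZl a x z : <<a *: x, z>> = a * <<x, z>>.
Proof. by rewrite -[a *: x]addr0 ipP ip0l addr0. Qed.

Lemma ipNl x z : <<- x, z>> = - <<x, z>>.
Proof. by rewrite -scaleN1r ipZl mulN1r. Qed.

Lemma ipBl x y z : <<x - y, z>> = <<x, z>> - <<y, z>>.
Proof. by rewrite ipDl ipNl. Qed.

Lemma ip0r z : <<z, 0>> = 0. Proof. by rewrite ipC ip0l. Qed.
Lemma ipDr x y z : <<z, x + y>> = <<z, x>> + <<z, y>>.
Proof. by rewrite ![<<z, _>>]ipC ipDl. Qed.
Lemma ipZr a x z : <<z, a *: x>> = a * <<z, x>>.
Proof. by rewrite ![<<z, _>>]ipC ipZl. Qed.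
Lemma ipNr x z : <<z, - x>> = - <<z, x>>.
Proof. by rewrite ![<<z, _>>]ipC ipNl. Qed.
Definition ipE := (ipDl, ipDr, ipNl, ipNr, ipZl, ipZr, ip0l, ip0r).

Lemma ip_subZ a x y :
  <<x - a *: y, x - a *: y>> = <<x, x>> - 2 * a * <<x, y>> + a ^+ 2 * <<y, y>>.
Proof. by rewrite !ipE (ipC hs y x); ring. Qed.

Lemma nrm_ge0 x : 0 <= N x. Proof. exact: sqrtr_ge0. Qed.

Lemma nrm_sq x : N x ^+ 2 = <<x, x>>.
Proof. by rewrite sqr_sqrtr// ip_ge0. Qed.

Lemma nrm0 : N 0 = 0. Proof. by rewrite /nrm ip0l sqrtr0. Qed.

Lemma nrmN x : N (- x) = N x.
Proof. by rewrite /nrm ipNl ipNr opprK. Qed.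

Lemma nrmBC x y : N (x - y) = N (y - x).
Proof. by rewrite -nrmN opprB. Qed.

Lemma nrmZ a x : N (a *: x) = `|a| * N x.
Proof. by rewrite /nrm ipZl ipZr mulrA -expr2 sqrtrM ?sqr_ge0// sqrtr_sqr. Qed.

Lemma ip_sqr_le x y : <<x, y>> ^+ 2 <= <<x, x>> * <<y, y>>.
Proof.
have q (t : R) : 0 <= <<x, x>> + 2 * t * <<x, y>> + t ^+ 2 * <<y, y>>.
  have := ip_ge0 hs (x + t *: y); rewrite !ipE (ipC hs y x).
  by congr (_ <= _); ring.
have [y0|y0] := eqVneq <<y, y>> 0.
  rewrite y0 mulr0; have [xy0|xy0] := eqVneq <<x, y>> 0.
    by rewrite xy0 expr0n.
  have := q (- (<<x, x>> + 1) / (2 * <<x, y>>)).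
  rewrite y0 mulr0 addr0.
  have -> : 2 * (- (<<x, x>> + 1) / (2 * <<x, y>>)) * <<x, y>>
     = - (<<x, x>> + 1) by field.
  lra.
have y1 : 0 < <<y, y>> by rewrite lt_neqAle eq_sym y0 ip_ge0.
have := q (- <<x, y>> / <<y, y>>).
have -> : <<x, x>> + 2 * (- <<x, y>> / <<y, y>>) * <<x, y>>
    + (- <<x, y>> / <<y, y>>) ^+ 2 * <<y, y>>
   = (<<x, x>> * <<y, y>> - <<x, y>> ^+ 2) / <<y, y>> by field.
by rewrite pmulr_lge0 ?invr_gt0// subr_ge0.
Qed.

Lemma CauchySchwarz x y : `|<<x, y>>| <= N x * N y.
Proof.
rewrite -(@ler_pXn2r _ 2%N)// ?nnegrE ?mulr_ge0 ?nrm_ge0//.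
by rewrite real_normK ?num_real// exprMn !nrm_sq ip_sqr_le.
Qed.

Lemma ip_le x y : <<x, y>> <= N x * N y.
Proof. exact: le_trans (ler_norm _) (CauchySchwarz x y). Qed.

Lemma nrmD x y : N (x + y) <= N x + N y.
Proof.
rewrite -(@ler_pXn2r _ 2%N)// ?nnegrE ?addr_ge0 ?nrm_ge0//.
rewrite nrm_sq !ipE (ipC hs y x) sqrrD !nrm_sq.
have := ip_le x y; lra.
Qed.

Lemma nrmB x y : N (x - y) <= N x + N y.
Proof. by rewrite -[N y]nrmN nrmD. Qed.

Lemma nrm_tri y x z : N (x - z) <= N (x - y) + N (y - z).
Proof. by rewrite -[x - z](subrKA y) nrmD. Qed.

Lemma nrm_le_tri x y : N x <= N (x - y) + N y.
Proof. by rewrite -{1}[x](subrK y) nrmD. Qed.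

Lemma nrm_le_sq x c : 0 <= c -> <<x, x>> <= c ^+ 2 -> N x <= c.
Proof. by move=> c0; rewrite -nrm_sq ler_pXn2r// nnegrE nrm_ge0. Qed.

Lemma nrm0_ip x y : N x = 0 -> <<x, y>> = 0.
Proof.
move=> x0; have := CauchySchwarz x y.
by rewrite x0 mul0r normr_le0 => /eqP.
Qed.

Lemma nrm_sum n (F : nat -> H) : N (\sum_(k < n) F k) <= \sum_(k < n) N (F k).
Proof.
elim: n => [|n IH]; first by rewrite !big_ord0 nrm0.
by rewrite !big_ord_recr/=; apply: le_trans (nrmD _ _) _; rewrite lerD2r.
Qed.

Lemma nrm_small x C : (forall e, 0 < e -> N x <= C * e) -> N x = 0.
Proof.
move=> h; apply/eqP; rewrite eq_le nrm_ge0 andbT.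
apply/ler_addgt0Pl => e e0; rewrite addr0.
have [C0|C0] := leP C 0.
  by have := h _ ltr01; have := nrm_ge0 x; lra.
by have := h (e / C) (divr_gt0 e0 C0); rewrite mulrCA divff ?mulr1// gt_eqF.
Qed.

Lemma tends_cst y : tends hs (fun=> y) y.
Proof. by move=> e e0; exists 0%N => n _; rewrite subrr nrm0. Qed.

Lemma tendsD (x x' : nat -> H) y y' : tends hs x y -> tends hs x' y' ->
  tends hs (fun n => x n + x' n) (y + y').
Proof.
move=> h h' e e0; have e2 : 0 < e / 2 by lra.
have [n1 h1] := h _ e2; have [n2 h2] := h' _ e2.
exists (maxn n1 n2) => n; rewrite geq_max => /andP[/h1 {}h1 /h2 {}h2].
by rewrite opprD addrACA; apply: le_lt_trans (nrmD _ _) _; lra.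
Qed.

Lemma tendsZ a (x : nat -> H) y : tends hs x y -> tends hs (fun n => a *: x n) (a *: y).
Proof.
move=> h e e0; have c0 : 0 < `|a| + 1 by have := normr_ge0 a; lra.
have [n0 h0] := h _ (divr_gt0 e0 c0).
exists n0 => n /h0; rewrite -scalerBr nrmZ ltr_pdivlMr// => h1.
by apply: le_lt_trans h1; rewrite mulrC ler_wpM2l ?nrm_ge0//; lra.
Qed.

Lemma tends_sub (x : nat -> H) y (k : nat -> nat) : (forall n, (n <= k n)%N) ->
  tends hs x y -> tends hs (x \o k) y.
Proof.
move=> hk h e /h[n0 h0]; exists n0 => n nn.
by apply: h0; exact: leq_trans nn (hk n).
Qed.

Lemma tends_le (x : nat -> H) y C : tends hs x y -> (forall n, N (x n) <= C) -> N y <= C.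
Proof.
move=> h hC; apply/ler_addgt0Pl => e /h[n0 /(_ n0 (leqnn _))] h0.
have := nrm_le_tri y (x n0); have := hC n0; rewrite nrmBC in h0; lra.
Qed.

Lemma tends_uniq (x : nat -> H) y z : tends hs x y -> tends hs x z -> N (y - z) = 0.
Proof.
move=> hy hz; apply: (@nrm_small _ 2) => e e0.
have [n1 h1] := hy _ e0; have [n2 h2] := hz _ e0.
have := nrm_tri (x (maxn n1 n2)) y z.
have := h1 _ (leq_maxl n1 n2); have := h2 _ (leq_maxr n1 n2).
rewrite (nrmBC y (x _)); lra.
Qed.

Lemma tends_ext (x x' : nat -> H) y : (forall n, N (x n - x' n) = 0) ->
  tends hs x y -> tends hs x' y.
Proof.
move=> xx h e /h[n0 h0]; exists n0 => n /h0.
have := nrm_tri (x n) (x' n) y; rewrite (nrmBC (x' n) (x n)) xx; lra.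
Qed.

(** A Cauchy sequence has a geometrically fast subsequence, and a Cauchy
    sequence converges along with any of its subsequences. *)
Lemma hilbert_complete (x : nat -> H) :
  (forall e, 0 < e -> exists n0, forall n m, (n0 <= n)%N -> (n0 <= m)%N ->
     N (x n - x m) <= e) ->
  exists y, tends hs x y.
Proof.
move=> cx.
have q0 n : 0 < (1 / 4 : R) ^+ n by rewrite exprn_gt0//; lra.
have /choice[k0 hk0] n : exists n0, forall i j, (n0 <= i)%N -> (n0 <= j)%N ->
    N (x i - x j) <= (1 / 4) ^+ n by exact: cx (q0 n).
pose k := fix k n := if n is m.+1 then maxn (k m).+1 (k0 n) else k0 0%N.
have k0k n : (k0 n <= k n)%N by case: n => //= n; rewrite leq_maxr.
have kS n : (k n < k n.+1)%N by rewrite /= leq_maxl.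
have kn n : (n <= k n)%N by elim: n => // n IH; exact: leq_ltn_trans IH (kS n).
have fast n : <<x (k n.+1) - x (k n), x (k n.+1) - x (k n)>> <= (1 / 16) ^+ n.
  have -> : (1 / 16 : R) = (1 / 4) ^+ 2 by field.
  rewrite -nrm_sq -exprM mulnC exprM.
  rewrite ler_pXn2r ?nnegrE ?nrm_ge0// ?(ltW (q0 _))//.
  by apply: hk0 (k0k n); exact: leq_trans (k0k n) (ltnW (kS n)).
have [y hy] := ip_fast fast; exists y => e e0.
have e2 : 0 < e / 2 by lra.
have [n1 h1] := cx _ e2.
have [n2 h2] := hy _ (exprn_gt0 2 e2).
exists n1 => n nn.
have /h2 : (n2 <= maxn n1 n2)%N by rewrite leq_maxr.
rewrite -nrm_sq ltr_pXn2r ?nnegrE ?nrm_ge0// ?(ltW e2)// => h3.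
have := nrm_tri (x (k (maxn n1 n2))) (x n) y.
have : (n1 <= k (maxn n1 n2))%N by rewrite (leq_trans _ (kn _))// leq_maxl.
by move=> /(h1 _ _ nn); lra.
Qed.

End hilbert_theory.

(** * Orthogonality, Riesz representation and coercive forms *)

Definition subspace (R : realType) (H : lmodType R) (P : H -> Prop) :=
  P 0 /\ forall a x y, P x -> P y -> P (a *: x + y).

Definition closed_in (R : realType) (H : lmodType R) (hs : hilbert H)
    (P : H -> Prop) :=
  forall (x : nat -> H) y, (forall n, P (x n)) -> tends hs x y -> P y.

Definition linear_form (R : realType) (H : lmodType R) (l : H -> R) :=
  forall a x y, l (a *: x + y) = a * l x + l y.

Section riesz.
Context {R : realType} {H : lmodType R} (hs : hilbert H).
Local Notation "<< x , y >>" := (ip hs x y).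
Local Notation N := (nrm hs).
Implicit Types (x y z : H) (a : R) (P : H -> Prop).

Lemma subspaceD P x y : subspace P -> P x -> P y -> P (x + y).
Proof. by move=> [_ h] Px Py; rewrite -[x]scale1r; exact: h. Qed.

Lemma subspaceZ P a x : subspace P -> P x -> P (a *: x).
Proof. by move=> [P0 h] Px; rewrite -[a *: x]addr0; exact: h. Qed.

Lemma subspaceB P x y : subspace P -> P x -> P y -> P (x - y).
Proof.
by move=> sP Px Py; rewrite -scaleN1r; apply: subspaceD => //; exact: subspaceZ.
Qed.

Lemma linear_formD l x y : linear_form l -> l (x + y : H) = l x + l y :> R.
Proof. by move=> h; rewrite -[x]scale1r h mul1r scale1r. Qed.

Lemma linear_form0 l : linear_form l -> l (0 : H) = 0 :> R.
Proof. by move=> h; have := linear_formD 0 0 h; rewrite addr0; lra. Qed.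

Lemma linear_formZ l a x : linear_form l -> l (a *: x : H) = a * l x :> R.
Proof. by move=> h; rewrite -[a *: x]addr0 h linear_form0// addr0. Qed.

Lemma linear_formB l x y : linear_form l -> l (x - y : H) = l x - l y :> R.
Proof.
by move=> h; rewrite linear_formD// -scaleN1r linear_formZ// mulN1r.
Qed.

Lemma quad_ge0_lin0 (V b : R) :
  (forall t, 0 <= t ^+ 2 * V + 2 * t * b) -> 0 <= V -> b = 0.
Proof.
move=> h V0; have V1 : 0 < V + 1 by lra.
have := h (- b / (V + 1)).
have -> : (- b / (V + 1)) ^+ 2 * V + 2 * (- b / (V + 1)) * b
  = - (b ^+ 2 * (V + 2) / (V + 1) ^+ 2) by field; lra.
rewrite oppr_ge0 => h1; apply/eqP; rewrite -sqrf_eq0; apply/eqP/le_anti.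
rewrite sqr_ge0 andbT; move: h1.
by rewrite pmulr_lle0 ?invr_gt0 ?exprn_gt0// pmulr_lle0//; lra.
Qed.

(** The minimiser over [P] of [<<x, x>> - 2 l x]: minimising sequences are
    Cauchy by the parallelogram identity. *)
Theorem riesz P l C : subspace P -> closed_in hs P -> linear_form l ->
  (forall x, l x <= C * N x) ->
  exists2 y, P y & forall v, P v -> <<y, v>> = l v.
Proof.
move=> sP cP ll lC.
pose J x := <<x, x>> - 2 * l x.
have Jlow x : - C ^+ 2 <= J x.
  rewrite /J -nrm_sq; have := lC x; have := sqr_ge0 (N x - C).
  by rewrite sqrrB; lra.
pose A := [set J x | x in P].
have A0 : A !=set0 by exists (J 0), 0 => //; exact: sP.1.
have Alb : has_lbound A by exists (- C ^+ 2) => _ [x _ <-].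
have hA : has_inf A by [].
pose m := inf A.
have mJ x : P x -> m <= J x by move=> Px; apply: ge_inf => //; exists x.
have /choice[x hx] (n : nat) : exists x, P x /\ J x < m + n.+1%:R^-1.
  have n0 : 0 < n.+1%:R^-1 :> R by rewrite invr_gt0.
  by have [_ [x Px <-] Jx] := inf_adherent n0 hA; exists x.
have par y z : P y -> P z -> <<y - z, y - z>> <= 2 * (J y - m) + 2 * (J z - m).
  move=> Py Pz.
  have := mJ _ (subspaceZ 2^-1 sP (subspaceD sP Py Pz)).
  rewrite /J !ipE (ipC hs z y) linear_formZ// linear_formD//; lra.
have small (e : R) : 0 < e -> exists n0, forall n, (n0 <= n)%N -> n.+1%:R^-1 < e.
  move=> e0; have [n0 _ h] := near_infty_natSinv_lt (PosNum e0).
  by exists n0 => n /h.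
have [y hy] : exists y, tends hs x y.
  apply: hilbert_complete => e e0.
  have e1 : 0 < e ^+ 2 / 4 by rewrite divr_gt0 ?exprn_gt0.
  have [n0 h0] := small _ e1.
  exists n0 => i j /h0 hi /h0 hj; apply: nrm_le_sq; first exact: ltW.
  have [Pi Ji] := hx i; have [Pj Jj] := hx j.
  have := par _ _ Pi Pj.
  move: (i.+1%:R^-1) (j.+1%:R^-1) Ji Jj hi hj => a b; lra.
have Py : P y by apply: cP hy => n; case: (hx n).
exists y => // v Pv; apply/eqP; rewrite -subr_eq0; apply/eqP.
apply: (@quad_ge0_lin0 <<v, v>>); last exact: ip_ge0.
move=> t; apply/ler_addgt0Pl => e e0.
have k0 : 0 < 1 + 2 * `|t| * N v.
  by rewrite ltr_wpDr// mulr_ge0 ?nrm_ge0// mulr_ge0.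
have e1 := divr_gt0 e0 k0.
have [n1 h1] := small _ e1.
have [n2 h2] := hy _ e1.
have [Pn Jn] := hx (maxn n1 n2).
have := h1 _ (leq_maxl n1 n2); have := h2 _ (leq_maxr n1 n2).
set xn := x (maxn n1 n2) in Pn Jn *; set d := e / _ in e1 *; move=> d1 d2.
have := mJ _ (subspaceD sP Pn (subspaceZ t sP Pv)).
rewrite /J !ipE linear_formD// linear_formZ// (ipC hs v xn) => Jt.
have : t * <<xn - y, v>> <= `|t| * (d * N v).
  apply: le_trans (ler_norm _) _; rewrite normrM ler_wpM2l//.
  apply: le_trans (CauchySchwarz _ _ _) _; rewrite ler_wpM2r ?nrm_ge0//.
  exact: ltW.
have ed : e = d * (1 + 2 * `|t| * N v) by rewrite /d divfK// gt_eqF.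
rewrite ipBl ed; rewrite /J in Jn.
move: (_.+1%:R^-1) Jn d2 => a Jn d2; nra.
Qed.

Lemma contraction_fixpoint P (Phi : H -> H) q x0 :
  closed_in hs P -> P x0 -> (forall x, P x -> P (Phi x)) -> 0 <= q < 1 ->
  (forall x y, P x -> P y -> N (Phi x - Phi y) <= q * N (x - y)) ->
  exists2 x, P x & N (Phi x - x) = 0.
Proof.
move=> cP P0 PP /andP[q0 q1] con.
pose u n := iter n Phi x0.
have Pu n : P (u n) by elim: n => //= n IH; exact: PP.
pose D := N (u 0%N - u 1%N).
have D0 : 0 <= D by exact: nrm_ge0.
have step n : N (u n - u n.+1) <= q ^+ n * D.
  elim: n => [|n IH]; first by rewrite expr0 mul1r.
  apply: le_trans (con _ _ (Pu n) (Pu n.+1)) _.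
  by rewrite exprS -mulrA ler_wpM2l.
have tail k n : N (u n - u (n + k)%N) <= q ^+ n * D / (1 - q).
  elim: k n => [|k IH] n.
    rewrite addn0 subrr nrm0 divr_ge0 ?subr_ge0 ?(ltW q1)//.
    by rewrite mulr_ge0// exprn_ge0.
  apply: le_trans (nrm_tri hs (u n.+1) _ _) _; rewrite addnS -addSn.
  apply: le_trans (lerD (step n) (IH n.+1)) _.
  rewrite le_eqVlt; apply/orP; left; apply/eqP; rewrite exprS; field; lra.
have sm e : 0 < e -> exists n0, forall n, (n0 <= n)%N -> q ^+ n * D / (1 - q) < e.
  move=> e0; have [||n0 h0] := @expr_small _ q (D / (1 - q)) e => //.
    by rewrite q0.
  by exists n0 => n /h0; rewrite mulrC mulrA.
have [y hy] : exists y, tends hs u y.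
  apply: hilbert_complete => e e0; have [n0 h0] := sm _ e0; exists n0.
  move=> n m nn nm; wlog nm' : n m nn nm / (n <= m)%N.
    move=> w; case/orP: (leq_total n m) => h; first exact: w.
    by rewrite nrmBC; exact: w.
  by rewrite -(subnKC nm') (le_trans (tail _ _))// ltW// h0.
have Py := cP _ _ Pu hy.
exists y => //; apply: (@nrm_small _ _ _ _ 2) => e e0.
have [n0 h0] := hy _ e0.
have := nrm_tri hs (u n0.+1) (Phi y) y.
have := con _ _ Py (Pu n0); have := h0 _ (leqnn n0); have := h0 _ (leqnSn n0).
have := nrm_ge0 hs (u n0 - y); rewrite (nrmBC hs y (u n0)) /=; nra.
Qed.

(** Lax-Milgram: Riesz turns the form into an operator [T], and a small step
    of [u - r (T u - f)] is a contraction by coercivity. *)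
Theorem lax_milgram P b l C M : subspace P -> closed_in hs P ->
  (forall x, linear_form (b x)) -> (forall y, linear_form (b ^~ y)) ->
  (forall x y, b x y <= M * N x * N y) ->
  (forall x, <<x, x>> <= b x x) -> 1 <= M ->
  linear_form l -> (forall x, l x <= C * N x) ->
  exists2 u, P u & forall v, P v -> b u v = l v.
Proof.
move=> sP cP bl br bM bc M1 ll lC.
have [f Pf hf] := riesz sP cP ll lC.
have /choice[T hT] u : exists w, P w /\ forall v, P v -> <<w, v>> = b u v.
  by have [w Pw hw] := riesz sP cP (bl u) (bM u); exists w.
have M0 : M != 0 by rewrite gt_eqF// (lt_le_trans ltr01).
pose r := M ^- 2.
have r0 : 0 < r by rewrite invr_gt0 exprn_gt0// (lt_le_trans ltr01).
have r1 : r <= 1 by rewrite invf_le1 ?exprn_gt0 ?exprn_ege1//; lra.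
pose q := Num.sqrt (1 - r).
have q1 : 0 <= q < 1.
  by rewrite sqrtr_ge0/= -[ltRHS]sqrtr1 ltr_sqrt//; lra.
pose Phi u := u - r *: (T u - f).
have PPhi x : P x -> P (Phi x).
  move=> Px; apply: subspaceB => //; apply: subspaceZ => //.
  by apply: subspaceB => //; case: (hT x).
have con x y : P x -> P y -> N (Phi x - Phi y) <= q * N (x - y).
  move=> Px Py; pose z := x - y; pose w := T x - T y.
  have -> : Phi x - Phi y = z - r *: w.
    have BACA (p s t c : H) : p - s - (t - c) = p - t - (s - c).
      by rewrite !opprB !addrA [LHS]addrAC [RHS]addrAC [p - s - t]addrAC.
    by rewrite /Phi BACA -scalerBr (BACA (T x)) subrr subr0.
  have [PTx hTx] := hT x; have [PTy hTy] := hT y.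
  have Pz : P z by exact: subspaceB.
  have Pw : P w by exact: subspaceB.
  have wv v : P v -> <<w, v>> = b z v.
    by move=> Pv; rewrite ipBl hTx// hTy// (linear_formB x y (br v)).
  have wM : N w <= M * N z.
    have [w0|w0] := eqVneq (N w) 0.
      by rewrite w0 mulr_ge0 ?nrm_ge0//; lra.
    have w1 : 0 < N w by rewrite lt_neqAle eq_sym w0 nrm_ge0.
    by rewrite -(ler_pM2r w1) -expr2 nrm_sq wv.
  have w2 : <<w, w>> <= M ^+ 2 * <<z, z>>.
    rewrite -!nrm_sq -exprMn ler_pXn2r ?nnegrE ?nrm_ge0//.
    by rewrite mulr_ge0 ?nrm_ge0//; lra.
  apply: nrm_le_sq; first by rewrite mulr_ge0 ?nrm_ge0// sqrtr_ge0.
  rewrite exprMn sqr_sqrtr ?subr_ge0// nrm_sq ip_subZ (ipC hs z w) wv//.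
  have : r * (r * <<w, w>>) <= r * <<z, z>>.
    rewrite ler_wpM2l ?(ltW r0)//; apply: le_trans (ler_wpM2l (ltW r0) w2) _.
    by rewrite mulrA mulVf ?mul1r// expf_neq0.
  have := bc z; move: (b z z) <<z, z>> <<w, w>> r0 => bz zz ww r0.
  by clear -r0; nra.
have [u Pu fu] := contraction_fixpoint cP sP.1 PPhi q1 con.
exists u => // v Pv; have [PT hTu] := hT u.
rewrite -hTu// -hf//; apply/eqP; rewrite -subr_eq0 -ipBl; apply/eqP.
apply: nrm0_ip; move: fu.
rewrite /Phi addrC addKr nrmN nrmZ => /eqP; rewrite mulf_eq0 => /orP[|/eqP//].
by rewrite normr_eq0 gt_eqF.
Qed.

End riesz.

(** * Products and rescalings of Hilbert spaces *)

Section products.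
Context {R : realType} {Ha Hb : lmodType R} (ha : hilbert Ha) (hb : hilbert Hb).

Definition prod_ip (x y : Ha * Hb) : R := ip ha x.1 y.1 + ip hb x.2 y.2.

Lemma prod_ipC x y : prod_ip x y = prod_ip y x.
Proof. by rewrite /prod_ip ipC (ipC hb). Qed.

Lemma prod_ipP a x y z : prod_ip (a *: x + y) z = a * prod_ip x z + prod_ip y z.
Proof. by rewrite /prod_ip /= !ipP; ring. Qed.

Lemma prod_ip_ge0 x : 0 <= prod_ip x x.
Proof. by rewrite addr_ge0 ?ip_ge0. Qed.

Lemma prod_ip_fast (x : nat -> Ha * Hb) :
  (forall n, prod_ip (x n.+1 - x n) (x n.+1 - x n) <= (1 / 16) ^+ n) ->
  exists y, forall e, 0 < e ->
    exists n0, forall n, (n0 <= n)%N -> prod_ip (x n - y) (x n - y) < e.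
Proof.
move=> h.
have [|y1 h1] := @ip_fast _ _ ha (fun n => (x n).1).
  by move=> n; apply: le_trans (h n); rewrite lerDl ip_ge0.
have [|y2 h2] := @ip_fast _ _ hb (fun n => (x n).2).
  by move=> n; apply: le_trans (h n); rewrite lerDr ip_ge0.
exists (y1, y2) => e e0; have e2 : 0 < e / 2 by lra.
have [n1 k1] := h1 _ e2; have [n2 k2] := h2 _ e2.
exists (maxn n1 n2) => n; rewrite geq_max => /andP[/k1 {}k1 /k2 {}k2].
by rewrite /prod_ip/=; lra.
Qed.

Definition prod_hilbert : hilbert (Ha * Hb)%type :=
  Hilbert prod_ipC prod_ipP prod_ip_ge0 prod_ip_fast.

Lemma nrm_fst x : nrm ha x.1 <= nrm prod_hilbert x.
Proof. by rewrite ler_wsqrtr// lerDl ip_ge0. Qed.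

Lemma nrm_snd x : nrm hb x.2 <= nrm prod_hilbert x.
Proof. by rewrite ler_wsqrtr// lerDr ip_ge0. Qed.

Lemma tends_fst x y : tends prod_hilbert x y -> tends ha (fst \o x) y.1.
Proof.
by move=> h e /h[n0 h0]; exists n0 => n /h0; exact: le_lt_trans (nrm_fst _).
Qed.

Lemma tends_snd x y : tends prod_hilbert x y -> tends hb (snd \o x) y.2.
Proof.
by move=> h e /h[n0 h0]; exists n0 => n /h0; exact: le_lt_trans (nrm_snd _).
Qed.

End products.

Section scaling.
Context {R : realType} {H : lmodType R} (c : R) (c0 : 0 < c) (hs : hilbert H).

Definition scale_ip (x y : H) : R := c * ip hs x y.

Lemma scale_ipC x y : scale_ip x y = scale_ip y x.
Proof. by rewrite /scale_ip ipC. Qed.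

Lemma scale_ipP a x y z :
  scale_ip (a *: x + y) z = a * scale_ip x z + scale_ip y z.
Proof. by rewrite /scale_ip ipP; ring. Qed.

Lemma scale_ip_ge0 x : 0 <= scale_ip x x.
Proof. by rewrite mulr_ge0 ?ip_ge0 ?(ltW c0). Qed.

Lemma scale_ip_fast (x : nat -> H) :
  (forall n, scale_ip (x n.+1 - x n) (x n.+1 - x n) <= (1 / 16) ^+ n) ->
  exists y, forall e, 0 < e ->
    exists n0, forall n, (n0 <= n)%N -> scale_ip (x n - y) (x n - y) < e.
Proof.
move=> h; pose s := Num.sqrt c.
have s0 : 0 < s by rewrite sqrtr_gt0.
have sc : c = s ^+ 2 by rewrite sqr_sqrtr ?(ltW c0).
have [|y hy] := @ip_fast _ _ hs (fun n => s *: x n).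
  move=> n; apply: le_trans (h n).
  by rewrite -scalerBr ipZl ipZr mulrA -expr2 -sc.
exists (s^-1 *: y) => e /hy[n0 h0]; exists n0 => n /h0.
have -> : s *: x n - y = s *: (x n - s^-1 *: y).
  by rewrite scalerBr scalerA divff ?gt_eqF// scale1r.
by rewrite ipZl ipZr mulrA -expr2 -sc.
Qed.

Definition scale_hilbert : hilbert H :=
  Hilbert scale_ipC scale_ipP scale_ip_ge0 scale_ip_fast.

End scaling.

Section real_line.
Context {R : realType}.

Lemma geometric_cvg (C : R) (x : nat -> R) : 0 <= C ->
  (forall n, `|x n.+1 - x n| <= C * (1 / 2) ^+ n) ->
  exists y, forall n, `|x n - y| <= 2 * C * (1 / 2) ^+ n.
Proof.
move=> C0 h.
have q0 n : 0 <= (1 / 2 : R) ^+ n by rewrite exprn_ge0.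
have tail k n : `|x n - x (n + k)%N| <= 2 * C * (1 / 2) ^+ n.
  elim: k n => [|k IH] n.
    by rewrite addn0 subrr normr0 !mulr_ge0.
  rewrite -(subrKA (x n.+1)) addnS -addSn.
  apply: le_trans (ler_normD _ _) _.
  apply: le_trans (lerD _ (IH n.+1)) _; first by rewrite distrC; exact: h.
  by rewrite exprS; have := mulr_ge0 C0 (q0 n); lra.
have tail2 n m : (n <= m)%N -> `|x n - x m| <= 2 * C * (1 / 2) ^+ n.
  by move=> nm; rewrite -(subnKC nm).
have /cauchy_cvgP cx : cauchy (x @ \oo).
  apply: cauchy_exP => e e0.
  have [|n0 h0] := @expr_small _ (1 / 2) (2 * C) e _ e0; first lra.
  exists (x n0); exists n0 => // n /= n0n.
  by rewrite /ball/= (le_lt_trans (tail2 _ _ n0n))// h0.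
exists (lim (x @ \oo)) => n.
have : `|x n - x m| @[m --> \oo] --> `|x n - lim (x @ \oo)|.
  by apply: cvg_norm; apply: cvgB => //; exact: cvg_cst.
move=> /(@cvg_lim _ _ _) <-//.
apply: limr_le.
  apply: is_cvg_norm; apply: is_cvgB => //; exact: is_cvg_cst.
by exists n => // m /= /tail2.
Qed.

Definition real_ip (x y : R^o) : R := x * y.

Lemma real_fast (x : nat -> R^o) :
  (forall n, real_ip (x n.+1 - x n) (x n.+1 - x n) <= (1 / 16) ^+ n) ->
  exists y : R^o, forall e, 0 < e ->
    exists n0, forall n, (n0 <= n)%N -> real_ip (x n - y) (x n - y) < e.
Proof.
move=> h; have q0 n : 0 <= (1 / 2 : R) ^+ n by rewrite exprn_ge0.
have [//|n|y hy] := @geometric_cvg 1 x.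
  rewrite mul1r -(@ler_pXn2r _ 2%N)// ?nnegrE//.
  rewrite real_normK ?num_real// expr2; apply: le_trans (h n) _.
  rewrite -exprM mulnC exprM; apply: lerXn2r; rewrite ?nnegrE; lra.
exists y => e e0.
have [|n0 h0] := @expr_small _ (1 / 4) 4 e _ e0; first lra.
exists n0 => n /h0; apply: le_lt_trans.
rewrite /real_ip -expr2 -real_normK ?num_real//.
have -> : 4 * (1 / 4) ^+ n = (2 * 1 * (1 / 2) ^+ n) ^+ 2 :> R.
  rewrite mulr1 [RHS]exprMn -exprM mulnC exprM; congr (_ * _); first by ring.
  by congr (_ ^+ _); field.
by rewrite ler_pXn2r// nnegrE mulr_ge0// mulr_ge0.
Qed.

Lemma real_ipC x y : real_ip x y = real_ip y x.
Proof. exact: mulrC. Qed.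

Lemma real_ipP (a : R) (x y z : R^o) :
  real_ip (a *: x + y) z = a * real_ip x z + real_ip y z.
Proof. by rewrite /real_ip mulrDl mulrA. Qed.

Lemma real_ip_ge0 x : 0 <= real_ip x x.
Proof. by rewrite /real_ip -expr2 sqr_ge0. Qed.

Definition real_hilbert : hilbert R^o :=
  Hilbert real_ipC real_ipP real_ip_ge0 real_fast.

End real_line.

Lemma lin_sub (R : realType) (H : lmodType R) (a : R) (p q s u : H) :
  a *: (p - s) + (q - u) = a *: p + q - (a *: s + u).
Proof. by rewrite scalerBr opprD addrACA. Qed.

Lemma lin_add (R : realType) (H : lmodType R) (a : R) (p q s u : H) :
  a *: (p + s) + (q + u) = a *: p + q + (a *: s + u).
Proof. by rewrite scalerDr addrACA. Qed.

(** * Coercive complex forms *)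

Section coercive_pair.
Context {R : realType} {Ha Hb : lmodType R} (ha : hilbert Ha) (hb : hilbert Hb).
Local Notation hab := (prod_hilbert ha hb).
Local Notation N := (nrm hab).

(** Writing [z = x + i y], the two equations say that [K z + i P z] represents
    the complex functional [l1 + i l2], where [P] and [K] are the forms of the
    two factors.  Multiplying by [1 - i] makes the real part of the form equal
    to the full inner product [P + K], hence coercive. *)
Theorem complex_riesz (V : Ha * Hb -> Prop) l1 l2 C : subspace V ->
  closed_in hab V -> linear_form l1 -> linear_form l2 ->
  (forall z, l1 z <= C * N z) -> (forall z, l2 z <= C * N z) ->
  exists x y, [/\ V x, V y & forall t, V t ->
    ip hb x.2 t.2 - ip ha y.1 t.1 = l1 t /\
    ip ha x.1 t.1 + ip hb y.2 t.2 = l2 t].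
Proof.
move=> sV cV ll1 ll2 b1 b2.
pose VV (z : (Ha * Hb) * (Ha * Hb)) := V z.1 /\ V z.2.
pose e1 (x y t : Ha * Hb) := ip hb x.2 t.2 - ip ha y.1 t.1.
pose e2 (x y t : Ha * Hb) := ip ha x.1 t.1 + ip hb y.2 t.2.
pose b (z t : (Ha * Hb) * (Ha * Hb)) :=
  e1 z.1 z.2 (t.1 - t.2) + e2 z.1 z.2 (t.1 + t.2).
pose l (t : (Ha * Hb) * (Ha * Hb)) := l1 (t.1 - t.2) + l2 (t.1 + t.2).
pose hh := prod_hilbert hab hab.
have sVV : subspace VV.
  split; first by split; exact: sV.1.
  by move=> a x y [x1 x2] [y1 y2]; split; exact: sV.2.
have cVV : closed_in hh VV.
  move=> x y Vx xy; split.
    by apply: (cV _ _ _ (tends_fst xy)) => n; case: (Vx n).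
  by apply: (cV _ _ _ (tends_snd xy)) => n; case: (Vx n).
have nD (t : (Ha * Hb) * (Ha * Hb)) : N (t.1 + t.2) <= 2 * nrm hh t.
  by apply: le_trans (nrmD _ _ _) _; have := nrm_fst hab hab t;
     have := nrm_snd hab hab t; lra.
have nB (t : (Ha * Hb) * (Ha * Hb)) : N (t.1 - t.2) <= 2 * nrm hh t.
  by apply: le_trans (nrmB _ _ _) _; have := nrm_fst hab hab t;
     have := nrm_snd hab hab t; lra.
have bound (x t : Ha * Hb) (z s : (Ha * Hb) * (Ha * Hb)) :
    N x <= nrm hh z -> N t <= 2 * nrm hh s ->
    `|ip ha x.1 t.1| <= 2 * (nrm hh z * nrm hh s) /\
    `|ip hb x.2 t.2| <= 2 * (nrm hh z * nrm hh s).
  move=> xz ts; rewrite mulrCA; split; apply: le_trans (CauchySchwarz _ _ _) _;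
    apply: ler_pM; rewrite ?nrm_ge0//.
  - exact: le_trans (nrm_fst _ _ _) xz.
  - exact: le_trans (nrm_fst _ _ _) ts.
  - exact: le_trans (nrm_snd _ _ _) xz.
  - exact: le_trans (nrm_snd _ _ _) ts.
have [|||||||z [Vz1 Vz2] hz] :=
    @lax_milgram _ _ hh VV b l (4 * `|C|) 8 sVV cVV.
- by move=> z a x y; rewrite /b /e1 /e2 /= !ipE; ring.
- by move=> z a x y; rewrite /b /e1 /e2 /= !ipE; ring.
- move=> z t; rewrite /b /e1 /e2.
  have z1 := nrm_fst hab hab z; have z2 := nrm_snd hab hab z.
  have [p1 p2] := bound _ _ _ _ z1 (nB t).
  have [q1 q2] := bound _ _ _ _ z2 (nB t).
  have [p3 p4] := bound _ _ _ _ z1 (nD t).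
  have [q3 q4] := bound _ _ _ _ z2 (nD t).
  rewrite -mulrA; move: (nrm hh z * nrm hh t) p1 p2 p3 p4 q1 q2 q3 q4 => p.
  move: (ip ha _ _) (ip hb _ _) (ip ha _ _) (ip hb _ _) (ip ha _ _) (ip hb _ _)
    (ip ha _ _) (ip hb _ _) => a1 a2 a3 a4 a5 a6 a7 a8.
  rewrite !ler_norml; clear.
  move=> /andP[? ?] /andP[? ?] /andP[? ?] /andP[? ?] /andP[? ?] /andP[? ?].
  move=> /andP[? ?] /andP[? ?].
  lra.
- move=> z; rewrite /b /e1 /e2 /= /prod_ip /= !ipE.
  rewrite (ipC ha z.2.1 z.1.1) (ipC hb z.2.2 z.1.2) /=.
  rewrite /prod_ip; lra.
- lra.
- move=> a x y; have := ll1 a (x.1 - x.2) (y.1 - y.2).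
  have := ll2 a (x.1 + x.2) (y.1 + y.2); rewrite lin_sub lin_add /l /= => -> ->.
  by ring.
- move=> t; rewrite /l.
  have k : forall s, N s <= 2 * nrm hh t -> C * N s <= 2 * `|C| * nrm hh t.
    move=> s st; apply: le_trans (_ : `|C| * N s <= _).
      by rewrite ler_wpM2r ?nrm_ge0// ler_norm.
    by rewrite -[leRHS]mulrA mulrCA ler_wpM2l.
  have -> : 4 * `|C| * nrm hh t = 2 * `|C| * nrm hh t + 2 * `|C| * nrm hh t.
    by ring.
  by apply: lerD; [apply: le_trans (b1 _) _|apply: le_trans (b2 _) _]; exact: k.
exists z.1, z.2; split=> // t Vt.
have tt : 2^-1 *: t + 2^-1 *: t = t.
  rewrite -scalerDl; have -> : 2^-1 + 2^-1 = 1 :> R by field.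
  by rewrite scale1r.
have Vt2 := subspaceZ 2^-1 sV Vt.
have e10 x y : e1 x y 0 = 0 by rewrite /e1 /= !ip0r subrr.
have e20 x y : e2 x y 0 = 0 by rewrite /e2 /= !ip0r addr0.
split.
  have := hz (2^-1 *: t, - (2^-1 *: t)); rewrite /b /l /=.
  rewrite opprK subrr tt e20 (linear_form0 ll2) !addr0; apply.
  by split=> //=; rewrite -sub0r; exact: subspaceB sV.1 Vt2.
have := hz (2^-1 *: t, 2^-1 *: t); rewrite /b /l /=.
by rewrite subrr tt e10 (linear_form0 ll1) !add0r; apply.
Qed.

End coercive_pair.

(** * Riemann integrals of vector-valued functions *)

Section overlap.
Context {R : realType}.
Implicit Types a b q : R.

(** Length of the intersection of [[a, b]] and [[a', b']]. *)
Definition overlap a b a' b' : R :=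
  Num.max 0 (Num.min b b' - Num.max a a').

Lemma overlapC a b a' b' : overlap a b a' b' = overlap a' b' a b.
Proof. by rewrite /overlap (minC b) (maxC a). Qed.

Lemma overlap_ge0 a b a' b' : 0 <= overlap a b a' b'.
Proof. by rewrite le_max lexx. Qed.

Lemma overlap_clamp a b q q' : a <= b -> q <= q' ->
  overlap a b q q' = Num.min (Num.max q' a) b - Num.min (Num.max q a) b.
Proof.
move=> ab qq; rewrite /overlap /Num.min /Num.max.
case: (ltP b q') => ?; case: (ltP a q) => ?; case: (ltP q' a) => ?;
  case: (ltP q a) => ?; try lra; case: ltP => ?; try lra; case: ltP => ?;
  try lra; case: ltP => ?; lra.
Qed.

Lemma le_chain (p : nat -> R) n : (forall k, (k < n)%N -> p k <= p k.+1) ->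
  p 0%N <= p n.
Proof.
elim: n => // n IH h; apply: le_trans (h _ (ltnSn n)).
by apply: IH => k kn; apply: h; rewrite ltnS ltnW.
Qed.

Lemma sum_overlap a b (q : nat -> R) n : a <= b ->
  (forall k, (k < n)%N -> q k <= q k.+1) -> q 0%N <= a -> b <= q n ->
  \sum_(j < n) overlap a b (q j) (q j.+1) = b - a.
Proof.
move=> ab qm q0 qn.
rewrite (eq_bigr (fun j : 'I_n => Num.min (Num.max (q j.+1) a) b -
    Num.min (Num.max (q j) a) b)); last first.
  by move=> j _; apply: overlap_clamp => //; exact: qm.
rewrite -(big_mkord xpredT (fun j => Num.min (Num.max (q j.+1) a) b -
    Num.min (Num.max (q j) a) b)) telescope_sumr//.
rewrite (max_r q0) (min_l ab); congr (_ - _).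
by rewrite max_l ?(le_trans ab)// min_r.
Qed.

End overlap.

Section riemann.
Context {R : realType} {H : lmodType R} (hs : hilbert H).
Local Notation N := (nrm hs).
Implicit Types (U : R -> H) (J : H) (p c q d : nat -> R) (t e : R).

Definition tagged n p c e t :=
  [/\ p 0%N = 0, p n = t &
    forall k, (k < n)%N -> p k <= c k <= p k.+1 /\ p k.+1 - p k < e].

Definition rsum n p c U : H := \sum_(k < n) (p k.+1 - p k) *: U (c k).

Definition is_rint U t J := forall e, 0 < e -> exists2 d, 0 < d &
  forall n p c, tagged n p c d t -> N (rsum n p c U - J) < e.

(** Continuity and differentiability are relative to the half line of
    nonnegative times. *)
Definition contH U t := forall e, 0 < e -> exists2 d, 0 < d &
  forall s, 0 <= s -> `|s - t| < d -> N (U s - U t) < e.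

Definition derH U t (V : H) := forall e, 0 < e -> exists2 d, 0 < d &
  forall s, 0 <= s -> `|s - t| < d ->
    N (U s - U t - (s - t) *: V) <= e * `|s - t|.

Lemma tagged_mono n p c e t : tagged n p c e t ->
  forall k, (k < n)%N -> p k <= p k.+1.
Proof. by move=> [_ _ h] k /h[/andP[+ +] _]; exact: le_trans. Qed.

Lemma tagged_sub n p c e e' t : e <= e' -> tagged n p c e t ->
  tagged n p c e' t.
Proof.
move=> ee [p0 pn h]; split=> // k /h[pc pe]; split=> //.
exact: lt_le_trans pe ee.
Qed.

Lemma le_chain_from (p : nat -> R) n i : (i <= n)%N ->
  (forall k, (k < n)%N -> p k <= p k.+1) -> p 0%N <= p i /\ p i <= p n.
Proof.
move=> iN h; split.
  by apply: le_chain => k ki; apply: h; exact: leq_trans ki iN.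
have := @le_chain _ (fun k => p (i + k)%N) (n - i).
rewrite addn0 subnKC//; apply => k ki; rewrite addnS; apply: h.
by rewrite -ltn_subRL.
Qed.

Lemma tagged_range n p c e t k : tagged n p c e t -> (k < n)%N ->
  0 <= c k <= t.
Proof.
move=> tg kn; have [p0 pn h] := tg; have m := tagged_mono tg.
have [/andP[h1 h2] _] := h _ kn.
have [h3 _] := le_chain_from (ltnW kn) m.
have [_ h4] := le_chain_from kn m.
by rewrite -p0 -pn (le_trans h3 h1) (le_trans h2 h4).
Qed.

Lemma tagged_uniform t e : 0 <= t -> 0 < e ->
  exists n, tagged n.+1 (fun k => t * (k%:R / n.+1%:R))
    (fun k => t * (k%:R / n.+1%:R)) e t.
Proof.
move=> t0 e0.
have [n hn] : exists n : nat, t / e < n.+1%:R.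
  exists (Num.truncn (t / e)); exact: truncnS_gt.
exists n; have n0 : 0 < n.+1%:R :> R by rewrite ltr0n.
split; first by rewrite mul0r mulr0.
  by rewrite divff ?mulr1// gt_eqF.
move=> k kn; have tk : t * (k.+1%:R / n.+1%:R) - t * (k%:R / n.+1%:R) =
    t / n.+1%:R.
  by rewrite -mulrBr -mulrBl -natrB ?subSnn ?mul1r.
split; last by rewrite tk ltr_pdivrMr// mulrC -ltr_pdivrMr.
by rewrite lexx/= -subr_ge0 tk divr_ge0// ltW.
Qed.

(** Two Riemann sums are compared term by term on the pairwise intersections of
    their intervals, which avoids building a common refinement. *)
Lemma rsum_close n p c m q d e e' C t U :
  tagged n p c e t -> tagged m q d e' t ->
  (forall s s', 0 <= s <= t -> 0 <= s' <= t -> `|s - s'| < e + e' ->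
     N (U s - U s') <= C) ->
  N (rsum n p c U - rsum m q d U) <= C * t.
Proof.
move=> tp tq hU.
have mp := tagged_mono tp; have mq := tagged_mono tq.
have [p0 pn hp] := tp; have [q0 qm hq] := tq.
pose ov (k j : nat) := overlap (p k) (p k.+1) (q j) (q j.+1).
have sp (k : 'I_n) : \sum_(j < m) ov k j = p k.+1 - p k.
  apply: sum_overlap => //; first exact: mp.
    by rewrite q0 -p0; exact: (le_chain_from (ltnW (ltn_ord k)) mp).1.
  by rewrite qm -pn; exact: (le_chain_from (ltn_ord k) mp).2.
have sq (j : 'I_m) : \sum_(k < n) ov k j = q j.+1 - q j.
  under eq_bigr do rewrite /ov overlapC.
  apply: sum_overlap => //; first exact: mq.
    by rewrite p0 -q0; exact: (le_chain_from (ltnW (ltn_ord j)) mq).1.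
  by rewrite pn -qm; exact: (le_chain_from (ltn_ord j) mq).2.
have -> : rsum n p c U - rsum m q d U =
    \sum_(k < n) \sum_(j < m) ov k j *: (U (c k) - U (d j)).
  rewrite /rsum (eq_bigr (fun k : 'I_n => \sum_(j < m) ov k j *: U (c k))).
    rewrite [X in _ - X](eq_bigr (fun j : 'I_m =>
        \sum_(k < n) ov k j *: U (d j))).
      rewrite [X in _ - X]exchange_big/= -sumrB; apply: eq_bigr => k _.
      by rewrite -sumrB; apply: eq_bigr => j _; rewrite scalerBr.
    by move=> j _; rewrite -scaler_suml sq.
  by move=> k _; rewrite -scaler_suml sp.
apply: le_trans (nrm_sum hs n (fun k =>
  \sum_(j < m) ov k j *: (U (c k) - U (d j)))) _.
have -> : C * t = \sum_(k < n) C * (p k.+1 - p k).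
  rewrite -mulr_sumr -(big_mkord xpredT (fun k => p k.+1 - p k)).
  by rewrite telescope_sumr// pn p0 subr0.
apply: ler_sum => k _.
apply: le_trans (nrm_sum hs m (fun j => ov k j *: (U (c k) - U (d j)))) _.
rewrite -sp mulr_sumr; apply: ler_sum => j _.
rewrite nrmZ ger0_norm ?overlap_ge0// [leRHS]mulrC.
have [ov0|ov0] := eqVneq (ov k j) 0; first by rewrite ov0 !mul0r.
rewrite ler_wpM2l ?overlap_ge0//; apply: hU.
- exact: tagged_range tp (ltn_ord k).
- exact: tagged_range tq (ltn_ord j).
have [/andP[k1 k2] k3] := hp _ (ltn_ord k).
have [/andP[j1 j2] j3] := hq _ (ltn_ord j).
have : 0 < ov k j by rewrite lt_neqAle eq_sym ov0 overlap_ge0.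
rewrite /ov /overlap lt_max ltxx/= subr_gt0 lt_min !gt_max.
move=> /andP[/andP[a1 a2] /andP[a3 a4]].
rewrite ltr_norml; apply/andP; split; lra.
Qed.

Lemma rint_exists U t : 0 <= t ->
  (forall e, 0 < e -> exists2 d, 0 < d & forall s s', 0 <= s <= t ->
     0 <= s' <= t -> `|s - s'| < d -> N (U s - U s') <= e) ->
  exists J, is_rint U t J.
Proof.
move=> t0 uc.
have k0 : 0 < t + 1 by lra.
have mod e : 0 < e -> exists2 d, 0 < d & forall n p c m q g,
    tagged n p c d t -> tagged m q g d t ->
    N (rsum n p c U - rsum m q g U) <= e.
  move=> e0; have [d d0 hd] := uc _ (divr_gt0 e0 k0).
  exists (d / 2); first lra.
  move=> n p c m q g tp tq.
  apply: le_trans (rsum_close (C := e / (t + 1)) tp tq _) _.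
    by move=> s s' h1 h2 h3; apply: hd => //; lra.
  by rewrite mulrAC ler_pdivrMr// ler_wpM2l ?(ltW e0)//; lra.
have /choice[f hf] (n : nat) : exists u, exists m p c,
    u = rsum m p c U /\ tagged m p c (n.+1%:R^-1) t.
  have n0 : 0 < n.+1%:R^-1 :> R by rewrite invr_gt0.
  have [m hm] := tagged_uniform t0 n0.
  by eexists; exists m.+1; eexists; eexists; split; [reflexivity|exact: hm].
have small (e : R) : 0 < e -> exists n0, forall n, (n0 <= n)%N -> n.+1%:R^-1 < e.
  move=> e0; have [n0 _ h] := near_infty_natSinv_lt (PosNum e0).
  by exists n0 => n /h.
have [J hJ] : exists J, tends hs f J.
  apply: hilbert_complete => e e0; have [d d0 hd] := mod _ e0.
  have [n0 h0] := small _ d0; exists n0 => i j /h0 hi /h0 hj.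
  have [mi [pi [ci [-> ti]]]] := hf i; have [mj [pj [cj [-> tj]]]] := hf j.
  by apply: hd; [exact: tagged_sub (ltW hi) ti|exact: tagged_sub (ltW hj) tj].
exists J => e e0; have e2 : 0 < e / 2 by lra.
have [d d0 hd] := mod _ e2; exists d => // n p c tp.
have [n1 h1] := hJ _ e2; have [n2 h2] := small _ d0.
have := h1 _ (leq_maxl n1 n2); have := h2 _ (leq_maxr n1 n2).
have [mi [pi [ci [-> ti]]]] := hf (maxn n1 n2).
move=> dl; have := nrm_tri hs (rsum mi pi ci U) (rsum n p c U) J.
by have := hd _ _ _ _ _ _ tp (tagged_sub (ltW dl) ti); lra.
Qed.

Lemma rsumB n p c U U' :
  rsum n p c (fun s => U s - U' s) = rsum n p c U - rsum n p c U'.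
Proof. by rewrite /rsum -sumrB; apply: eq_bigr => k _; rewrite scalerBr. Qed.

Lemma rintB U U' t J J' : is_rint U t J -> is_rint U' t J' ->
  is_rint (fun s => U s - U' s) t (J - J').
Proof.
move=> h h' e e0; have e2 : 0 < e / 2 by lra.
have [d d0 hd] := h _ e2; have [d' d'0 hd'] := h' _ e2.
exists (Num.min d d'); first by rewrite lt_min d0.
move=> n p c tg; rewrite rsumB.
have -> : rsum n p c U - rsum n p c U' - (J - J') =
  (rsum n p c U - J) - (rsum n p c U' - J').
  by rewrite !opprB !addrA [LHS]addrAC [RHS]addrAC [_ - J - _]addrAC.
apply: le_lt_trans (nrmB _ _ _) _.
have := hd _ _ _ (tagged_sub _ tg); have := hd' _ _ _ (tagged_sub _ tg).
by rewrite !ge_min !lexx orbT => /(_ isT) + /(_ isT); lra.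
Qed.

Lemma rsum_le n p c e t U z C : tagged n p c e t ->
  (forall s, 0 <= s <= t -> N (U s - z) <= C) ->
  N (rsum n p c U - t *: z) <= C * t.
Proof.
move=> tg hC; have [p0 pn h] := tg.
have tE : \sum_(k < n) (p k.+1 - p k) = t.
  rewrite -(big_mkord xpredT (fun k => p k.+1 - p k)).
  by rewrite telescope_sumr// pn p0 subr0.
rewrite -{1 2}tE scaler_suml /rsum -sumrB mulr_sumr.
under eq_bigr do rewrite -scalerBr.
apply: le_trans (nrm_sum hs n (fun k => (p k.+1 - p k) *: (U (c k) - z))) _.
apply: ler_sum => k _; rewrite nrmZ ger0_norm.
  by rewrite mulrC ler_wpM2r ?subr_ge0 ?(tagged_mono tg)//;
    apply: hC; exact: tagged_range tg _.
by rewrite subr_ge0 (tagged_mono tg).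
Qed.

Lemma rint_le U t J C : 0 <= t -> is_rint U t J ->
  (forall s, 0 <= s <= t -> N (U s) <= C) -> N J <= C * t.
Proof.
move=> t0 hJ hC; apply/ler_addgt0Pl => e e0.
have [d d0 hd] := hJ _ e0; have [n tg] := tagged_uniform t0 d0.
have := hd _ _ _ tg; set S := rsum _ _ _ _ => h1.
have : N (S - t *: 0) <= C * t.
  by apply: rsum_le tg _ => s /hC; rewrite subr0.
by rewrite scaler0 subr0; have := nrm_le_tri hs J S; rewrite nrmBC; lra.
Qed.

(** A partition of [[0, a]] extended by one of [[a, b]] gives Riemann sums over
    [[0, b]] whose first part cancels. *)
Lemma rint_increment U a b Ja Jb z C : 0 <= a -> a <= b ->
  is_rint U a Ja -> is_rint U b Jb ->
  (forall s, a <= s <= b -> N (U s - z) <= C) ->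
  N (Jb - Ja - (b - a) *: z) <= C * (b - a).
Proof.
move=> a0 ab hJa hJb hC; apply/ler_addgt0Pl => e e0.
have e2 : 0 < e / 2 by lra.
have [d1 d10 h1] := hJa _ e2; have [d2 d20 h2] := hJb _ e2.
pose d := Num.min d1 d2.
have d0 : 0 < d by rewrite lt_min d10.
have dd1 : d <= d1 by rewrite ge_min lexx.
have dd2 : d <= d2 by rewrite ge_min lexx orbT.
have ba0 : 0 <= b - a by lra.
have [n tn] := tagged_uniform a0 d0; have [m tm] := tagged_uniform ba0 d0.
set pn := fun k : nat => _ in tn; set pm := fun k : nat => _ in tm.
pose p k := if (k <= n.+1)%N then pn k else a + pm (k - n.+1)%N.
have pS k : p (n.+1 + k)%N = a + pm k.
  rewrite /p; case: k => [|k]; last by rewrite addnS ltnNge leq_addr/= -addnS addKn.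
  by rewrite addn0 leqnn; have [_ -> _] := tn; have [-> _ _] := tm; rewrite addr0.
have tp : tagged (n.+1 + m.+1) p p d b.
  split.
  - by rewrite /p/=; have [-> _ _] := tn.
  - by rewrite pS; have [_ -> _] := tm; rewrite subrKC.
  move=> k kn; have [kn1|kn1] := ltnP k n.+1.
    rewrite /p (ltnW kn1) kn1; have [_ _ /(_ _ kn1)] := tn; done.
  rewrite -(subnKC kn1) -addnS !pS.
  have km : (k - n.+1 < m.+1)%N by rewrite ltn_subLR.
  have [_ _ /(_ _ km)[/andP[m1 m2] m3]] := tm.
  by rewrite !lerD2l m1 m2; split=> //; rewrite opprD addrACA subrr add0r.
have S2 : rsum (n.+1 + m.+1) p p U =
    rsum n.+1 pn pn U + rsum m.+1 pm pm (fun s => U (a + s)).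
  rewrite /rsum big_split_ord/=; congr (_ + _); apply: eq_bigr => i _ /=.
    by rewrite /p (ltnW (ltn_ord i)) (ltn_ord i).
  by rewrite -addnS !pS opprD addrACA subrr add0r.
have := h1 _ _ _ (tagged_sub dd1 tn); have := h2 _ _ _ (tagged_sub dd2 tp).
have : N (rsum m.+1 pm pm (fun s => U (a + s)) - (b - a) *: z) <= C * (b - a).
  by apply: rsum_le tm _ => s /andP[s1 s2]; apply: hC; apply/andP; split; lra.
rewrite S2; move: (rsum _ _ _ _) (rsum _ _ _ _) ((b - a) *: z) => Y X Z hX hXY hY.
have -> : Jb - Ja - Z = (X - Z) + ((Y - Ja) - (Y + X - Jb)).
  have -> : Y - Ja - (Y + X - Jb) = Jb - Ja - X.
    by rewrite opprB addrC opprD (addrA Jb) addrAC subrKA.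
  by rewrite [RHS]addrC subrKA.
have := nrmD hs (X - Z) ((Y - Ja) - (Y + X - Jb)).
have := nrmB hs (Y - Ja) (Y + X - Jb); lra.
Qed.

End riemann.

Section riemann_derivative.
Context {R : realType} {H : lmodType R} (hs : hilbert H).
Local Notation N := (nrm hs).

Lemma rint_derH (U J : R -> H) t :
  (forall s, 0 <= s -> is_rint hs U s (J s)) -> 0 <= t -> contH hs U t ->
  derH hs J t (U t).
Proof.
move=> hJ t0 cU e e0; have [d d0 hd] := cU _ e0; exists d => // s s0 sd.
have [ts|st] := leP t s.
  rewrite (ger0_norm (_ : 0 <= s - t)) ?subr_ge0//.
  apply: rint_increment (hJ _ t0) (hJ _ s0) _ => // r /andP[r1 r2].
  apply/ltW/hd; first lra.
  by move: sd; rewrite !ger0_norm; lra.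
have -> : J s - J t - (s - t) *: U t = - (J t - J s - (t - s) *: U t).
  by lmodule.
rewrite nrmN distrC (ger0_norm (_ : 0 <= t - s)) ?subr_ge0 ?(ltW st)//.
apply: rint_increment (hJ _ s0) (hJ _ t0) _ => //; first exact: ltW.
move=> r /andP[r1 r2]; apply/ltW/hd; first lra.
by move: sd; rewrite ![`|_ - t|]distrC !ger0_norm; lra.
Qed.

(** A quadratic error in the first order expansion of [U] makes the Riemann sums
    of its derivative telescope up to the mesh. *)
Lemma quadratic_rint (U V : R -> H) C t : 0 <= t -> 0 <= C ->
  (forall s r, 0 <= s -> 0 <= r ->
     N (U r - U s - (r - s) *: V s) <= C * (r - s) ^+ 2) ->
  is_rint hs V t (U t - U 0).
Proof.
move=> t0 C0 hC e e0.
have k0 : 0 < 2 * C * t + 1 by rewrite ltr_wpDl// !mulr_ge0.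
have [d d0 ed] : exists2 d, 0 < d & e = d * (2 * C * t + 1).
  by exists (e / (2 * C * t + 1)); rewrite ?divr_gt0// divfK// gt_eqF.
exists d => // n p c tg; have [p0 pn hp] := tg.
have step k : (k < n)%N ->
    N ((p k.+1 - p k) *: V (c k) - (U (p k.+1) - U (p k))) <=
    2 * C * d * (p k.+1 - p k).
  move=> kn; have [/andP[h1 h2] h3] := hp _ kn.
  have [a1 _] := le_chain_from (ltnW kn) (tagged_mono tg).
  rewrite p0 in a1.
  have a2 : 0 <= c k := le_trans a1 h1.
  have a3 : 0 <= p k.+1 := le_trans a2 h2.
  have b1 := hC _ _ a2 a3; have b2 := hC _ _ a2 a1.
  have -> : (p k.+1 - p k) *: V (c k) - (U (p k.+1) - U (p k)) =
      (U (p k) - U (c k) - (p k - c k) *: V (c k)) -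
      (U (p k.+1) - U (c k) - (p k.+1 - c k) *: V (c k)).
    by lmodule.
  apply: le_trans (nrmB _ _ _) _; apply: le_trans (lerD b2 b1) _.
  rewrite -mulrDr -!mulrA mulrCA ler_wpM2l//.
  have q1 : (p k - c k) ^+ 2 <= d * (p k.+1 - p k).
    rewrite -sqrrN opprB expr2; apply: ler_pM; lra.
  have q2 : (p k.+1 - c k) ^+ 2 <= d * (p k.+1 - p k).
    rewrite expr2; apply: ler_pM; lra.
  by lra.
have -> : U t - U 0 = \sum_(k < n) (U (p k.+1) - U (p k)).
  rewrite -(big_mkord xpredT (fun k => U (p k.+1) - U (p k))).
  by rewrite (@telescope_sumr _ 0 n (U \o p))//= pn p0.
rewrite /rsum -sumrB.
apply: le_lt_trans (nrm_sum hs n (fun k =>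
  (p k.+1 - p k) *: V (c k) - (U (p k.+1) - U (p k)))) _.
apply: le_lt_trans (ler_sum _ (fun (k : 'I_n) _ => step k (ltn_ord k))) _.
rewrite -mulr_sumr -(big_mkord xpredT (fun k => p k.+1 - p k)).
rewrite telescope_sumr// pn p0 subr0.
have -> : 2 * C * d * t = d * (2 * C * t) by ring.
by rewrite ed ltr_pM2l//; lra.
Qed.

End riemann_derivative.

(** * Semigroups generated by maximal dissipative operators *)

Section semigroup.
Context {R : realType} {H : lmodType R} (hs : hilbert H).
Local Notation "<< x , y >>" := (ip hs x y).
Local Notation N := (nrm hs).
Variable G : H -> H -> Prop.
Implicit Types (h k c : R) (x y z u v f a b : H).

(** The graph of a linear operator, seen up to elements of norm zero; [<<x, y>>]
    stands for the real part of the inner product. *)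
Definition maximal_dissipative :=
  [/\ (forall c x y x' y', G x y -> G x' y' -> G (c *: x + x') (c *: y + y')),
      (forall x y x' y', N (x - x') = 0 -> N (y - y') = 0 ->
         G x y -> G x' y'),
      (forall x y, G x y -> <<x, y>> <= 0),
      (forall h f, 0 < h -> exists x y, G x y /\ N (f - (x - h *: y)) = 0) &
      (forall x y, G x y -> N x = 0 -> N y = 0)].

Hypothesis mG : maximal_dissipative.

Lemma G_lin c x y x' y' : G x y -> G x' y' -> G (c *: x + x') (c *: y + y').
Proof. by case: mG => h _ _ _ _; exact: h. Qed.

Lemma G_ext x y x' y' : N (x - x') = 0 -> N (y - y') = 0 ->
  G x y -> G x' y'.
Proof. by case: mG => _ h _ _ _; exact: h. Qed.

Lemma G_diss x y : G x y -> <<x, y>> <= 0.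
Proof. by case: mG => _ _ h _ _; exact: h. Qed.

Lemma G_max h f : 0 < h -> exists x y, G x y /\ N (f - (x - h *: y)) = 0.
Proof. by case: mG => _ _ _ + _; exact. Qed.

Lemma G_00 : G 0 0.
Proof.
have [x [y [xy _]]] := G_max 0 ltr01.
by have := G_lin (-1) xy xy; rewrite !scaleN1r !addNr.
Qed.

Lemma G_Z c x y : G x y -> G (c *: x) (c *: y).
Proof. by move=> /(G_lin c) /(_ G_00); rewrite !addr0. Qed.

Lemma G_D x y x' y' : G x y -> G x' y' -> G (x + x') (y + y').
Proof. by move=> /(G_lin 1) /[apply]; rewrite !scale1r. Qed.

Lemma G_B x y x' y' : G x y -> G x' y' -> G (x - x') (y - y').
Proof. by move=> xy /(G_Z (-1)); rewrite !scaleN1r; exact: G_D. Qed.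

Lemma G_resolvent_le h x y : 0 <= h -> G x y ->
  N x <= N (x - h *: y) /\ h * N y <= N (x - h *: y).
Proof.
move=> h0 /G_diss xy.
have hxy : h * <<x, y>> <= 0 by rewrite mulr_ge0_le0.
split; first apply: nrm_le_sq; rewrite ?nrm_ge0//.
  rewrite nrm_sq ip_subZ.
  have := mulr_ge0 (sqr_ge0 h) (ip_ge0 hs y); lra.
rewrite -(@ler_pXn2r _ 2%N)// ?nnegrE ?mulr_ge0 ?nrm_ge0//.
by rewrite exprMn !nrm_sq ip_subZ; have := ip_ge0 hs x; lra.
Qed.

Lemma Jex h f : exists u, if 0 < h then G u (h^-1 *: (u - f)) else u = f.
Proof.
case: ltP => [h0|_]; last by exists f.
have [x [y [xy e]]] := G_max f h0; exists x.
apply: G_ext xy; first by rewrite subrr nrm0.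
have -> : y - h^-1 *: (x - f) = h^-1 *: (f - (x - h *: y)).
  have h1 : h != 0 by rewrite gt_eqF.
  by lmodule.
by rewrite nrmZ e mulr0.
Qed.

(** The resolvent [(1 - h A)^-1], extended by the identity at [h = 0] so that
    all estimates below hold for [h >= 0]. *)
Definition J h f : H :=
  xget 0 [set u | if 0 < h then G u (h^-1 *: (u - f)) else u = f].

Lemma JP h f : 0 < h -> G (J h f) (h^-1 *: (J h f - f)).
Proof.
move=> h0; have /(xgetPex 0) := Jex h f.
by rewrite -/(J h f) h0.
Qed.

Lemma J0 f : J 0 f = f.
Proof.
have /(xgetPex 0) := Jex 0 f.
by rewrite -/(J 0 f) ltxx.
Qed.

Lemma resolventK h u f : 0 < h -> u - h *: (h^-1 *: (u - f)) = f.
Proof. by move=> h0; rewrite scalerA divff ?gt_eqF// scale1r subKr. Qed.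

Lemma J_lin_le h c a b v : 0 <= h ->
  N (J h a - J h b - c *: J h v) <= N (a - b - c *: v).
Proof.
rewrite le_eqVlt => /predU1P[<-|h0]; first by rewrite !J0.
have := G_B (G_B (JP a h0) (JP b h0)) (G_Z c (JP v h0)).
move=> /(G_resolvent_le (ltW h0))[+ _].
have -> : h^-1 *: (J h a - a) - h^-1 *: (J h b - b) - c *: (h^-1 *: (J h v - v))
    = h^-1 *: (J h a - J h b - c *: J h v - (a - b - c *: v)).
  by lmodule.
by rewrite resolventK.
Qed.

Lemma J_contr h a b : 0 <= h -> N (J h a - J h b) <= N (a - b).
Proof.
move=> h0; have := J_lin_le 0 a b 0 h0.
by rewrite !scale0r !subr0.
Qed.

Lemma J_uniq h x y f : 0 <= h -> G x y -> N (J h f - x) <= N (f - (x - h *: y)).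
Proof.
rewrite le_eqVlt => /predU1P[<-|h0 xy]; first by rewrite J0 scale0r subr0.
have /(G_resolvent_le (ltW h0))[+ _] := G_B (JP f h0) xy.
have -> : J h f - x - h *: (h^-1 *: (J h f - f) - y) = f - (x - h *: y).
  have h1 : h != 0 by rewrite gt_eqF.
  by lmodule.
by [].
Qed.

Lemma J_graph h x y : 0 <= h -> G x y -> G (J h x) (J h y).
Proof.
rewrite le_eqVlt => /predU1P[<-|h0 xy]; first by rewrite !J0.
have h1 : h != 0 by rewrite gt_eqF.
have gw := G_B (JP x h0) xy.
apply: G_ext (JP x h0); first by rewrite subrr nrm0.
apply/eqP; rewrite eq_le nrm_ge0 andbT nrmBC.
have := J_uniq y (ltW h0) (G_Z h^-1 gw).
have -> : y - (h^-1 *: (J h x - x) - h *: (h^-1 *: (h^-1 *: (J h x - x) - y)))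
    = 0 by lmodule.
by rewrite nrm0 => /le_trans -> //; rewrite nrm_ge0.
Qed.

Lemma J_sub_id h x y : 0 <= h -> G x y -> N (J h x - x - h *: J h y) = 0.
Proof.
rewrite le_eqVlt => /predU1P[<-|h0] xy.
  by rewrite !J0 scale0r subr0 subrr nrm0.
apply/eqP; rewrite eq_le nrm_ge0 andbT.
have h1 : h != 0 by rewrite gt_eqF.
have := J_uniq x (ltW h0) (G_D xy (G_Z h (JP y h0))).
have -> : x - (x + h *: J h y - h *: (y + h *: (h^-1 *: (J h y - y)))) = 0.
  by lmodule.
by rewrite nrm0 opprD addrA.
Qed.

Lemma nrm_eq0_of x y : N (x - y) = 0 -> N x <= N y.
Proof. by move=> h; have := nrm_le_tri hs x y; rewrite h add0r. Qed.

Lemma J_le h f : 0 <= h -> N (J h f) <= N f.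
Proof.
by move=> h0; have := J_uniq f h0 G_00; rewrite scaler0 !subr0.
Qed.

Lemma J_move h x y : 0 <= h -> G x y -> N (J h x - x) <= h * N y.
Proof.
move=> h0 xy; apply: le_trans (nrm_eq0_of (J_sub_id h0 xy)) _.
by rewrite nrmZ ger0_norm// ler_wpM2l// J_le.
Qed.

(** The resolvent identity. *)
Lemma J_diff h k x y : 0 <= h -> 0 <= k -> G x y ->
  N (J h x - J k x - (h - k) *: J h (J k y)) = 0.
Proof.
move=> h0 k0 xy; have ab := J_graph k0 xy.
have h1 := J_lin_le k (J k x) x (J k y) h0; rewrite J_sub_id// in h1.
have h2 := J_sub_id h0 ab.
apply/eqP; rewrite eq_le nrm_ge0 andbT.
have -> : J h x - J k x - (h - k) *: J h (J k y) =
    (J h (J k x) - J k x - h *: J h (J k y)) -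
    (J h (J k x) - J h x - k *: J h (J k y)) by lmodule.
by apply: le_trans (nrmB _ _ _) _; rewrite h2 add0r.
Qed.

Lemma J_dist h k x y : 0 <= h -> 0 <= k -> G x y ->
  N (J h x - J k x) <= `|h - k| * N y.
Proof.
move=> h0 k0 xy; apply: le_trans (nrm_eq0_of (J_diff h0 k0 xy)) _.
by rewrite nrmZ ler_wpM2l// (le_trans (J_le _ _))// J_le.
Qed.

(** Halving the step changes one resolvent step by [O(h^2)] only. *)
Lemma J_half h x y z : 0 <= h -> G x y -> G y z ->
  N (J h x - J (h / 2) (J (h / 2) x)) <= (h / 2) ^+ 2 * N z.
Proof.
move=> h0 xy yz; pose k := h / 2; have k0 : 0 <= k by rewrite /k; lra.
have hk : h - k = k by rewrite /k; field.
have ab := J_graph k0 xy; have bc := J_graph k0 yz.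
have e1 := J_diff h0 k0 xy; have e2 := J_sub_id k0 ab.
have e3 := J_dist h0 k0 bc.
rewrite -/k; have -> : J h x - J k (J k x) =
   (J h x - J k x - (h - k) *: J h (J k y)) -
   (J k (J k x) - J k x - k *: J k (J k y)) +
   k *: (J h (J k y) - J k (J k y)).
  by rewrite hk; lmodule.
apply: le_trans (nrmD _ _ _) _.
have := nrmB hs (J h x - J k x - (h - k) *: J h (J k y))
   (J k (J k x) - J k x - k *: J k (J k y)).
rewrite e1 e2 addr0 => e4; rewrite -[leRHS]add0r; apply: lerD => //.
rewrite nrmZ ger0_norm// expr2 -mulrA ler_wpM2l//.
apply: le_trans e3 _.
by rewrite hk ger0_norm// ler_wpM2l// J_le.
Qed.

Definition Jn h n x : H := iter n (J h) x.

Lemma Jn_graph h n x y : 0 <= h -> G x y -> G (Jn h n x) (Jn h n y).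
Proof. by move=> h0 xy; elim: n => //= n IH; exact: J_graph. Qed.

Lemma Jn_le h n x : 0 <= h -> N (Jn h n x) <= N x.
Proof.
by move=> h0; elim: n => //= n IH; apply: le_trans (J_le _ _) IH.
Qed.

Lemma Jn_contr h n x y : 0 <= h -> N (Jn h n x - Jn h n y) <= N (x - y).
Proof.
by move=> h0; elim: n => //= n IH; apply: le_trans (J_contr _ _ _) IH.
Qed.

Lemma Jn_half h n x y z : 0 <= h -> G x y -> G y z ->
  N (Jn h n x - Jn (h / 2) n.*2 x) <= n%:R * ((h / 2) ^+ 2 * N z).
Proof.
move=> h0 xy yz; have k0 : 0 <= h / 2 by lra.
elim: n => [|n IH]; first by rewrite /= subrr nrm0 mul0r.
rewrite doubleS /=.
apply: le_trans (nrm_tri hs (J h (Jn (h / 2) n.*2 x)) _ _) _.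
rewrite -[n.+1%:R]natr1 mulrDl mul1r; apply: lerD.
  by apply: le_trans (J_contr _ _ _) IH.
apply: le_trans (J_half h0 (Jn_graph _ k0 xy) (Jn_graph _ k0 yz)) _.
by rewrite ler_wpM2l ?sqr_ge0// Jn_le.
Qed.

Lemma Jn_dist h k n x y : 0 <= h -> 0 <= k -> G x y ->
  N (Jn h n x - Jn k n x) <= n%:R * (`|h - k| * N y).
Proof.
move=> h0 k0 xy.
elim: n => [|n IH]; first by rewrite /= subrr nrm0 mul0r.
apply: le_trans (nrm_tri hs (J h (Jn k n x)) _ _) _.
rewrite -[n.+1%:R]natr1 mulrDl mul1r; apply: lerD.
  by apply: le_trans (J_contr _ _ _) IH.
apply: le_trans (J_dist h0 k0 (Jn_graph n k0 xy)) _.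
by rewrite ler_wpM2l// Jn_le.
Qed.

(** On the domain of the square, powers of two resolvents agree up to first
    order in the difference of the steps; the quadratic error is what makes the
    semigroup the Riemann integral of its derivative. *)
Lemma Jn_taylor h k n x y z : 0 <= h -> 0 <= k -> G x y -> G y z ->
  N (Jn h n x - Jn k n x - (n%:R * (h - k)) *: Jn k n y) <=
  `|h - k| * (n%:R ^+ 2 * `|h - k| + n%:R * h) * N z.
Proof.
move=> h0 k0 xy yz.
elim: n => [|n IH].
  by rewrite /= subrr mul0r scale0r subr0 nrm0 expr0n !mul0r addr0 mulr0 mul0r.
set u := Jn k n x in IH *; set v := Jn k n y in IH *; set w := Jn h n x in IH *.
have uv : G u v by exact: Jn_graph.
have vz : G v (Jn k n z) by exact: Jn_graph.
have e1 := J_lin_le (n%:R * (h - k)) w u v h0.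
have e2 := J_diff h0 k0 uv.
have e3 := J_dist h0 k0 vz.
have e4 := J_move h0 (J_graph k0 vz).
have nz : N (Jn k n z) <= N z by exact: Jn_le.
have e5 : N (J h v - J k v) <= `|h - k| * N z.
  by apply: le_trans e3 _; rewrite ler_wpM2l.
have e6 : N (J h (J k v) - J k v) <= h * N z.
  by apply: le_trans e4 _; rewrite ler_wpM2l// (le_trans (J_le _ _)).
rewrite /= -/u -/v -/w.
have -> : J h w - J k u - (n.+1%:R * (h - k)) *: J k v =
   (J h w - J h u - (n%:R * (h - k)) *: J h v) +
   (J h u - J k u - (h - k) *: J h (J k v)) +
   ((n%:R * (h - k)) *: (J h v - J k v) + (h - k) *: (J h (J k v) - J k v)).
  by rewrite -natr1; lmodule.
apply: le_trans (nrmD _ _ _) _.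
apply: le_trans (lerD (nrmD _ _ _) (nrmD _ _ _)) _.
rewrite e2 addr0 !nrmZ normrM normr_nat.
have m0 : 0 <= `|h - k| by [].
have n0 : 0 <= n%:R :> R by [].
have N0 := nrm_ge0 hs z.
apply: le_trans (lerD (le_trans e1 IH)
  (lerD (ler_wpM2l (mulr_ge0 n0 m0) e5) (ler_wpM2l m0 e6))) _.
rewrite -natr1.
move: `|h - k| (n%:R) (N z) m0 n0 N0 => m nn q m0 n0 N0; clear -m0 n0 N0 h0.
have := mulr_ge0 (mulr_ge0 m0 m0) N0.
have := mulr_ge0 n0 (mulr_ge0 (mulr_ge0 m0 m0) N0).
lra.
Qed.

(** The resolvent is a contraction and is defined everywhere: the solution [u]
    of [u - A u = a - b] is the limit of the solutions [x n] for [x n - y n]. *)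
Lemma G_closed (x y : nat -> H) a b : (forall n, G (x n) (y n)) ->
  tends hs x a -> tends hs y b -> G a b.
Proof.
move=> xy xa yb; have [u [w [uw e]]] := G_max (a - b) ltr01.
rewrite scale1r in e.
have au : N (u - a) = 0.
  apply: (@nrm_small _ _ _ _ 3) => d d0.
  have [n1 h1] := xa _ d0; have [n2 h2] := yb _ d0.
  have := h1 _ (leq_maxl n1 n2); have := h2 _ (leq_maxr n1 n2).
  move: (maxn n1 n2) => n; move=> h4 h3.
  have [+ _] := G_resolvent_le ler01 (G_B uw (xy n)); rewrite scale1r => h5.
  have := nrm_tri hs (x n) u a.
  have : N (u - x n - (w - y n)) <= N (a - b - (u - w)) + N (x n - a) + N (y n - b).
    rewrite -(nrmN _ (_ - _ - _)).
    have -> : - (u - x n - (w - y n)) =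
       (a - b - (u - w)) + (x n - a) - (y n - b) by lmodule.
    by apply: le_trans (nrmB _ _ _) _; rewrite lerD2r nrmD.
  rewrite e; lra.
apply: G_ext uw => //.
have := nrmB hs (u - a) (a - b - (u - w)); rewrite au e addr0.
have -> : u - a - (a - b - (u - w)) = (u - a) + (u - a) - (w - b) by lmodule.
move=> h6; have := nrmD hs (u - a) (u - a); rewrite au addr0 => h7.
apply/eqP; rewrite eq_le nrm_ge0 andbT.
have -> : w - b = (u - a + (u - a)) - (u - a + (u - a) - (w - b)) by lmodule.
by apply: le_trans (nrmB _ _ _) _; lra.
Qed.

(** A vector orthogonal to the domain is [u - A u] for some [u] in the domain;
    dissipativity gives [u = 0], and single-valuedness [A u = 0]. *)
Lemma G_dense a e : 0 < e -> exists x y, G x y /\ N (a - x) < e.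
Proof.
move=> e0; pose P v := forall e, 0 < e -> exists x y, G x y /\ N (v - x) < e.
suff : P a by apply.
have sP : subspace P.
  split; first by move=> d d0; exists 0, 0; rewrite subrr nrm0; split=> //; exact: G_00.
  move=> c v w Pv Pw d d0.
  have c0 : 0 < `|c| + 1 by have := normr_ge0 c; lra.
  have d1 : 0 < d / 2 by lra.
  have [x [y [xy hx]]] := Pv _ (divr_gt0 d1 c0).
  have [x' [y' [xy' hx']]] := Pw _ d1.
  exists (c *: x + x'), (c *: y + y'); split; first exact: G_lin.
  have -> : c *: v + w - (c *: x + x') = c *: (v - x) + (w - x') by lmodule.
  apply: le_lt_trans (nrmD _ _ _) _; rewrite nrmZ.
  have : `|c| * N (v - x) <= d / 2.
    rewrite mulrC; apply: le_trans (_ : N (v - x) * (`|c| + 1) <= _).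
      by rewrite ler_wpM2l ?nrm_ge0//; lra.
    by rewrite -ler_pdivlMr// ltW.
  lra.
have cP : closed_in hs P.
  move=> x v Px xv d d0; have d2 : 0 < d / 2 by lra.
  have [n0 /(_ _ (leqnn _)) h0] := xv _ d2.
  have [u [w [uw hu]]] := Px n0 _ d2; exists u, w; split => //.
  by apply: le_lt_trans (nrm_tri hs (x n0) _ _) _; rewrite nrmBC; lra.
have lin : linear_form (ip hs a) by move=> c x y; rewrite !ipE.
have bd x : <<a, x>> <= N a * N x by exact: ip_le.
have [q Pq hq] := riesz sP cP lin bd.
have [u [w [uw hu]]] := G_max (a - q) ltr01; rewrite scale1r in hu.
have Pu : P u by move=> d d0; exists u, w; rewrite subrr nrm0.
have uz : N u = 0.
  have := nrm0_ip u hu; rewrite !ipBl hq// subrr sub0r => /eqP.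
  rewrite oppr_eq0 subr_eq0 (ipC hs w) => /eqP uu.
  apply/eqP; rewrite eq_le nrm_ge0 andbT; apply: nrm_le_sq => //.
  by rewrite expr0n/= uu; exact: G_diss.
have wz : N w = 0 by case: mG => _ _ _ _ h; exact: h uw uz.
move=> d d0; have [x [y [xy hx]]] := Pq _ d0; exists x, y; split => //.
apply: le_lt_trans hx; apply: nrm_eq0_of.
have -> : a - x - (q - x) = (a - q - (u - w)) + (u - w) by lmodule.
apply/eqP; rewrite eq_le nrm_ge0 andbT.
apply: le_trans (nrmD _ _ _) _; rewrite hu add0r.
by apply: le_trans (nrmB _ _ _) _; rewrite uz wz addr0.
Qed.

(** The resolvent with a small step maps the domain into the domain of the
    square and moves [x] and, by density, [y] only a little. *)
Lemma G_core x y e : 0 < e -> G x y -> exists x' y' z',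
  [/\ G x' y', G y' z', N (x - x') < e & N (y - y') < e].
Proof.
move=> e0 xy; have e4 : 0 < e / 4 by lra.
have [u [w [uw hu]]] := G_dense y e4.
have c0 : 0 < N y + N w + 1 by have := nrm_ge0 hs y; have := nrm_ge0 hs w; lra.
have h0 := divr_gt0 e4 c0; set h := e / 4 / _ in h0.
have hc : h * (N y + N w + 1) = e / 4 by rewrite /h divfK// gt_eqF.
exists (J h x), (J h y), (h^-1 *: (J h y - y)); split.
- exact: J_graph (ltW h0) xy.
- exact: JP.
- rewrite nrmBC; apply: le_lt_trans (J_move (ltW h0) xy) _.
  have := mulr_ge0 (ltW h0) (nrm_ge0 hs w); lra.
have k1 := J_contr y u (ltW h0); have k2 := J_move (ltW h0) uw.
have k3 := nrm_tri hs u y (J h y); have k4 := nrm_tri hs (J h u) u (J h y).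
rewrite (nrmBC hs u (J h u)) (nrmBC hs (J h u) (J h y)) in k4.
have := mulr_ge0 (ltW h0) (nrm_ge0 hs y); lra.
Qed.

Lemma G_dense2 a e : 0 < e -> exists x y z, [/\ G x y, G y z & N (a - x) < e].
Proof.
move=> e0; have e2 : 0 < e / 2 by lra.
have [x [y [xy hx]]] := G_dense a e2.
have [x' [y' [z' [x'y' y'z' hx' _]]]] := G_core e2 xy.
exists x', y', z'; split => //.
by apply: le_lt_trans (nrm_tri hs x _ _) _; lra.
Qed.

End semigroup.

Section exponential_formula.
Context {R : realType} {H : lmodType R} (hs : hilbert H).
Local Notation "<< x , y >>" := (ip hs x y).
Local Notation N := (nrm hs).
Variable G : H -> H -> Prop.
Hypothesis mG : maximal_dissipative hs G.
Implicit Types (h k c t s r : R) (x y z u v f a b : H).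

Local Notation Jn := (Jn G).

(** Powers of two, so that each approximation is compared with the next one by
    halving all its steps. *)
Definition euler t x (n : nat) : H := Jn (t / 2 ^+ n) (2 ^ n) x.

Lemma pow2_gt0 n : 0 < 2 ^+ n :> R. Proof. by rewrite exprn_gt0. Qed.

Lemma euler_step_ge0 t n : 0 <= t -> 0 <= t / 2 ^+ n.
Proof. by move=> t0; rewrite divr_ge0// ltW// pow2_gt0. Qed.

Lemma euler_halving t n x y z : 0 <= t -> G x y -> G y z ->
  N (euler t x n - euler t x n.+1) <= t ^+ 2 / 4 * N z * (1 / 2) ^+ n.
Proof.
move=> t0 xy yz.
have := Jn_half mG (2 ^ n) (euler_step_ge0 n t0) xy yz.
rewrite -mul2n -expnS /euler.
have -> : t / 2 ^+ n / 2 = t / 2 ^+ n.+1.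
  by rewrite exprSr invfM mulrA.
move/le_trans; apply; rewrite natrX le_eqVlt; apply/orP; left; apply/eqP.
rewrite div1r exprVn (exprSr _ n); have := pow2_gt0 n.
by move: (2 ^+ n) (N z) => p q p0; field; rewrite gt_eqF.
Qed.

Lemma euler_cvg t x : 0 <= t -> exists u, tends hs (euler t x) u.
Proof.
move=> t0; apply: hilbert_complete => e e0; have e4 : 0 < e / 4 by lra.
have [x' [y' [z' [xy yz xx]]]] := G_dense2 mG x e4.
pose C := t ^+ 2 / 4 * N z'.
have C0 : 0 <= C by rewrite mulr_ge0 ?nrm_ge0// divr_ge0// sqr_ge0.
have q0 n : 0 <= (1 / 2 : R) ^+ n by rewrite exprn_ge0.
have tail (m n : nat) : N (euler t x' n - euler t x' (n + m)%N) <= 2 * C * (1 / 2) ^+ n.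
  elim: m n => [|m IH] n.
    by rewrite addn0 subrr nrm0 mulr_ge0// mulr_ge0.
  rewrite addnS -addSn.
  apply: le_trans (nrm_tri hs (euler t x' n.+1) _ _) _.
  apply: le_trans (lerD (euler_halving n t0 xy yz) (IH n.+1)) _.
  rewrite -/C (exprS _ n); have := mulr_ge0 C0 (q0 n); lra.
have [|n0 h0] := @expr_small _ (1 / 2) (2 * C) _ _ e4; first lra.
exists n0 => n m nn nm.
have tl i : (n0 <= i)%N -> N (euler t x' n0 - euler t x' i) <= e / 4.
  by move=> ni; rewrite -(subnKC ni) (le_trans (tail _ _))// ltW// h0.
have ct i : N (euler t x i - euler t x' i) <= e / 4.
  by apply: le_trans (Jn_contr mG _ _ _ (euler_step_ge0 _ t0)) _; exact: ltW.
have := ct n; have := ct m; have := tl _ nn; have := tl _ nm.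
(* the four errors of size [e / 4] along x_n, x'_n, x'_n0, x'_m, x_m *)
have -> : euler t x n - euler t x m =
   (euler t x n - euler t x' n) - (euler t x' n0 - euler t x' n)
   + ((euler t x' n0 - euler t x' m) - (euler t x m - euler t x' m)).
  by lmodule.
have := nrmD hs ((euler t x n - euler t x' n) - (euler t x' n0 - euler t x' n))
   ((euler t x' n0 - euler t x' m) - (euler t x m - euler t x' m)).
have := nrmB hs (euler t x n - euler t x' n) (euler t x' n0 - euler t x' n).
have := nrmB hs (euler t x' n0 - euler t x' m) (euler t x m - euler t x' m).
lra.
Qed.

Definition S t x : H := xget 0 [set u | tends hs (euler t x) u].

Lemma S_tends t x : 0 <= t -> tends hs (euler t x) (S t x).
Proof. by move=> /(euler_cvg x) /(xgetPex 0). Qed.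

Lemma S_0 x : N (S 0 x - x) = 0.
Proof.
apply: tends_uniq (S_tends x (lexx 0)) _.
apply: tends_ext (tends_cst hs x) => n.
rewrite /euler mul0r; elim: (2 ^ n)%N => [|m IH]; first by rewrite subrr nrm0.
by rewrite /= (J0 mG).
Qed.

Lemma S_graph t x y : 0 <= t -> G x y -> G (S t x) (S t y).
Proof.
move=> t0 xy; apply: (G_closed mG _ (S_tends x t0) (S_tends y t0)) => n.
by apply: (Jn_graph mG _ _ xy); exact: euler_step_ge0.
Qed.

Lemma S_contr t x y : 0 <= t -> N (S t x - S t y) <= N (x - y).
Proof.
move=> t0.
have h := tendsD (S_tends x t0) (tendsZ (-1) (S_tends y t0)).
rewrite scaleN1r in h; apply: tends_le h _ => n; rewrite scaleN1r.
by apply: (Jn_contr mG); exact: euler_step_ge0.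
Qed.

Lemma euler_stepB t s n :
  (2 ^ n)%:R * `|t / 2 ^+ n - s / 2 ^+ n| = `|t - s|.
Proof.
have p0 := pow2_gt0 n.
rewrite natrX -mulrBl normrM [`|_^-1|]gtr0_norm ?invr_gt0//.
by rewrite mulrC divfK// gt_eqF.
Qed.

Lemma S_lipschitz t s x y : 0 <= t -> 0 <= s -> G x y ->
  N (S t x - S s x) <= `|t - s| * N y.
Proof.
move=> t0 s0 xy.
have h := tendsD (S_tends x t0) (tendsZ (-1) (S_tends x s0)).
rewrite scaleN1r in h; apply: tends_le h _ => n; rewrite scaleN1r.
apply: le_trans (Jn_dist mG _ (euler_step_ge0 _ t0) (euler_step_ge0 _ s0) xy) _.
by rewrite mulrA euler_stepB.
Qed.

Lemma S_taylor t s x y z : 0 <= t -> 0 <= s -> G x y -> G y z ->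
  N (S t x - S s x - (t - s) *: S s y) <= N z * (t - s) ^+ 2.
Proof.
move=> t0 s0 xy yz; apply/ler_addgt0Pr => e e0.
have h := tendsD (S_tends x t0) (tendsZ (-1) (S_tends x s0)).
have {}h := tendsD h (tendsZ (- (t - s)) (S_tends y s0)).
rewrite scaleN1r scaleNr in h.
have [|n0 h0] := @expr_small _ (1 / 2) (`|t - s| * t * N z) _ _ e0; first lra.
apply: tends_le (tends_sub (fun n => leq_addl n0 n) h) _ => n /=.
have := Jn_taylor mG (2 ^ (n0 + n)) (euler_step_ge0 (n0 + n) t0)
  (euler_step_ge0 (n0 + n) s0) xy yz.
have := h0 (n0 + n)%N (leq_addr _ _).
have ts : (2 ^ (n0 + n))%:R * (t / 2 ^+ (n0 + n) - s / 2 ^+ (n0 + n)) = t - s.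
  by rewrite natrX -mulrBl mulrC divfK// gt_eqF// pow2_gt0.
have nts := euler_stepB t s (n0 + n).
have nt : (2 ^ (n0 + n))%:R * (t / 2 ^+ (n0 + n)) = t.
  by rewrite natrX mulrC divfK// gt_eqF// pow2_gt0.
have pw : (1 / 2) ^+ (n0 + n) * (2 ^ (n0 + n))%:R = 1 :> R.
  by rewrite natrX div1r exprVn mulVf// gt_eqF// pow2_gt0.
rewrite ts scaleN1r scaleNr -/(euler t x (n0 + n)) -/(euler s x (n0 + n)).
rewrite -/(euler s y (n0 + n)) => small /le_trans; apply.
move: nts nt pw small; clear.
move: `|t / _ - _| => d; move: (t / _) ((2 ^ _)%:R) ((1 / 2) ^+ _).
move=> h P q dP hP qP small.
have -> : (t - s) ^+ 2 = `|t - s| ^+ 2 by rewrite real_normK ?num_real.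
rewrite -dP; have -> : P ^+ 2 * d + P * h = P * (P * d) + t by rewrite hP; ring.
have -> : d * (P * (P * d) + t) * N z = N z * (P * d) ^+ 2 + d * t * N z by ring.
rewrite lerD2l; apply/ltW; apply: le_lt_trans small.
rewrite -dP le_eqVlt; apply/orP; left; apply/eqP.
have -> : P * d * t * N z * q = (q * P) * (d * t * N z) by ring.
by rewrite qP mul1r.
Qed.

Lemma S_uniform_cont x e : 0 < e -> exists2 d, 0 < d & forall s r, 0 <= s ->
  0 <= r -> `|s - r| < d -> N (S s x - S r x) <= e.
Proof.
move=> e0; have e4 : 0 < e / 4 by lra.
have [x' [y [xy xx]]] := G_dense mG x e4.
have c0 : 0 < N y + 1 by have := nrm_ge0 hs y; lra.
exists (e / 4 / (N y + 1)); first exact: divr_gt0.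
move=> s r s0 r0; rewrite ltr_pdivlMr// => sr.
have := S_contr x x' s0; have := S_contr x x' r0.
have := S_lipschitz s0 r0 xy.
have := nrm_tri hs (S s x') (S s x) (S r x).
have := nrm_tri hs (S r x') (S s x') (S r x).
rewrite (nrmBC hs (S r x') (S r x)).
move: (N (S s x - S s x')) (N (S r x - S r x')) (N (S s x' - S r x))
  (N (S s x - S r x)) (N (S s x' - S r x')) (N (x - x')) (N y) `|s - r|
  xx e0 sr (normr_ge0 (s - r)) => a b c d f g k l; clear; lra.
Qed.

Lemma S_cont x t : 0 <= t -> contH hs (S ^~ x) t.
Proof.
move=> t0 e e0; have e2 : 0 < e / 2 by lra.
have [d d0 hd] := S_uniform_cont x e2; exists d => // s s0 sd.
by have := hd _ _ s0 t0 sd; lra.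
Qed.

Lemma S_rint x t : 0 <= t -> exists j, is_rint hs (S ^~ x) t j.
Proof.
move=> t0; apply: rint_exists => // e /(S_uniform_cont x)[d d0 hd].
by exists d => // s s' /andP[s0 _] /andP[s'0 _]; exact: hd.
Qed.

Lemma S_rint_contr x x' t j j' : 0 <= t -> is_rint hs (S ^~ x) t j ->
  is_rint hs (S ^~ x') t j' -> N (j - j') <= N (x - x') * t.
Proof.
move=> t0 h h'; apply: rint_le t0 (rintB h h') _ => s /andP[s0 _].
exact: S_contr.
Qed.

Lemma tends_of_small (xs : nat -> H) a : (forall n, N (xs n - a) < (1 / 2) ^+ n) ->
  tends hs xs a.
Proof.
move=> h e e0; have [|n0 h0] := @expr_small _ (1 / 2) 1 _ _ e0; first lra.
by exists n0 => n /h0; rewrite mul1r; exact: lt_trans (h n).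
Qed.

Lemma S_rint_tends x (xs : nat -> H) t j (js : nat -> H) : 0 <= t ->
  tends hs xs x -> (forall n, is_rint hs (S ^~ (xs n)) t (js n)) ->
  is_rint hs (S ^~ x) t j -> tends hs js j.
Proof.
move=> t0 xx hjs hj e e0; have t1 : 0 < t + 1 by lra.
have [n0 h0] := xx _ (divr_gt0 e0 t1); exists n0 => n /h0.
rewrite ltr_pdivlMr// => h.
have := S_rint_contr t0 (hjs n) hj; have := nrm_ge0 hs (xs n - x); lra.
Qed.

(** The quadratic error of [S_taylor] makes the Riemann sums telescope. *)
Lemma S_mild_core x y z t : 0 <= t -> G x y -> G y z ->
  is_rint hs (S ^~ y) t (S t x - S 0 x).
Proof.
move=> t0 xy yz; apply: (@quadratic_rint _ _ _ (S ^~ x) _ (N z)) => //.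
  exact: nrm_ge0.
by move=> s r s0 r0; exact: S_taylor xy yz.
Qed.

Lemma S_tends_arg t x (xs : nat -> H) : 0 <= t -> tends hs xs x ->
  tends hs (fun n => S t (xs n)) (S t x).
Proof.
move=> t0 xx e /xx[n0 h0]; exists n0 => n /h0.
exact: le_lt_trans (S_contr _ _ t0).
Qed.

Lemma tendsB (xs ys : nat -> H) a b : tends hs xs a -> tends hs ys b ->
  tends hs (fun n => xs n - ys n) (a - b).
Proof.
move=> h h'; have := tendsD h (tendsZ (-1) h'); rewrite scaleN1r.
by apply: tends_ext => n; rewrite scaleN1r subrr nrm0.
Qed.

Lemma G_core_seq x y : G x y -> exists xs ys zs : nat -> H,
  [/\ forall n, G (xs n) (ys n), forall n, G (ys n) (zs n),
      tends hs xs x & tends hs ys y].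
Proof.
move=> xy.
have /choice[f hf] (n : nat) : exists p : H * H * H,
    [/\ G p.1.1 p.1.2, G p.1.2 p.2, N (x - p.1.1) < (1 / 2) ^+ n &
     N (y - p.1.2) < (1 / 2) ^+ n].
  have p0 : 0 < (1 / 2 : R) ^+ n by rewrite exprn_gt0.
  have [x' [y' [z' [h1 h2 h3 h4]]]] := G_core mG p0 xy.
  by exists (x', y', z').
exists (fun n => (f n).1.1), (fun n => (f n).1.2), (fun n => (f n).2); split.
- by move=> n; case: (hf n).
- by move=> n; case: (hf n).
- by apply: tends_of_small => n; rewrite nrmBC; case: (hf n).
- by apply: tends_of_small => n; rewrite nrmBC; case: (hf n).
Qed.

Lemma S_int_domain x y t j : 0 <= t -> G x y -> is_rint hs (S ^~ y) t j ->
  N (j - (S t x - S 0 x)) = 0.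
Proof.
move=> t0 xy hj.
have [xs [ys [zs [xys yzs xx yy]]]] := G_core_seq xy.
have h n := S_mild_core t0 (xys n) (yzs n).
have := S_rint_tends t0 yy h hj => h1.
apply: tends_uniq h1 _.
by apply: tendsB; apply: S_tends_arg.
Qed.

(** The Riemann sums of [s |-> (S s x, S s y)] stay in the graph, which is
    closed; this gives the integrated equation on the domain, hence everywhere
    by density. *)
Lemma S_mild x t j : 0 <= t -> is_rint hs (S ^~ x) t j -> G j (S t x - x).
Proof.
move=> t0 hj.
have dom x' y' j' : G x' y' -> is_rint hs (S ^~ x') t j' ->
    G j' (S t x' - S 0 x').
  move=> xy hj'; have [w hw] := S_rint y' t0.
  apply: (@G_ext _ _ _ _ mG j' w); first by rewrite subrr nrm0.
    exact: S_int_domain xy hw.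
  have /choice[f hf] (n : nat) : exists p : H * H,
      [/\ G p.1 p.2, N (p.1 - j') < (1 / 2) ^+ n & N (p.2 - w) < (1 / 2) ^+ n].
    have p0 : 0 < (1 / 2 : R) ^+ n by rewrite exprn_gt0.
    have [d d0 hd] := hj' _ p0; have [d' d'0 hd'] := hw _ p0.
    have m0 : 0 < Num.min d d' by rewrite lt_min d0.
    have [m tg] := tagged_uniform t0 m0.
    set p := (fun k : nat => _) in tg.
    exists (rsum m.+1 p p (S ^~ x'), rsum m.+1 p p (S ^~ y')); split.
    - rewrite /rsum /=; have [_ _ hp] := tg; have mp := tagged_mono tg.
      elim/big_ind2 : _ => [|u1 u2 v1 v2|k _]; first exact: (G_00 mG).
        by move=> h1 h2; exact: (G_D mG h1 h2).
      apply: (G_Z mG); apply: (S_graph _ xy).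
      by case/andP: (tagged_range tg (ltn_ord k)).
    - by apply: hd; apply: tagged_sub tg; rewrite ge_min lexx.
    - by apply: hd'; apply: tagged_sub tg; rewrite ge_min lexx orbT.
  apply: (@G_closed _ _ _ _ mG (fst \o f) (snd \o f)).
  - by move=> n; case: (hf n).
  - by apply: tends_of_small => n; case: (hf n).
  - by apply: tends_of_small => n; case: (hf n).
have /choice[f hf] (n : nat) : exists p : H * H,
    G p.1 p.2 /\ N (p.1 - x) < (1 / 2) ^+ n.
  have p0 : 0 < (1 / 2 : R) ^+ n by rewrite exprn_gt0.
  have [x' [y' [xy hx]]] := G_dense mG x p0.
  by exists (x', y'); rewrite nrmBC.
have xx : tends hs (fst \o f) x.
  by apply: tends_of_small => n; case: (hf n).
have /choice[js hjs] (n : nat) := S_rint (f n).1 t0.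
apply: (@G_ext _ _ _ _ mG j (S t x - S 0 x)); first by rewrite subrr nrm0.
  have -> : S t x - S 0 x - (S t x - x) = - (S 0 x - x) by lmodule.
  by rewrite nrmN S_0.
apply: (@G_closed _ _ _ _ mG js (fun n => S t (f n).1 - S 0 (f n).1)).
- by move=> n; have [h _] := hf n; exact: dom h (hjs n).
- exact: S_rint_tends xx hjs hj.
- by apply: tendsB; exact: S_tends_arg xx.
Qed.

(** [S s x] differs by a constant from the integral of the continuous function
    [S s y]. *)
Lemma S_deriv x y t : 0 <= t -> G x y -> derH hs (S ^~ x) t (S t y).
Proof.
move=> t0 xy.
have /choice[j hj] (s : R) : exists j, 0 <= s -> is_rint hs (S ^~ y) s j.
  have [s0|s0] := leP 0 s; last by exists 0.
  by have [j hj] := S_rint y s0; exists j.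
move=> e e0.
have [d d0 hd] := rint_derH hj t0 (S_cont y t0) e0.
exists d => // s s0 /(hd _ s0) h.
apply: le_trans h; apply: nrm_eq0_of.
have es := S_int_domain s0 xy (hj _ s0); have et := S_int_domain t0 xy (hj _ t0).
apply/eqP; rewrite eq_le nrm_ge0 andbT.
have -> : S s x - S t x - (s - t) *: S t y - (j s - j t - (s - t) *: S t y) =
    (j t - (S t x - S 0 x)) - (j s - (S s x - S 0 x)) by lmodule.
by apply: le_trans (nrmB _ _ _) _; rewrite es et add0r.
Qed.

End exponential_formula.

Lemma is_derive_of_expansion (R : realType) (f : R -> R) (t l : R) :
  (forall e, 0 < e -> exists2 d, 0 < d & forall s, `|s - t| < d ->
     `|f s - f t - (s - t) * l| <= e * `|s - t|) ->
  is_derive t (1 : R) f l.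
Proof.
move=> h.
have cv : h^-1 *: ((f \o shift t) (h *: (1 : R)) - f t) @[h --> 0^'] --> l.
  apply/cvgrPdist_le => e e0; have [d d0 hd] := h _ e0.
  near=> x.
  have x0 : x != 0 by near: x; exact: nbhs_dnbhs_neq.
  have xd : `|x| < d.
    near: x; apply: dnbhs0_lt => //.
  have := hd (x + t); rewrite addrK => /(_ xd).
  rewrite /= [x *: 1]mulr1 -(ler_pM2l (_ : 0 < `|x|^-1)); last first.
    by rewrite invr_gt0 normr_gt0.
  rewrite mulrCA mulVf ?normr_eq0// mulr1 -normfV -normrM distrC.
  rewrite mulrBr [x^-1 * (x * l)]mulrA mulVf// mul1r.
  by [].
apply: DeriveDef; last exact/cvg_lim.
by apply/cvg_ex; exists l.
Unshelve. all: by end_near. Qed.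

(** One-sided differentiability at [0] is enough. *)
Lemma nonincreasing_of_expansion (R : realType) (f g : R -> R) T : 0 <= T ->
  (forall t, 0 <= t -> forall e, 0 < e -> exists2 d, 0 < d & forall s, 0 <= s ->
     `|s - t| < d -> `|f s - f t - (s - t) * g t| <= e * `|s - t|) ->
  (forall t, 0 <= t -> g t <= 0) -> f T <= f 0.
Proof.
move=> T0 df g0.
pose f0 t := f (Num.max 0 t).
have f0E t : 0 <= t -> f0 t = f t by move=> t0; rewrite /f0 max_r.
have cf0 : continuous f0.
  move=> t; apply/cvgrPdist_le => e e0.
  pose t' := Num.max 0 t; have t'0 : 0 <= t' by rewrite le_max lexx.
  have [d d0 hd] := df _ t'0 _ ltr01.
  have k0 : 0 < 1 + `|g t'| by rewrite ltr_pwDl.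
  near=> s.
  pose s' := Num.max 0 s; have s'0 : 0 <= s' by rewrite le_max lexx.
  have st : `|s' - t'| <= `|s - t|.
    have n1 := ler_norm (s - t); have := ler_norm (t - s).
    rewrite distrC ler_norml /s' /t' /Num.max => n2.
    by case: ltP => s0; case: ltP => t0; apply/andP; split; lra.
  have sd : `|s' - t'| < d.
    apply: le_lt_trans st _; near: s; rewrite /=.
    under eq_near do rewrite distrC.
    exact: cvgr_dist_lt.
  have se : `|s' - t'| <= e / (1 + `|g t'|).
    apply: le_trans st _; near: s; rewrite /=.
    under eq_near do rewrite distrC.
    by apply: cvgr_dist_le => //; exact: divr_gt0.
  have := hd _ s'0 sd; rewrite mul1r => h.
  rewrite distrC -/s' -/t' /f0 -/s' -/t'.
  have -> : f s' - f t' = f s' - f t' - (s' - t') * g t' + (s' - t') * g t'.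
    by rewrite subrK.
  apply: le_trans (ler_normD _ _) _; apply: le_trans (lerD h (lexx _)) _.
  rewrite normrM; move: se; rewrite ler_pdivlMr//; lra.
have [t t0 e] : exists2 t, 0 <= t & f0 T - f0 0 = g t * (T - 0).
  have [//|t||t tT ->] := @MVT_segment _ f0 g 0 T.
  - move=> tT; have t0 : 0 < t by move: tT; rewrite in_itv => /andP[].
    apply: is_derive_of_expansion => e /(df _ (ltW t0))[d d0 hd].
    exists (Num.min d t); first by rewrite lt_min d0.
    move=> s; rewrite lt_min => /andP[sd st].
    have s0 : 0 <= s by move: st; rewrite ltr_norml => /andP[]; lra.
    by rewrite !f0E ?(ltW t0)//; exact: hd.
  - exact: continuous_subspaceT.
  - by exists t => //; move: tT; rewrite in_itv => /andP[].
rewrite -(f0E _ T0) -(f0E _ (lexx _)) -subr_le0 e subr0.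
by rewrite mulr_le0_ge0// g0.
Unshelve. all: by end_near. Qed.

Section uniqueness.
Context {R : realType} {H : lmodType R} (hs : hilbert H).
Local Notation "<< x , y >>" := (ip hs x y).
Local Notation N := (nrm hs).
Variable G : H -> H -> Prop.
Hypothesis mG : maximal_dissipative hs G.

(** [|W|^2] has derivative [2 <<W', W>> <= 0]. *)
Theorem dissipative_uniq (W F : R -> H) :
  (forall t, 0 <= t -> G (W t) (F t)) ->
  (forall t, 0 <= t -> derH hs W t (F t)) -> N (W 0) = 0 ->
  forall t, 0 <= t -> N (W t) = 0.
Proof.
move=> WF dW W0 T T0.
pose f t := <<W t, W t>>; pose g t := 2 * <<F t, W t>>.
suff : f T <= f 0.
  rewrite /f -!nrm_sq W0 expr0n/= => h; apply/eqP; rewrite -sqrf_eq0.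
  by rewrite eq_le h sqr_ge0.
apply: (@nonincreasing_of_expansion _ f g) => // [t t0 e e0|t t0]; last first.
  by rewrite /g mulr_ge0_le0// ipC; apply: G_diss mG _ _ (WF _ t0).
pose a := N (W t); pose b := N (F t).
have a0 : 0 <= a := nrm_ge0 _ _; have b0 : 0 <= b := nrm_ge0 _ _.
have a1 : 0 < 4 * (a + 1) by lra.
have b1 : 0 < 2 * (b + 1) ^+ 2 by rewrite mulr_gt0// exprn_gt0//; lra.
have [d d0 hd] := dW _ t0 _ (divr_gt0 e0 a1).
have [d' d'0 hd'] := dW _ t0 _ ltr01.
exists (Num.min (Num.min d d') (e / (2 * (b + 1) ^+ 2))).
  by rewrite !lt_min d0 d'0 divr_gt0.
move=> s s0; rewrite !lt_min => /andP[/andP[sd sd']].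
rewrite ltr_pdivlMr// => se.
have h := hd _ s0 sd; have := hd' _ s0 sd'; rewrite mul1r => h'.
pose D := W s - W t.
have -> : f s - f t - (s - t) * g t =
    2 * <<D - (s - t) *: F t, W t>> + <<D, D>>.
  by rewrite /f /g /D !ipE (ipC hs (W t) (W s)); ring.
have hD : N D <= (b + 1) * `|s - t|.
  have := nrm_le_tri hs D ((s - t) *: F t); rewrite nrmZ -/b.
  by rewrite /D; lra.
have hc : `|<<D - (s - t) *: F t, W t>>| <= e / (4 * (a + 1)) * `|s - t| * a.
  apply: le_trans (CauchySchwarz _ _ _) _.
  by rewrite ler_wpM2r.
have hDD : <<D, D>> <= (b + 1) ^+ 2 * `|s - t| ^+ 2.
  by rewrite -nrm_sq -exprMn ler_pXn2r ?nnegrE ?nrm_ge0// mulr_ge0//; lra.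
have hDD0 : 0 <= <<D, D>> := ip_ge0 _ _.
apply: le_trans (ler_normD _ _) _.
rewrite (ger0_norm hDD0) normrM (ger0_norm (ler0n _ 2)).
have e1 : e / (4 * (a + 1)) * `|s - t| * a <= e / 4 * `|s - t|.
  have -> : e / (4 * (a + 1)) * `|s - t| * a =
    (e / 4 * `|s - t|) * (a / (a + 1)) by field; lra.
  have c1 : a / (a + 1) <= 1 by rewrite ler_pdivrMr; lra.
  have c2 : 0 <= e / 4 * `|s - t| by apply: mulr_ge0 => //; lra.
  by rewrite ler_piMr.
have e2 : (b + 1) ^+ 2 * `|s - t| ^+ 2 <= e / 2 * `|s - t|.
  rewrite expr2 mulrA ler_wpM2r//; lra.
lra.
Qed.

(** The difference [W] of the two integrals satisfies [W' = A W] and [W(0) = 0],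
    so it vanishes, and so does its derivative. *)
Theorem mild_uniq (U V JU JV : R -> H) (u0 : H) :
  (forall t, 0 <= t -> contH hs U t) -> (forall t, 0 <= t -> contH hs V t) ->
  (forall t, 0 <= t -> is_rint hs U t (JU t) /\ G (JU t) (U t - u0)) ->
  (forall t, 0 <= t -> is_rint hs V t (JV t) /\ G (JV t) (V t - u0)) ->
  forall t, 0 <= t -> N (U t - V t) = 0.
Proof.
move=> cU cV hU hV.
pose Z t : H := U t - V t; pose W t : H := JU t - JV t.
have rW t : 0 <= t -> is_rint hs Z t (W t).
  by move=> t0; apply: rintB; [case: (hU _ t0)|case: (hV _ t0)].
have cZ t : 0 <= t -> contH hs Z t.
  move=> t0 e e0; have e2 : 0 < e / 2 by lra.
  have [d d0 hd] := cU _ t0 _ e2; have [d' d'0 hd'] := cV _ t0 _ e2.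
  exists (Num.min d d'); first by rewrite lt_min d0.
  move=> s s0; rewrite lt_min => /andP[/(hd _ s0) h1 /(hd' _ s0) h2].
  have -> : Z s - Z t = (U s - U t) - (V s - V t) by rewrite /Z; lmodule.
  by apply: le_lt_trans (nrmB _ _ _) _; lra.
have dW t : 0 <= t -> derH hs W t (Z t).
  by move=> t0; apply: rint_derH => //; exact: cZ.
have GW t : 0 <= t -> G (W t) (Z t).
  move=> t0; have [_ h1] := hU _ t0; have [_ h2] := hV _ t0.
  have := G_B mG h1 h2.
  by have -> : U t - u0 - (V t - u0) = Z t by rewrite /Z; lmodule.
have W0 : N (W 0) = 0.
  have [M hM] : exists M, forall s, 0 <= s <= 0 -> N (Z s) <= M.
    by exists (N (Z 0)) => s; rewrite -eq_le => /eqP<-.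
  have := rint_le (lexx 0) (rW _ (lexx _)) hM.
  by rewrite mulr0 => h; apply/eqP; rewrite eq_le h nrm_ge0.
have Wz := dissipative_uniq GW dW W0.
move=> t t0; apply: (@nrm_small _ _ _ _ 1) => e e0; rewrite mul1r.
have [d d0 hd] := dW _ t0 _ e0.
have s0 : 0 <= t + d / 2 by lra.
have sd : t + d / 2 - t = d / 2 by rewrite addrAC subrr add0r.
have d2 : 0 < d / 2 by lra.
have := hd _ s0; rewrite sd gtr0_norm// => h.
have := nrmB hs (W (t + d / 2) - W t) (W (t + d / 2) - W t - (d / 2) *: Z t).
have -> : W (t + d / 2) - W t - (W (t + d / 2) - W t - (d / 2) *: Z t) =
  (d / 2) *: Z t by lmodule.
have := nrmB hs (W (t + d / 2)) (W t); rewrite !Wz// nrmZ gtr0_norm//.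
move=> h1 h2; rewrite -/(Z t) -(ler_pM2l d2).
have h3 : d / 2 < d by lra.
have := h h3; lra.
Qed.

End uniqueness.

Lemma derH_lin (R : realType) (H : lmodType R) (hs : hilbert H) (a : R)
  (U V : R -> H) (t : R) (F K : H) : derH hs U t F -> derH hs V t K ->
  derH hs (fun s => a *: U s + V s) t (a *: F + K).
Proof.
move=> hU hV e e0; have a0 : 0 < `|a| + 1 by rewrite ltr_wpDl.
have e1 : 0 < e / 2 / (`|a| + 1) by rewrite !divr_gt0.
have e2 : 0 < e / 2 by rewrite divr_gt0.
have [d1 d10 h1] := hU _ e1; have [d2 d20 h2] := hV _ e2.
exists (Num.min d1 d2); first by rewrite lt_min d10.
move=> s s0; rewrite lt_min => /andP[s1 s2].
have -> : a *: U s + V s - (a *: U t + V t) - (s - t) *: (a *: F + K) =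
    a *: (U s - U t - (s - t) *: F) + (V s - V t - (s - t) *: K).
  rewrite 2!lin_sub scalerDr; congr (_ - (_ + _)).
  by rewrite !scalerA mulrC.
apply: le_trans (nrmD _ _ _) _; rewrite nrmZ.
have := h2 s s0 s2; have := ler_wpM2l (normr_ge0 a) (h1 s s0 s1).
have : `|a| * (e / 2 / (`|a| + 1) * `|s - t|) <= e / 2 * `|s - t|.
  rewrite [leLHS]mulrA ler_wpM2r// mulrCA ler_piMr ?(ltW e2)//.
  by rewrite ler_pdivrMr// mul1r lerDl.
lra.
Qed.

(** The Lumer-Phillips theorem; the orbit is a mild solution for all data and a
    differentiable one for data in the domain. *)
Theorem abstract_evolution (R : realType) (H : lmodType R) (hs : hilbert H)
  (G : H -> H -> Prop) (x : H) : maximal_dissipative hs G ->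
  exists u : R -> H, [/\ nrm hs (u 0 - x) = 0,
    forall t, 0 <= t -> contH hs u t,
    forall t, 0 <= t -> exists j, is_rint hs u t j /\ G j (u t - x) &
    forall y, G x y -> exists f, forall t, 0 <= t ->
      [/\ contH hs f t, G (u t) (f t) & derH hs u t (f t)]].
Proof.
move=> mG; exists (fun t => S hs G t x); split.
- exact: (S_0 mG x).
- by move=> t; exact: (S_cont mG x).
- move=> t t0; have [j hj] := S_rint mG x t0; exists j; split=> //.
  exact: (S_mild mG t0 hj).
- move=> y xy; exists (fun t => S hs G t y) => t t0; split.
  + exact: (S_cont mG y t0).
  + exact: (S_graph mG t0 xy).
  + exact: (S_deriv mG t0 xy).
Qed.

(** * Square integrable functions *)

Section l2.
Context {R : realType}.
Local Notation mu := (@lebesgue_measure R).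
Implicit Types (D : set R) (f g : R -> R).

Definition intg D f := mu.-integrable D (EFin \o f).

Definition l2 D f :=
  measurable_fun D f /\ intg D (fun x => f x ^+ 2).

Section fixed_domain.
Variables (D : set R) (mD : measurable D).

Lemma intg_meas f : intg D f -> measurable_fun D f.
Proof. by move=> /integrableP[+ _] => /measurable_EFinP. Qed.

Lemma intg_le f g : measurable_fun D f -> intg D g ->
  (forall x, D x -> `|f x| <= g x) -> intg D f.
Proof.
move=> mf ig fg; apply: le_integrable ig => //; first exact/measurable_EFinP.
move=> x Dx /=; rewrite lee_fin; apply: le_trans (fg _ Dx) _.
exact: ler_norm.
Qed.

Lemma intgD f g : intg D f -> intg D g -> intg D (fun x => f x + g x).
Proof.
move=> h h'; have := @integrableD _ _ _ mu D mD _ _ h h'.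
by apply: eq_integrable => // x _; rewrite /= EFinD.
Qed.

Lemma intgZ c f : intg D f -> intg D (fun x => c * f x).
Proof.
move=> h; have := @integrableZl _ _ _ mu D mD c _ h.
by apply: eq_integrable => // x _; rewrite /= EFinM.
Qed.

Lemma intgN f : intg D f -> intg D (fun x => - f x).
Proof.
by move=> /(intgZ (-1)); apply: eq_integrable => // x _ /=; rewrite mulN1r.
Qed.

Lemma intgB f g : intg D f -> intg D g -> intg D (fun x => f x - g x).
Proof. by move=> h h'; apply: intgD => //; exact: intgN. Qed.

Lemma intg0 : intg D (fun=> 0).
Proof. exact: integrable0. Qed.

Lemma l2_mul f g : l2 D f -> l2 D g -> intg D (fun x => f x * g x).
Proof.
move=> [mf f2] [mg g2]; apply: intg_le (intgD f2 g2) _.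
  exact: measurable_funM.
move=> x _; rewrite normrM -(real_normK (num_real (f x))).
rewrite -(real_normK (num_real (g x))).
have := sqr_ge0 (`|f x| - `|g x|); rewrite sqrrB.
have := sqr_ge0 `|f x|; have := sqr_ge0 `|g x|; lra.
Qed.

Lemma l2_lin c f g : l2 D f -> l2 D g -> l2 D (fun x => c * f x + g x).
Proof.
move=> hf hg; have [mf f2] := hf; have [mg g2] := hg; split.
  by apply: measurable_funD => //; apply: measurable_funM.
have := intgD (intgD (intgZ (c ^+ 2) f2) (intgZ (2 * c) (l2_mul hf hg))) g2.
by apply: eq_integrable => // x _ /=; congr (_%:E); ring.
Qed.

Lemma l2_0 : l2 D (fun=> 0).
Proof.
split => //; have := intg0; apply: eq_integrable => // x _ /=.
by rewrite expr0n.
Qed.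

Definition l2p & measurable D : {pred (R -> R)} := fun f => `[<l2 D f>].

Lemma l2p_submod : submod_closed (l2p mD).
Proof.
split; first by apply/asboolP; exact: l2_0.
by move=> c f g /asboolP hf /asboolP hg; apply/asboolP; exact: l2_lin.
Qed.

HB.instance Definition _ :=
  GRing.isSubmodClosed.Build R (R -> R) (l2p mD) l2p_submod.

Definition l2t (h : measurable D) : Type := {f : R -> R | f \in l2p h}.

HB.instance Definition _ := SubChoice.on (l2t mD).
HB.instance Definition _ := [SubChoice_isSubLmodule of l2t mD by <:].

Lemma l2tP (f : l2t mD) : l2 D (val f).
Proof. by have /asboolP := valP f. Qed.

Definition l2_of f : l2t mD := insubd 0 f.

Lemma l2_ofK f : l2 D f -> val (l2_of f) = f.
Proof. by move=> h; rewrite /l2_of insubdK//; apply/asboolP. Qed.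

Lemma intD f g : intg D f -> intg D g ->
  \int[mu]_(x in D) (f x + g x) =
  \int[mu]_(x in D) f x + \int[mu]_(x in D) g x.
Proof. exact: RintegralD. Qed.

Lemma intZ c f : intg D f ->
  \int[mu]_(x in D) (c * f x) = c * \int[mu]_(x in D) f x.
Proof. exact: RintegralZl. Qed.

Lemma intB f g : intg D f -> intg D g ->
  \int[mu]_(x in D) (f x - g x) =
  \int[mu]_(x in D) f x - \int[mu]_(x in D) g x.
Proof. exact: RintegralB. Qed.

Lemma int_le f g : intg D f -> intg D g -> (forall x, D x -> f x <= g x) ->
  \int[mu]_(x in D) f x <= \int[mu]_(x in D) g x.
Proof. exact: le_Rintegral. Qed.

Lemma eq_int f g : (forall x, D x -> f x = g x) ->
  \int[mu]_(x in D) f x = \int[mu]_(x in D) g x.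
Proof. by move=> h; apply: eq_Rintegral => x /set_mem; exact: h. Qed.

Lemma EFin_int f : intg D f ->
  (\int[mu]_(x in D) f x)%:E = (\int[mu]_(x in D) (f x)%:E)%E.
Proof. by move=> h; rewrite /Rintegral fineK//; exact: integrable_fin_num. Qed.

Lemma int_ae_eq f g : intg D f -> intg D g -> ae_eq mu D f g ->
  \int[mu]_(x in D) f x = \int[mu]_(x in D) g x.
Proof.
move=> hf hg fg; rewrite /Rintegral; congr fine.
apply: ae_eq_integral => //.
- by case/integrableP : hf.
- by case/integrableP : hg.
- by apply: filterS fg => x h Dx /=; rewrite h.
Qed.

Lemma int0_ae f : intg D f -> (forall x, D x -> 0 <= f x) ->
  \int[mu]_(x in D) f x = 0 -> ae_eq mu D f (fun=> 0).
Proof.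
move=> hf f0 h0; have h := EFin_int hf; rewrite h0 in h.
have mf : measurable_fun D (EFin \o f) by case/integrableP : hf.
have : ae_eq mu D (EFin \o f) (cst 0%E).
  apply/(@ae_eq_integral_abs _ _ _ mu D mD) => //.
  rewrite [RHS]h; apply: eq_integral => x /set_mem Dx /=.
  by rewrite ger0_norm// f0.
by apply: filterS => x + Dx => /(_ Dx) [].
Qed.

Lemma sq_intg f : measurable_fun D f ->
  (\int[mu]_(x in D) (f x ^+ 2)%:E < +oo)%E -> l2 D f.
Proof.
move=> mf f2; split => //; apply/integrableP; split.
  by apply/measurable_EFinP; exact: measurable_funX.
apply: le_lt_trans f2; rewrite le_eqVlt; apply/orP; left; apply/eqP.
by apply: eq_integral => x _ /=; rewrite ger0_norm// sqr_ge0.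
Qed.

Definition l2_ip (f g : l2t mD) : R := \int[mu]_(x in D) (val f x * val g x).

Lemma l2_ipC (f g : l2t mD) : l2_ip f g = l2_ip g f.
Proof. by apply: eq_int => x _; rewrite mulrC. Qed.

Lemma l2_ipP c (f g h : l2t mD) : l2_ip (c *: f + g) h = c * l2_ip f h + l2_ip g h.
Proof.
have fh := l2_mul (l2tP f) (l2tP h); have gh := l2_mul (l2tP g) (l2tP h).
rewrite /l2_ip -intZ// -intD//; last exact: intgZ.
by apply: eq_int => x _ /=; rewrite mulrDl mulrA.
Qed.

Lemma l2_ip_ge0 (f : l2t mD) : 0 <= l2_ip f f.
Proof. by apply: Rintegral_ge0 => x _; rewrite -expr2 sqr_ge0. Qed.

Lemma l2_ipE (f : l2t mD) : (l2_ip f f)%:E = (\int[mu]_(x in D) (val f x ^+ 2)%:E)%E.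
Proof.
rewrite -EFin_int; last by case: (l2tP f).
by congr EFin; apply: eq_int => x _; rewrite expr2.
Qed.

Lemma sum_quarter n : \sum_(0 <= k < n) (1 / 4 : R) ^+ k <= 2.
Proof.
have : \sum_(0 <= k < n) (1 / 4 : R) ^+ k <= 2 - 2 * (1 / 4) ^+ n.
  elim: n => [|n IH]; first by rewrite big_geq// expr0; lra.
  rewrite big_nat_recr//= exprS.
  have : 0 <= (1 / 4 : R) ^+ n by rewrite exprn_ge0.
  lra.
have : 0 <= (1 / 4 : R) ^+ n by rewrite exprn_ge0.
lra.
Qed.

(** Riesz-Fischer.  The function [G = \sum_n 4^n (f_(n+1) - f_n)^2] has a finite
    integral; wherever [G] is finite the sequence converges geometrically, with
    the pointwise error [2 sqrt(G) / 2^n], which also bounds the error in L2. *)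
Theorem l2_fast (x : nat -> l2t mD) :
  (forall n, l2_ip (x n.+1 - x n) (x n.+1 - x n) <= (1 / 16) ^+ n) ->
  exists y, forall e, 0 < e ->
    exists n0, forall n, (n0 <= n)%N -> l2_ip (x n - y) (x n - y) < e.
Proof.
move=> hx; pose f n := val (x n).
have mf n : measurable_fun D (f n) by case: (l2tP (x n)).
pose g n t := ((4 ^+ n * (f n.+1 t - f n t) ^+ 2)%:E : \bar R).
have g0 n t : (0 <= g n t)%E.
  by rewrite lee_fin mulr_ge0 ?sqr_ge0// exprn_ge0.
have mg n : measurable_fun D (g n).
  apply/measurable_EFinP; apply: measurable_funM => //.
  by apply: measurable_funX; apply: measurable_funB.
pose G t := (\sum_(0 <= n <oo) g n t)%E.
have G0 t : (0 <= G t)%E by apply: nneseries_ge0 => n _ _.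
have mG : measurable_fun D G by apply: ge0_emeasurable_sum.
have intG : (\int[mu]_(t in D) G t <= 2%:E)%E.
  rewrite integral_nneseries//.
  apply: lime_le; first by apply: is_cvg_nneseries => n _ _; exact: integral_ge0.
  apply: nearW => n; apply: le_trans (_ : _ <= (\sum_(0 <= k < n) (1 / 4) ^+ k)%:E)%E _.
    rewrite -sumEFin; apply: lee_sum => k _.
    have -> : (\int[mu]_(t in D) g k t)%E =
        ((4 ^+ k)%:E * (l2_ip (x k.+1 - x k) (x k.+1 - x k))%:E)%E.
      pose d := x k.+1 - x k.
      have md : measurable_fun D (fun t => ((val d t) ^+ 2)%:E).
        by case: (l2tP d) => _ /integrableP[].
      have k0 : (0 <= (4 ^+ k)%:E :> \bar R)%E by rewrite lee_fin exprn_ge0.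
      have d0 t : D t -> (0 <= ((val d t) ^+ 2)%:E :> \bar R)%E.
        by rewrite lee_fin sqr_ge0.
      by rewrite l2_ipE -(@ge0_integralZl _ _ _ mu D mD _ md _ d0 k0).
    rewrite -EFinM lee_fin.
    apply: le_trans (ler_wpM2l (exprn_ge0 _ _) (hx k)) _ => //.
    rewrite -exprMn le_eqVlt; apply/orP; left; apply/eqP.
    by congr (_ ^+ _); field.
  by rewrite lee_fin sum_quarter.
have q0 n : 0 <= (1 / 2 : R) ^+ n by rewrite exprn_ge0.
have /choice[F hF] (t : R) : exists y, (G t < +oo)%E /\ D t ->
    forall n, `|f n t - y| <= 2 * Num.sqrt (fine (G t)) * (1 / 2) ^+ n.
  have [[Gt Dt]|] := pselect ((G t < +oo)%E /\ D t); last by exists 0.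
  have [||y hy] := @geometric_cvg _ (Num.sqrt (fine (G t))) (f ^~ t).
  - exact: sqrtr_ge0.
  - move=> n; rewrite -(@ler_pXn2r _ 2%N)// ?nnegrE ?mulr_ge0 ?sqrtr_ge0//.
    rewrite exprMn sqr_sqrtr ?fine_ge0// real_normK ?num_real//.
    have : (g n t <= G t)%E.
      apply: le_trans (nneseries_lim_ge n.+1 (fun k _ _ => g0 k t)).
      by rewrite big_nat_recr//= leeDr// sume_ge0.
    rewrite -[G t]fineK ?ge0_fin_numE// lee_fin.
    rewrite -exprM mulnC exprM.
    have -> : (1 / 2 : R) ^+ 2 = 4^-1 by field.
    by rewrite exprVn ler_pdivlMr ?exprn_gt0// mulrC.
  - by exists y.
pose A := [set t | D t /\ (G t < +oo)%E].
have mA : measurable A by exact: emeasurable_fun_infty_o.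
have small (C e : R) : 0 < e -> exists n0, forall n, (n0 <= n)%N ->
    C * (1 / 2) ^+ n < e.
  by move=> e0; apply: expr_small => //; lra.
pose y t := F t * \1_A t.
have my : measurable_fun D y.
  apply: (@measurable_fun_cvg _ _ _ D (fun n t => f n t * \1_A t)) => //.
    by move=> n; apply: measurable_funM => //; exact: measurable_indic.
  move=> t Dt; rewrite /y indicE.
  have [At|At] := boolP (t \in A); last first.
    by under eq_cvg do rewrite mulr0; rewrite mulr0; exact: cvg_cst.
  under eq_cvg do rewrite mulr1.
  have [_ Gt] : A t by exact: set_mem.
  rewrite mulr1; apply/cvgrPdist_lt => e e0.
  have [n0 h0] := small (2 * Num.sqrt (fine (G t))) _ e0.
  exists n0 => // n /= /h0; apply: le_lt_trans.
  by rewrite distrC; exact: hF.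
have bound n : (\int[mu]_(t in D) ((f n t - y t) ^+ 2)%:E <=
    (4 * (1 / 4) ^+ n)%:E * 2%:E)%E.
  have c0 : 0 < 4 * (1 / 4) ^+ n :> R by rewrite mulr_gt0// exprn_gt0.
  have c0' : (0 <= (4 * (1 / 4) ^+ n)%:E :> \bar R)%E by rewrite lee_fin ltW.
  apply: le_trans (lee_wpmul2l c0' intG).
  rewrite -(@ge0_integralZl _ _ _ mu D mD _ mG _ (fun t _ => G0 t) c0').
  apply: (@ge0_le_integral _ _ _ mu D mD) => //.
  - by move=> t _; rewrite lee_fin sqr_ge0.
  - by apply/measurable_EFinP; apply: measurable_funX;
    apply: measurable_funB; [exact: mf|exact: my].
  - exact: measurable_funeM.
  move=> t Dt; have [Gt|] := ltP (G t) +oo%E; last first.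
    by rewrite leye_eq => /eqP->; rewrite gt0_muley ?leey// lte_fin.
  have At : t \in A by apply/mem_set.
  rewrite /y indicE At mulr1 -[G t]fineK ?ge0_fin_numE// -EFinM lee_fin.
  rewrite -real_normK ?num_real//.
  have -> : 4 * (1 / 4) ^+ n * fine (G t) =
      (2 * Num.sqrt (fine (G t)) * (1 / 2) ^+ n) ^+ 2.
    have sq (p q : R) : (2 * p * q) ^+ 2 = 4 * q ^+ 2 * p ^+ 2 by ring.
    rewrite sq sqr_sqrtr ?fine_ge0// -exprM mulnC exprM.
    by have -> : (1 / 2 : R) ^+ 2 = 1 / 4 by field.
  rewrite ler_pXn2r ?nnegrE ?mulr_ge0 ?sqrtr_ge0//; exact: hF.
have yl2 : l2 D y.
  have h0 : l2 D (fun t => f 0%N t - y t).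
    apply: sq_intg; first by apply: measurable_funB; [exact: mf|exact: my].
    by apply: le_lt_trans (bound 0%N) _; rewrite -EFinM ltry.
  have := l2_lin (-1) h0 (l2tP (x 0%N)).
  congr (l2 D _); apply/funext => t; rewrite /f; ring.
exists (l2_of y) => e e0.
have [|n0 h0] := @expr_small _ (1 / 4) 8 e _ e0; first lra.
exists n0 => n /h0; apply: le_lt_trans; rewrite -lee_fin l2_ipE.
have -> : 8 * (1 / 4) ^+ n = 4 * (1 / 4) ^+ n * 2 :> R by ring.
by rewrite EFinM; apply: le_trans (bound n); rewrite /= l2_ofK.
Qed.

Definition l2_hilbert : hilbert (l2t mD) :=
  Hilbert l2_ipC l2_ipP l2_ip_ge0 l2_fast.

Lemma l2_nrm0 (f : l2t mD) :
  nrm l2_hilbert f = 0 <-> ae_eq mu D (val f) (fun=> 0).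
Proof.
have hf := l2tP f; split=> [f0|f0].
  have := int0_ae hf.2 (fun x _ => sqr_ge0 _).
  have -> : \int[mu]_(x in D) (val f x ^+ 2) = 0.
    by have := nrm_sq l2_hilbert f; rewrite f0 expr0n.
  move=> /(_ erefl); apply: filterS => x /= h Dx.
  by apply/eqP; rewrite -sqrf_eq0 h.
apply/eqP; rewrite -sqrf_eq0 nrm_sq /= /l2_ip; apply/eqP.
rewrite (int_ae_eq (l2_mul hf hf) intg0).
  by rewrite /Rintegral integral0.
by apply: filterS f0 => x h Dx; rewrite h// mul0r.
Qed.

End fixed_domain.

End l2.
(** * Absolutely continuous functions of a real variable *)

Section cousin.
Context {R : realType}.

(** Cousin's lemma as interval induction: a property of intervals that is stable
    under juxtaposition and holds for all small intervals around each point
    holds for the whole interval. *)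
Lemma cousin (P : R -> R -> Prop) (a b : R) : a <= b ->
  (forall x, a <= x <= b -> exists2 d, 0 < d & forall u v,
     a <= u -> u <= x -> x <= v -> v <= b -> v - u < d -> P u v) ->
  (forall u v w, u <= v -> v <= w -> P u v -> P v w -> P u w) -> P a b.
Proof.
move=> ab loc add.
pose S := [set x | a <= x <= b /\ P a x].
have Sa : S a.
  split; first by rewrite lexx ab.
  have [|d d0 hd] := loc a; first by rewrite lexx ab.
  by apply: hd; rewrite ?subrr.
have hS : has_sup S by split; [exists a|exists b => x [/andP[]]].
pose c := sup S.
have ac : a <= c by exact: (sup_upper_bound hS) Sa.
have cb : c <= b by apply: ge_sup; [exists a|move=> x [/andP[]]].
have [|d d0 hd] := loc c; first by rewrite ac cb.
have d2 : 0 < d / 2 by lra.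
have [x [/andP[ax xb] Px] cx] := sup_adherent d2 hS.
have xc : x <= c by apply: (sup_upper_bound hS); split=> //; rewrite ax.
rewrite -/c in cx.
pose y := Num.min b (c + d / 3).
have cy : c <= y by rewrite /y le_min cb; lra.
have yb : y <= b by rewrite /y ge_min lexx.
have yc : y <= c + d / 3 by rewrite /y ge_min lexx orbT.
have Pxy : P x y by apply: hd => //; lra.
have Py : P a y by apply: add Px Pxy => //; exact: le_trans cy.
have yc' : y <= c.
  by apply: (sup_upper_bound hS); split => //; rewrite yb (le_trans ac).
have [e|e] : y = b \/ y = c + d / 3.
  by rewrite /y /Num.min; case: ltP; [left|right].
  by rewrite -e.
lra.
Qed.

End cousin.

Lemma expansion_of_is_derive (R : realType) (f : R -> R) (t l e : R) :
  is_derive t (1 : R) f l -> 0 < e -> exists2 d, 0 < d &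
    forall s, `|s - t| < d -> `|f s - f t - (s - t) * l| <= e * `|s - t|.
Proof.
move=> [df <-] e0.
have /cvgrPdist_le /(_ _ e0) /nbhs_ballP[d /= d0 hd] :
  h^-1 *: ((f \o shift t) (h *: (1 : R)) - f t) @[h --> 0^'] --> 'D_1 f t by [].
exists d => // s sd; have [->|st] := eqVneq s t.
  by rewrite !subrr mul0r subrr normr0 mulr0.
have st0 : s - t != 0 by rewrite subr_eq0.
have := hd (s - t); rewrite /ball /= sub0r normrN => /(_ sd st0).
rewrite [_ *: 1]mulr1 subrK => h.
have -> : f s - f t - (s - t) * 'D_1 f t =
   - ((s - t) * ('D_1 f t - (s - t)^-1 * (f s - f t))).
  by rewrite mulrBr mulrA divff// mul1r opprB.
by rewrite normrN normrM mulrC ler_wpM2r.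
Qed.

Section absolute_continuity.
Context {R : realType}.
Local Notation mu := (@lebesgue_measure R).
Implicit Types (f g : R -> R) (a b : R).

Definition AC a b f := forall e, 0 < e -> exists2 d, 0 < d &
  forall (n : nat) (l r : 'I_n -> R),
    (forall i, [/\ a <= l i, l i <= r i & r i <= b]) ->
    trivIset [set: 'I_n] (fun i => `]l i, r i[%classic) ->
    \sum_(i < n) (r i - l i) < d ->
    \sum_(i < n) `|f (r i) - f (l i)| < e.

Lemma AC_sub a b a' b' f : a <= a' -> b' <= b -> AC a b f -> AC a' b' f.
Proof.
move=> aa bb h e /h[d d0 hd]; exists d => // n l r hlr.
apply: hd => i; have [h1 h2 h3] := hlr i.
by split=> //; [exact: le_trans h1|exact: le_trans bb].
Qed.

Lemma AC_lin c a b f g : AC a b f -> AC a b g -> AC a b (fun x => c * f x + g x).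
Proof.
move=> hf hg e e0; have e2 : 0 < e / 2 by lra.
have c0 : 0 < `|c| + 1 by have := normr_ge0 c; lra.
have [d1 d10 h1] := hf _ (divr_gt0 e2 c0); have [d2 d20 h2] := hg _ e2.
exists (Num.min d1 d2); first by rewrite lt_min d10.
move=> n l r hlr tr; rewrite lt_min => /andP[s1 s2].
have := h1 _ _ _ hlr tr s1; have := h2 _ _ _ hlr tr s2.
set X := \sum_(i < n) _; set Y := \sum_(i < n) _ => hX.
rewrite ltr_pdivlMr// => hY.
have Y0 : 0 <= Y by apply: sumr_ge0.
apply: le_lt_trans (_ : _ <= `|c| * Y + X) _; last by lra.
rewrite mulr_sumr -big_split; apply: ler_sum => i _ /=.
rewrite -normrM.
have -> : c * f (r i) + g (r i) - (c * f (l i) + g (l i)) =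
  c * (f (r i) - f (l i)) + (g (r i) - g (l i)) by ring.
exact: ler_normD.
Qed.

Lemma AC_unif a b f e : AC a b f -> 0 < e -> exists2 d, 0 < d & forall x y,
  a <= x -> x <= y -> y <= b -> y - x < d -> `|f y - f x| < e.
Proof.
move=> h /h[d d0 hd]; exists d => // x y ax xy yb yx.
have := hd 1%N (fun=> x) (fun=> y); rewrite !big_ord1; apply => //.
by move=> i j _ _ _; rewrite !ord1.
Qed.

Lemma AC_bounded a b f : AC a b f -> a <= b ->
  exists M, forall x, a <= x <= b -> `|f x| <= M.
Proof.
move=> h ab; have [d d0 hd] := AC_unif h (@ltr01 R).
apply: (@cousin R (fun u v => a <= u -> v <= b ->
   exists M, forall x, u <= x <= v -> `|f x| <= M) a b) => //.
  move=> x /andP[ax xb]; exists d => // u v au ux xv vb vu _ _.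
  exists (`|f u| + 1) => y /andP[uy yv].
  have yu : y - u < d by lra.
  have h1 := hd _ _ au uy (le_trans yv vb) yu.
  have -> : f y = f u + (f y - f u) by ring.
  by apply: le_trans (ler_normD _ _) _; rewrite lerD2l ltW.
move=> u v w uv vw h1 h2 au wb.
have [M1 hM1] := h1 au (le_trans vw wb).
have [M2 hM2] := h2 (le_trans au uv) wb.
exists (Num.max M1 M2) => x /andP[ux xw]; rewrite le_max.
have [xv|vx] := leP x v; first by rewrite hM1// ux.
by rewrite (hM2 x) ?orbT// (ltW vx).
Qed.

Lemma AC_mul a b f g : a <= b -> AC a b f -> AC a b g ->
  AC a b (fun x => f x * g x).
Proof.
move=> ab hf hg e e0; have e2 : 0 < e / 2 by lra.
have [M1 hM1] := AC_bounded hf ab; have [M2 hM2] := AC_bounded hg ab.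
have M10 : 0 < M1 + 1.
  by have := hM1 a; rewrite lexx ab => /(_ isT); have := normr_ge0 (f a); lra.
have M20 : 0 < M2 + 1.
  by have := hM2 a; rewrite lexx ab => /(_ isT); have := normr_ge0 (g a); lra.
have [d1 d10 h1] := hf _ (divr_gt0 e2 M20).
have [d2 d20 h2] := hg _ (divr_gt0 e2 M10).
exists (Num.min d1 d2); first by rewrite lt_min d10.
move=> n l r hlr tr; rewrite lt_min => /andP[s1 s2].
have := h1 _ _ _ hlr tr s1; have := h2 _ _ _ hlr tr s2.
rewrite !ltr_pdivlMr//; set X := \sum_(i < n) _; set Y := \sum_(i < n) _ => hX hY.
apply: le_lt_trans (_ : _ <= Y * (M2 + 1) + X * (M1 + 1)) _; last by lra.
rewrite !mulr_suml -big_split; apply: ler_sum => i _ /=.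
have [al lr rb] := hlr i.
have -> : f (r i) * g (r i) - f (l i) * g (l i) =
  (f (r i) - f (l i)) * g (r i) + (g (r i) - g (l i)) * f (l i) by ring.
apply: le_trans (ler_normD _ _) _; rewrite !normrM.
have b1 : `|g (r i)| <= M2 + 1.
  by apply: le_trans (hM2 _ _) _; rewrite ?(le_trans al lr)// lerDl.
have b2 : `|f (l i)| <= M1 + 1.
  by apply: le_trans (hM1 _ _) _; rewrite ?al ?(le_trans lr rb)// lerDl.
by apply: lerD; apply: ler_wpM2l.
Qed.

(** Disjoint intervals are listed in increasing order, so that families over
    adjacent intervals can be concatenated, as Cousin's lemma requires. *)
Fixpoint chain (u v : R) (s : seq (R * R)) : Prop :=
  if s is p :: s' then [/\ u <= p.1, p.1 <= p.2 & chain p.2 v s'] else u <= v.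

Lemma chain_cat u v w s s' : chain u v s -> chain v w s' ->
  chain u w (s ++ s').
Proof.
elim: s u => [|p s IH] u /=.
  by case: s' => [|q s'] /= uv; [exact: le_trans|case=> vq h1 h2; split=> //;
    exact: le_trans vq].
by move=> [h1 h2 h3] h4; split=> //; exact: IH.
Qed.

Lemma chain_le u v s : chain u v s -> u <= v.
Proof.
by elim: s u => [//|p s IH] u /= [h1 h2 /IH]; move=> /(le_trans h2); exact: le_trans.
Qed.

Lemma chain_nth u v s i : chain u v s -> (i < size s)%N ->
  [/\ u <= (nth (0, 0) s i).1, (nth (0, 0) s i).1 <= (nth (0, 0) s i).2 &
      (nth (0, 0) s i).2 <= v].
Proof.
elim: s u i => [//|p s IH] u [|i] /= [h1 h2 h3].
  by move=> _; split => //; exact: chain_le h3.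
by rewrite ltnS => /(IH _ _ h3)[h4 h5 h6]; split => //;
  exact: le_trans h1 (le_trans h2 h4).
Qed.

Lemma chain_lt u v s i j : chain u v s -> (i < j)%N -> (j < size s)%N ->
  (nth (0, 0) s i).2 <= (nth (0, 0) s j).1.
Proof.
elim: s u i j => [//|p s IH] u [|i] [|j] //= [h1 h2 h3].
  by rewrite ltnS => _ /(chain_nth h3)[].
by rewrite !ltnS; exact: IH h3.
Qed.

Lemma AC_chain a b f e : AC a b f -> 0 < e -> exists2 d, 0 < d & forall s,
  chain a b s -> \sum_(p <- s) (p.2 - p.1) < d ->
  \sum_(p <- s) `|f p.2 - f p.1| < e.
Proof.
move=> h /h[d d0 hd]; exists d => // s cs.
have E (F : R * R -> R) :
    \sum_(p <- s) F p = \sum_(i < size s) F (nth (0, 0) s i).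
  by rewrite (big_nth (0, 0)) big_mkord.
rewrite !E; apply: (hd _ (fun i => (nth (0, 0) s i).1)
  (fun i => (nth (0, 0) s i).2)).
  by move=> i; exact: chain_nth.
move=> i j _ _ [x /= []]; rewrite !in_itv/= => /andP[x1 x2] /andP[x3 x4].
apply/val_inj; case: (ltngtP i j) => // ij.
  by have := lt_trans (lt_le_trans x2 (chain_lt cs ij (ltn_ord j))) x3; rewrite ltxx.
by have := lt_trans (lt_le_trans x4 (chain_lt cs ij (ltn_ord i))) x1; rewrite ltxx.
Qed.

Lemma chain_measure (O : set R) u v s : measurable O -> chain u v s ->
  (forall p, p \in s -> `[p.1, p.2] `<=` O) ->
  ((\sum_(p <- s) (p.2 - p.1))%:E <= mu (O `&` `]u, v]))%E.
Proof.
move=> mO; elim: s u => [|p s IH] u /=.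
  by rewrite big_nil => _ _; exact: measure_ge0.
move=> [up pp cs] hs; rewrite big_cons EFinD.
have pO : `[p.1, p.2] `<=` O by apply: hs; rewrite mem_head.
have {}IH := IH _ cs (fun q qs => hs q (mem_behead (s := p :: s) qs)).
have pv := chain_le cs.
have -> : O `&` `]u, v] = (O `&` `]u, p.2]) `|` (O `&` `]p.2, v]).
  rewrite -setIUr; congr (_ `&` _); apply/seteqP; split=> x /=;
    rewrite !in_itv /=.
    by move=> /andP[ux xv]; case: (leP x p.2) => h; [left|right]; rewrite ?ux ?xv.
  move=> [/andP[ux xp]|/andP[px xv]].
    by rewrite ux (le_trans xp pv).
  by rewrite xv (le_lt_trans _ px)// (le_trans up pp).
rewrite measureU//=.
- apply: leeD => //.
  have : (mu (`]p.1, p.2] : set R) <= mu (O `&` `]u, p.2]))%E.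
    apply: le_measure; rewrite ?inE//.
      exact: measurableI.
    move=> x /=; rewrite !in_itv /= => /andP[x1 x2]; split.
      by apply: pO; rewrite /= in_itv/= (ltW x1).
    by rewrite x2 (le_lt_trans up x1).
  rewrite lebesgue_measure_itv/= lte_fin.
  case: ltP => h; first by rewrite -EFinB.
  by move=> _; apply: le_trans (measure_ge0 _ _); rewrite lee_fin subr_le0.
- exact: measurableI.
- exact: measurableI.
rewrite -subset0 => x /= [[_ +] [_]]; rewrite !in_itv/= => /andP[_ h1] /andP[h2 _].
by move: (lt_le_trans h2 h1); rewrite ltxx.
Qed.

(** Cover the bad points by an open set of small measure, where absolute
    continuity bounds the total increment; near the other points the increments
    are at most [e] times the length. *)
Theorem AC_zero_derivative a b f : a <= b -> AC a b f ->
  {ae mu, forall x, x \in `]a, b[ -> is_derive x (1 : R) f 0} -> f b = f a.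
Proof.
move=> ab hf [A [mA A0 hA]].
apply/eqP; rewrite -subr_eq0 -normr_eq0 eq_le normr_ge0 andbT.
apply/ler_addgt0Pl => e' e'0; rewrite addr0.
pose e := e' / (b - a + 1); have k0 : 0 < b - a + 1 by lra.
have e0 : 0 < e by exact: divr_gt0.
have ee : e' = e * (b - a) + e.
  by rewrite /e; field; rewrite gt_eqF.
have [d d0 hd] := AC_chain hf e0.
pose B := A `|` [set a; b].
have mB : measurable B by apply: measurableU => //; apply: measurableU.
have B0 : mu B = 0%E.
  have m1 (x : R) : measurable [set x] by exact: measurable_set1.
  have mAa : measurable (A `|` [set a]) by exact: measurableU.
  have Aa : mu (A `|` [set a]) = mu A.
    by apply: (@measureU0 _ _ _ mu) => //; exact: lebesgue_measure_set1.
  have := @measureU0 _ _ _ mu _ _ mAa (m1 b) (lebesgue_measure_set1 b).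
  by move=> AB; rewrite /B setUA; exact: etrans AB (etrans Aa A0).
have Boo : (mu B < +oo)%E by rewrite B0.
have [ O [oO BO Od]] := @lebesgue_regularity_outer R B d mB Boo d0.
have mO : measurable O by exact: open_measurable.
have {}Od : (mu O < d%:E)%E.
  have mOB : measurable (O `\` B) by exact: measurableD.
  have := @measureU0 _ _ _ mu _ _ mOB mB B0.
  by rewrite setUC setDUK// => ->.
pose P u v := u <= v /\ exists s, [/\ chain u v s,
  (forall p, p \in s -> `[p.1, p.2] `<=` O) &
  `|f v - f u| <= e * (v - u) + \sum_(p <- s) `|f p.2 - f p.1|].
have [_ [s [cs sO hs]]] : P a b.
  apply: cousin => //; last first.
    move=> u v w _ _ [uv [s [h1 h2 h3]]] [vw [s' [h1' h2' h3']]].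
    split; first exact: le_trans vw.
    exists (s ++ s'); split; first exact: chain_cat h1'.
      by move=> p; rewrite mem_cat => /orP[]; [exact: h2|exact: h2'].
    rewrite big_cat /=.
    have -> : f w - f u = (f w - f v) + (f v - f u) by ring.
    apply: le_trans (ler_normD _ _) _; lra.
  move=> x /andP[ax xb]; have [Bx|nBx] := pselect (B x).
    have [d' /= d'0 hd'] : exists2 d' : R, 0 < d' & ball x d' `<=` O.
      by have := oO; rewrite openE => /(_ x (BO _ Bx)) /nbhs_ballP[d' d'0 h]; exists d'.
    exists d' => // u v au ux xv vb vu; split; first exact: le_trans xv.
    exists [:: (u, v)]; rewrite big_seq1 /=; split.
    - by split=> //; exact: le_trans xv.
    - move=> p; rewrite inE => /eqP-> y /=; rewrite in_itv/= => /andP[uy yv].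
      apply: hd'; rewrite /ball /= ltr_norml; apply/andP; split; lra.
    - by rewrite lerDr mulr_ge0 ?subr_ge0 ?(ltW e0)// (le_trans ux).
  have dx : is_derive x (1 : R) f 0.
    have nA : ~ A x by move=> Ax; apply: nBx; left.
    have : x \in `]a, b[.
      rewrite in_itv/= !lt_neqAle ax xb !andbT; apply/andP; split.
        by apply/eqP => xa; apply: nBx; right; left.
      by apply/eqP => xa; apply: nBx; right; right.
    by move=> xab; apply: contrapT => h; apply: nA; apply: hA => /= /(_ xab).
  have [d' d'0 hd'] := expansion_of_is_derive dx e0.
  exists d' => // u v au ux xv vb vu; split; first exact: le_trans xv.
  exists [::]; split => //=; first exact: le_trans xv.
  rewrite big_nil addr0.
  have h1 := hd' v; have h2 := hd' u; rewrite !mulr0 !subr0 in h1 h2.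
  have -> : f v - f u = (f v - f x) - (f u - f x) by ring.
  apply: le_trans (ler_normB _ _) _.
  have -> : e * (v - u) = e * `|v - x| + e * `|u - x|.
    by rewrite [`|u - x|]distrC !ger0_norm ?subr_ge0//; ring.
  apply: lerD; [apply: h1|apply: h2].
    by rewrite ger0_norm; lra.
  by rewrite distrC ger0_norm; lra.
rewrite ee; apply: le_trans hs _; rewrite lerD2l; apply/ltW/hd => //.
rewrite -lte_fin; apply: le_lt_trans (chain_measure mO cs sO) _.
apply: le_lt_trans Od; apply: le_measure; rewrite ?inE//.
exact: measurableI.
Qed.

End absolute_continuity.

(** * The fundamental theorem of calculus for absolutely continuous functions *)

Section fundamental_theorem.
Context {R : realType}.
Local Notation mu := (@lebesgue_measure R).
Implicit Types (f g F : R -> R) (a b : R).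

Lemma intgS (D E : set R) g : measurable D -> measurable E -> E `<=` D ->
  intg D g -> intg E g.
Proof. by move=> mD mE ED; exact: (@integrableS _ _ _ mu D E). Qed.

Lemma intg_setT (E : set R) g : measurable E -> intg setT g -> intg E g.
Proof. by move=> mE; apply: intgS. Qed.

Lemma int_sub (x y : R) g : intg setT g -> x <= y ->
  \int[mu]_(t in `]-oo, y]) g t - \int[mu]_(t in `]-oo, x]) g t =
  \int[mu]_(t in `]x, y[) g t.
Proof.
move=> ig xy.
have h1 : mu.-integrable [set` Interval -oo%O (BRight y)] (EFin \o g).
  by have := intg_setT (measurable_itv `]-oo, y]) ig.
rewrite (Rintegral_itvB h1)//.
have h2 : mu.-integrable [set` Interval (BRight x) (BLeft y)] (EFin \o g).
  by have := intg_setT (measurable_itv `]x, y[) ig.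
by rewrite (Rintegral_itv_bndo_bndc h2).
Qed.

Lemma int_restrict (D E : set R) g : E `<=` D ->
  \int[mu]_(t in E) (g \_ D) t = \int[mu]_(t in E) g t.
Proof. by move=> ED; apply: eq_int => t Et; rewrite patchE mem_set//; exact: ED. Qed.

(** Absolute continuity of the integral with respect to the measure. *)
Lemma AC_int_setT g a b : intg setT g ->
  AC a b (fun x => \int[mu]_(t in `]-oo, x]) g t).
Proof.
move=> ig e e0; have [d [d0 hd]] := integral_normr_continuous ig e0.
exists d => // n l r hlr tr lrd.
pose I (i : 'I_n) := `]l i, r i[%classic : set R.
pose D := \big[setU/set0]_(i < n) I i.
have mI i : measurable (I i) by exact: measurable_itv.
have mD : measurable D by exact: bigsetU_measurable.
have muD : (mu D < d%:E)%E.
  rewrite /D (@measure_bigsetU_ord _ _ _ mu n xpredT I)//.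
  apply: le_lt_trans (_ : _ <= (\sum_(i < n) (r i - l i))%:E)%E _; last by rewrite lte_fin.
  rewrite -sumEFin; apply: lee_sum => i _.
  rewrite [leLHS](lebesgue_measure_itv `]l i, r i[) /= lte_fin.
  case: ltP => h; first by rewrite EFinB.
  by have [_ h1 _] := hlr i; rewrite lee_fin subr_ge0.
apply: le_lt_trans (hd D mD muD).
have ign : intg setT (fun x => `|g x|).
  by have := @integrable_abse _ _ _ mu _ _ ig.
have iD E : measurable E -> intg E (fun x => `|g x|).
  by move=> mE; exact: intg_setT ign.
have -> : \int[mu]_(x in D) `|g x| = \sum_(i < n) \int[mu]_(x in I i) `|g x|.
  apply: EFin_inj; rewrite EFin_int//; last exact: iD.
  rewrite (@ge0_integral_bigsetU _ _ _ mu _ I _ (index_enum 'I_n)) //.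
  - by rewrite -sumEFin; apply: eq_bigr => i _; rewrite EFin_int//; exact: iD.
  - exact: index_enum_uniq.
  - exact: sub_trivIset tr.
  - by case/integrableP : (iD _ mD).
apply: ler_sum => i _; have [_ h1 _] := hlr i.
rewrite int_sub//; apply: le_normr_Rintegral => //.
exact: intg_setT ig.
Qed.

(** Lebesgue differentiation gives the derivative almost everywhere. *)
Lemma AC_antiderivative a b g : a <= b -> intg `]a, b[ g ->
  exists F, [/\ AC a b F,
    {ae mu, forall x, x \in `]a, b[ -> is_derive x (1 : R) F (g x)} &
    forall x y, a <= x -> x <= y -> y <= b ->
      F y - F x = \int[mu]_(t in `]x, y[) g t].
Proof.
move=> ab ig; pose G := g \_ `]a, b[.
have iG : intg setT G.
  have /(@integrable_mkcond _ _ _ mu _ _ (measurable_itv _)) := ig.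
  by rewrite restrict_EFin.
have iGy D : measurable D -> intg D G by move=> mD; exact: intg_setT iG.
exists (fun x => \int[mu]_(t in `]-oo, x]) G t); split.
- exact: AC_int_setT.
- have locG : locally_integrable [set: R] G.
    by apply: open_integrable_locally => //; exact: openT.
  have := FTC1Ny (fun y => iGy _ (measurable_itv _)) locG.
  apply: filterS; first exact: (ae_filter_ringOfSetsType mu).
  move=> x [dF FG] xab.
  apply: DeriveDef => //; rewrite -derive1E FG /G patchE mem_set//.
- move=> x y ax xy yb; rewrite int_sub//; apply: int_restrict => t /=.
  rewrite !in_itv/= => /andP[xt ty].
  by rewrite (le_lt_trans ax xt) (lt_le_trans ty yb).
Qed.

(** The difference of [f] and an antiderivative of [g] has a null derivative
    almost everywhere, hence is constant. *)
Theorem AC_FTC a b f g : a <= b -> AC a b f ->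
  {ae mu, forall x, x \in `]a, b[ -> is_derive x (1 : R) f (g x)} ->
  intg `]a, b[ g -> f b - f a = \int[mu]_(t in `]a, b[) g t.
Proof.
move=> ab hf df ig; have [F [hF dF FE]] := AC_antiderivative ab ig.
have := @AC_zero_derivative R a b _ ab (AC_lin (-1) hF hf).
rewrite -(FE a b)// => h.
have : -1 * F b + f b = -1 * F a + f a.
  apply: h; move: dF df; apply: filterS2.
    exact: (ae_filter_ringOfSetsType mu).
  move=> x h1 h2 xab.
  have {}h1 := h1 xab; have {}h2 := h2 xab.
  have -> : 0 = -1 * g x + g x by rewrite mulN1r addNr.
  exact: is_deriveD.
lra.
Qed.

End fundamental_theorem.

(** * Integrability of powers *)

Section powers.
Context {R : realType}.
Local Notation mu := (@lebesgue_measure R).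
Implicit Types (p x : R).

Definition pw p x : R := expR (p * ln x).

Lemma pw_gt0 p x : 0 < pw p x. Proof. exact: expR_gt0. Qed.

Lemma pwD p q x : pw (p + q) x = pw p x * pw q x.
Proof. by rewrite /pw mulrDl expRD. Qed.

Lemma pw1 x : 0 < x -> pw 1 x = x.
Proof. by move=> x0; rewrite /pw mul1r lnK. Qed.

Lemma pwN1 x : 0 < x -> pw (-1) x = x^-1.
Proof. by move=> x0; rewrite /pw mulN1r expRN lnK. Qed.

Lemma pw_le1 p x : 0 <= p -> 0 < x <= 1 -> pw p x <= 1.
Proof.
move=> p0 /andP[x0 x1]; rewrite -expR0 ler_expR; apply: mulr_ge0_le0 => //.
exact: ln_le0.
Qed.

Lemma pw_ge1_le1 p x : p <= 0 -> 1 <= x -> pw p x <= 1.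
Proof.
move=> p0 x1; rewrite -expR0 ler_expR; apply: mulr_le0_ge0 => //.
exact: ln_ge0.
Qed.

Lemma pw_derive p x : 0 < x -> is_derive x (1 : R) (pw p) (p * pw (p - 1) x).
Proof.
move=> x0.
have h1 : is_derive x (1 : R) (fun y => p * ln y) (p * x^-1).
  by have := @is_deriveZ R R R (@ln R) p x 1 x^-1 (is_derive1_ln x0).
have := @is_derive1_comp R expR (fun y => p * ln y) x _ _ (is_derive_expR (p * ln x)) h1.
have -> // : expR (p * ln x) * (p * x^-1) = p * pw (p - 1) x.
by rewrite pwD pwN1// /pw; ring.
Qed.

Lemma FTC_segment (f F : R -> R) (a b : R) : a < b ->
  (forall x, a <= x <= b -> is_derive x (1 : R) F (f x)) ->
  (forall x, a <= x <= b -> derivable f x 1) ->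
  (\int[mu]_(x in `[a, b]) (f x)%:E = (F b)%:E - (F a)%:E)%E.
Proof.
move=> ab dF df.
have cF x : a <= x <= b -> {for x, continuous F}.
  move=> /dF h; apply: differentiable_continuous; apply/derivable1_diffP.
  exact: ex_derive.
apply: continuous_FTC2 => //.
- by apply: derivable_within_continuous => x; rewrite in_itv/=; exact: df.
- split.
  + by move=> x; rewrite in_itv/= => /andP[ax xb]; apply: ex_derive; apply: dF; rewrite !ltW.
  + by apply: cvg_at_right_filter; apply: cF; rewrite lexx ltW.
  + by apply: cvg_at_left_filter; apply: cF; rewrite lexx ltW.
- move=> x; rewrite in_itv/= => /andP[ax xb]; rewrite derive1E.
  have h : a <= x <= b by rewrite !ltW.
  by have := dF _ h => -[].
Qed.

(** An increasing bounded antiderivative on an exhausting sequence of segments. *)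
Lemma intg_exhaustion (f F : R -> R) (a b : nat -> R) (D : set R) M :
  measurable D -> D = \bigcup_n `[a n, b n]%classic ->
  (forall n, a n < b n) -> (forall n, a n.+1 <= a n) ->
  (forall n, b n <= b n.+1) ->
  (forall x, D x -> is_derive x (1 : R) F (f x)) ->
  (forall x, D x -> derivable f x 1) ->
  (forall x, D x -> 0 <= f x) -> (forall x, D x -> `|F x| <= M) ->
  measurable_fun D f -> intg D f.
Proof.
move=> mD DE ab aS bS dF df f0 FM mf.
have inD n x : a n <= x <= b n -> D x.
  by move=> h; rewrite DE; exists n.
apply/integrableP; split; first exact/measurable_EFinP.
have -> : (\int[mu]_(x in D) `|(EFin \o f) x| = \int[mu]_(x in D) (f x)%:E)%E.
  by apply: eq_integral => x /set_mem Dx /=; rewrite ger0_norm// f0.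
apply: le_lt_trans (ltry (2 * M)).
rewrite DE.
have nd : {homo (fun n => `[a n, b n]%classic : set R) : n m / (n <= m)%N >-> (n <= m)%O}.
  apply/nondecreasing_seqP => n; apply/subsetPset => x /=; rewrite !in_itv/=.
  by move=> /andP[h1 h2]; rewrite (le_trans (aS n) h1) (le_trans h2 (bS n)).
have cv : (\int[mu]_(x in `[a i, b i]) (f x)%:E @[i --> \oo] -->
    \int[mu]_(x in \bigcup_n `[a n, b n]%classic) (f x)%:E)%E.
  apply: ge0_nondecreasing_set_cvg_integral => // i.
  - apply/measurable_EFinP; apply: measurable_funS mf => // x /=.
    by rewrite in_itv/=; exact: inD.
  - by move=> x /=; rewrite in_itv/= => /inD /f0; rewrite lee_fin.
rewrite -(cvg_lim _ cv)//; apply: lime_le; first by apply/cvg_ex; eexists; exact: cv.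
apply: nearW => n.
have e := FTC_segment (ab n) (fun x h => dF x (inD n x h))
  (fun x h => df x (inD n x h)).
rewrite e -EFinB lee_fin.
have := FM (a n) (inD n _ _); have := FM (b n) (inD n _ _).
rewrite !lexx !(ltW (ab n)) => /(_ isT) + /(_ isT).
by rewrite !ler_norml => /andP[? ?] /andP[? ?]; lra.
Qed.

(** The same bound for the reflected function, whose antiderivative is
    [- F (- x)]. *)
Lemma intg_exhaustion_opp (f F : R -> R) (a b : nat -> R) (D : set R) M :
  measurable D -> D = \bigcup_n `[a n, b n]%classic ->
  (forall n, a n < b n) -> (forall n, a n.+1 <= a n) ->
  (forall n, b n <= b n.+1) ->
  (forall x, D x -> is_derive x (1 : R) F (f x)) ->
  (forall x, D x -> derivable f x 1) ->
  (forall x, D x -> 0 <= f x) -> (forall x, D x -> `|F x| <= M) ->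
  measurable_fun D f ->
  intg D f /\ intg [set x | D (- x)] (fun x => f (- x)).
Proof.
move=> mD DE ab aS bS dF df f0 FM mf; split.
  exact: (intg_exhaustion mD DE ab aS bS dF df f0 FM mf).
have dN (x : R) : is_derive x (1 : R) (fun y : R => - y) (-1).
  have := @is_deriveN R R R id x 1 1 (is_derive_id x 1).
  by [].
have mD' : measurable [set x : R | D (- x)].
  rewrite -[X in measurable X]setTI; exact: (@oppr_measurable R).
apply: (@intg_exhaustion _ (fun x => - F (- x)) (fun n => - b n)
   (fun n => - a n) _ M) => //.
- apply/seteqP; split=> x /=.
    rewrite DE => -[n _ /=]; rewrite in_itv/= => /andP[h1 h2].
    by exists n => //=; rewrite in_itv/= lerNl h2/= lerNr.
  move=> [n _ /=]; rewrite in_itv/= => /andP[h1 h2]; rewrite DE.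
  by exists n => //=; rewrite in_itv/= lerNr h2/= lerNl.
- by move=> n; rewrite ltrN2.
- by move=> n; rewrite lerN2.
- by move=> n; rewrite lerN2.
- move=> x Dx.
  have h := @is_derive1_comp R F (fun y => - y) x _ _ (dF _ Dx) (dN x).
  have := @is_deriveN R R R _ x 1 _ h.
  by rewrite mulrN1 opprK.
- move=> x Dx.
  have [dfx] : is_derive (- x) (1 : R) f ('D_1 f (- x)).
    by apply: DeriveDef => //; exact: df.
  move=> e; have h0 : is_derive (- x) (1 : R) f ('D_1 f (- x)) by split.
  have h := @is_derive1_comp R f (fun y => - y) x _ _ h0 (dN x).
  exact: ex_derive.
- by move=> x /f0.
- by move=> x /FM; rewrite normrN.
- apply: (@measurable_comp _ _ _ _ _ _ D) => //.
  by move=> _ [x Dx <-].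
Qed.

Lemma pw_derivable p x : 0 < x -> derivable (pw p) x 1.
Proof. by move=> /(pw_derive p) h; exact: ex_derive. Qed.

Lemma measurable_pw p : measurable_fun setT (pw p).
Proof.
apply: measurableT_comp => //; apply: measurable_funM => //.
Qed.

Lemma natS_small x : 0 < x -> exists n, n.+2%:R^-1 <= x.
Proof.
move=> x0; exists (Num.truncn x^-1).
rewrite -[leRHS]invrK lef_pV2 ?posrE ?invr_gt0// ltW//.
by apply: lt_le_trans (truncnS_gt _) _; rewrite ler_nat.
Qed.

Lemma intg_pw_01 p : -1 < p ->
  intg `]0, 1] (pw p) /\ intg [set x | `]0, 1]%classic (- x)] (fun x => pw p (- x)).
Proof.
move=> p1; have q0 : 0 < p + 1 by lra.
apply: (@intg_exhaustion_opp _ (fun x => (p + 1)^-1 * pw (p + 1) x)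
  (fun n => n.+2%:R^-1) (fun=> 1) _ (p + 1)^-1) => //.
- apply/seteqP; split => x /=.
    rewrite in_itv/= => /andP[x0 x1]; have [n hn] := natS_small x0.
    by exists n => //=; rewrite in_itv/= hn x1.
  move=> [n _]; rewrite /= !in_itv/= => /andP[x0 ->].
  by rewrite andbT (lt_le_trans _ x0)// invr_gt0.
- by move=> n; rewrite invf_lt1// ltr1n.
- by move=> n; rewrite lef_pV2 ?posrE// ler_nat.
- move=> x; rewrite /= in_itv/= => /andP[x0 _].
  have := @is_deriveZ R R R (pw (p + 1)) (p + 1)^-1 x 1 _ (pw_derive (p + 1) x0).
  by rewrite addrK /GRing.scale /= mulrA mulVf ?gt_eqF// mul1r.
- by move=> x; rewrite /= in_itv/= => /andP[x0 _]; exact: pw_derivable.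
- by move=> x _; exact: ltW (pw_gt0 _ _).
- move=> x; rewrite /= in_itv/= => /andP[x0 x1].
  rewrite ger0_norm ?mulr_ge0 ?invr_ge0 ?(ltW (pw_gt0 _ _)) ?(ltW q0)//.
  by rewrite ler_piMr ?invr_ge0 ?(ltW q0)// pw_le1 ?(ltW q0)// x0.
- exact: measurable_funS (measurable_pw p).
Qed.

Lemma intg_pw_1y p : p < -1 -> intg `[1, +oo[ (pw p) /\
  intg [set x | `[1, +oo[%classic (- x)] (fun x => pw p (- x)).
Proof.
move=> p1; have q0 : p + 1 < 0 by lra.
apply: (@intg_exhaustion_opp _ (fun x => (p + 1)^-1 * pw (p + 1) x)
  (fun=> 1) (fun n => n.+2%:R) _ (- (p + 1)^-1)) => //.
- apply/seteqP; split => x /=.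
    rewrite in_itv/= andbT => x1; exists (Num.truncn x) => //=.
    rewrite in_itv/= x1/= ltW// (lt_le_trans (truncnS_gt _))// ler_nat//.
  by move=> [n _]; rewrite /= !in_itv/= => /andP[->].
- by move=> n; rewrite ltr1n.
- by move=> n; rewrite ler_nat.
- move=> x; rewrite /= in_itv/= andbT => x1.
  have x0 : 0 < x by lra.
  have := @is_deriveZ R R R (pw (p + 1)) (p + 1)^-1 x 1 _ (pw_derive (p + 1) x0).
  by rewrite addrK /GRing.scale /= mulrA mulVf ?lt_eqF// mul1r.
- by move=> x; rewrite /= in_itv/= andbT => x1; apply: pw_derivable; lra.
- by move=> x _; exact: ltW (pw_gt0 _ _).
- move=> x; rewrite /= in_itv/= andbT => x1.
  have i0 : 0 <= - (p + 1)^-1 by rewrite oppr_ge0 invr_le0 ltW.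
  rewrite normrM (gtr0_norm (pw_gt0 _ _)) -normrN ger0_norm//.
  by rewrite ler_piMr// pw_ge1_le1// ltW.
- exact: measurable_funS (measurable_pw p).
Qed.

Lemma not_intg_inv (d : R) : 0 < d -> ~ intg `]0, d[ (fun x => x^-1).
Proof.
move=> d0 h.
have [M hM] : exists M, M = \int[mu]_(x in `]0, d[) x^-1 by eexists.
have d2 : 0 < d / 2 by lra.
have [e [e0 ed el]] : exists e, [/\ 0 < e, e < d / 2 & ln e = ln (d / 2) - (`|M| + 1)].
  exists (d / 2 * expR (- (`|M| + 1))); split.
  - by rewrite mulr_gt0 ?expR_gt0.
  - by rewrite gtr_pMr// -expR0 ltr_expR; have := normr_ge0 M; lra.
  - by rewrite lnM ?posrE ?expR_gt0// expRK.
have ftc : (\int[mu]_(x in `[e, (d / 2)%R]) (x^-1)%:E = (ln (d / 2)%R)%:E - (ln e)%:E)%E.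
  apply: FTC_segment => // x /andP[ex _].
    by apply: is_derive1_ln; exact: lt_le_trans ex.
  by apply: derivableV => //; rewrite gt_eqF// (lt_le_trans e0).
have sub : (`[e, d / 2]%classic : set R) `<=` `]0, d[%classic.
  by move=> x /=; rewrite !in_itv/= => /andP[h1 h2]; apply/andP; split; lra.
have : (\int[mu]_(x in `[e, (d / 2)%R]) (x^-1)%:E <= \int[mu]_(x in `]0%R, d[) (x^-1)%:E)%E.
  apply: ge0_subset_integral => //.
    by case/integrableP : h.
  by move=> x; rewrite /= in_itv/= => /andP[x0 _]; rewrite lee_fin invr_ge0 ltW.
rewrite ftc -EFin_int// -EFinB lee_fin -hM el.
have := ler_norm M; lra.
Qed.

End powers.

(** * The boundary weight and the degenerate coefficient *)

Lemma measurable_inv_ge0 (R : realType) (D : set R) (f : R -> R) :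
  (forall x, D x -> 0 <= f x) -> measurable_fun D f ->
  measurable_fun D (fun x => (f x)^-1).
Proof.
move=> f0 mf; have h : measurable_fun D (fun x => f x `^ (-1)).
  exact: (measurableT_comp (measurable_powR _) mf).
by apply: eq_measurable_fun h => x /set_mem /f0 /powR_inv1.
Qed.

Lemma measurable_sqrt (R : realType) (D : set R) (f : R -> R) :
  measurable_fun D f -> measurable_fun D (fun x => Num.sqrt (f x)).
Proof.
move=> mf; apply: measurableT_comp mf.
by apply: continuous_measurable_fun; exact: sqrt_continuous.
Qed.

Section weight.
Context {R : realType}.
Local Notation mu := (@lebesgue_measure R).
Variable alpha : R.
Hypothesis alpha01 : 0 < alpha < 1.

Lemma eta_ge0 xi : 0 <= eta alpha xi. Proof. exact: powR_ge0. Qed.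

Lemma eta_sqE xi : xi != 0 -> eta alpha xi ^+ 2 = pw (2 * alpha - 1) `|xi|.
Proof.
move=> x0; rewrite /eta /powR normr_eq0 (negPf x0) -/(pw _ _) expr2 -pwD.
by rewrite -splitr.
Qed.

Lemma measurable_eta : measurable_fun setT (eta alpha).
Proof.
exact: (measurableT_comp (measurable_powR _) (@normr_measurable R setT)).
Qed.

Lemma intg_restrict (D : set R) (g : R -> R) : measurable D -> intg D g ->
  intg setT (g \_ D).
Proof.
move=> mD /(@integrable_mkcond _ _ _ mu _ _ mD).
by rewrite restrict_EFin.
Qed.

(** [eta^2 / (1 + xi^2)] behaves like [|xi|^(2 alpha - 1)] at the origin and
    like [|xi|^(2 alpha - 3)] at infinity. *)
Lemma intg_eta : intg setT (fun xi => eta alpha xi ^+ 2 / (1 + xi ^+ 2)).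
Proof.
have /andP[a0 a1] := alpha01.
have p1 : -1 < 2 * alpha - 1 by lra.
have p2 : 2 * alpha - 3 < -1 by lra.
have [i1 i2] := intg_pw_01 p1; have [i3 i4] := intg_pw_1y p2.
have mopp (D : set R) : measurable D -> measurable [set x : R | D (- x)].
  move=> mD; rewrite -[X in measurable X]setTI; exact: (@oppr_measurable R).
have i5 : intg `[-1, 1] (fun=> 1 : R).
  apply/integrableP; split; first exact: measurable_cst.
  rewrite integral_cst//= [X in (_ * X)%E](lebesgue_measure_itv `[-1, 1])/=.
  by rewrite lte_fin; case: ifP => _; rewrite ?mule0 ?ltry//= -EFinN -EFinD normr1 mul1e ltry.
have j1 := intg_restrict (measurable_itv _) i1.
have j2 := intg_restrict (mopp _ (measurable_itv _)) i2.
have j3 := intg_restrict (measurable_itv _) i3.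
have j4 := intg_restrict (mopp _ (measurable_itv _)) i4.
have j5 := intg_restrict (measurable_itv _) i5.
have J := intgD measurableT j5 (intgD measurableT (intgD measurableT j1 j2)
  (intgD measurableT j3 j4)).
apply: (intg_le measurableT _ J).
  apply: measurable_funM; first by apply: measurable_funX; exact: measurable_eta.
  apply: measurable_inv_ge0 => [x _|]; first by rewrite addr_ge0// sqr_ge0.
  by apply: measurable_funD => //; exact: measurable_funX.
move=> x _.
have r0 (D : set R) (g : R -> R) : (forall y, 0 <= g y) -> 0 <= (g \_ D) x.
  by move=> g0; rewrite patchE; case: ifP.
have pw0 (p y : R) : 0 <= pw p y := ltW (pw_gt0 p y).
have s1 := r0 `]0, 1]%classic _ (pw0 (2 * alpha - 1)).
have s2 := r0 [set x | `]0, 1]%classic (- x)] _ (fun y => pw0 (2 * alpha - 1) (- y)).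
have s3 := r0 `[1, +oo[%classic _ (pw0 (2 * alpha - 3)).
have s4 := r0 [set x | `[1, +oo[%classic (- x)] _ (fun y => pw0 (2 * alpha - 3) (- y)).
have s5 := r0 `[-1, 1]%classic (fun=> 1) (fun=> ler01).
have x2 : 0 < 1 + x ^+ 2 by have := sqr_ge0 x; lra.
rewrite ger0_norm ?divr_ge0 ?sqr_ge0 ?(ltW x2)//.
have rE (D : set R) (g : R -> R) : D x -> (g \_ D) x = g x.
  by move=> Dx; rewrite patchE mem_set.
have [x0|x0] := eqVneq x 0.
  have : eta alpha x ^+ 2 / (1 + x ^+ 2) <= 1.
    rewrite x0 expr0n addr0 divr1 /eta normr0 /powR eqxx.
    by case: (_ == 0); rewrite ?expr1n ?expr0n.
  have := rE `[-1, 1]%classic (fun=> 1); rewrite /= in_itv/= x0.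
  have -> : (-1 <= 0 :> R) && (0 <= 1 :> R) by apply/andP; split; lra.
  by move=> /(_ isT); rewrite x0 in s1 s2 s3 s4 s5 *; lra.
have nx0 : 0 < `|x| by rewrite normr_gt0.
have small : `|x| <= 1 -> eta alpha x ^+ 2 / (1 + x ^+ 2) <= pw (2 * alpha - 1) `|x|.
  move=> x1; rewrite eta_sqE// ler_pdivrMr// ler_peMr ?pw0//.
  by have := sqr_ge0 x; lra.
have large : eta alpha x ^+ 2 / (1 + x ^+ 2) <= pw (2 * alpha - 3) `|x|.
  rewrite eta_sqE//.
  have -> : pw (2 * alpha - 3) `|x| =
      pw (2 * alpha - 1) `|x| * (pw (-1) `|x| * pw (-1) `|x|).
    have -> : 2 * alpha - 3 = 2 * alpha - 1 + (-1 + -1) by ring.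
    by rewrite !pwD.
  rewrite !pwN1// ler_wpM2l ?pw0// -invfM -expr2.
  by rewrite real_normK ?num_real// lef_pV2 ?posrE ?exprn_even_gt0// lerDr.
have [xp|xn] := ltP 0 x.
  have nx : `|x| = x by rewrite gtr0_norm.
  rewrite nx in small large; have [x1|x1] := leP x 1.
    have := rE `]0, 1]%classic (pw (2 * alpha - 1)).
    by rewrite /= in_itv/= xp x1 => /(_ isT); have := small x1; lra.
  have := rE `[1, +oo[%classic (pw (2 * alpha - 3)).
  by rewrite /= in_itv/= (ltW x1) => /(_ isT); lra.
have xp : 0 < - x by rewrite oppr_gt0 lt_neqAle x0.
have nx : `|x| = - x by rewrite ler0_norm.
rewrite nx in small large; have [x1|x1] := leP (- x) 1.
  have := rE [set x | `]0, 1]%classic (- x)] (fun y => pw (2 * alpha - 1) (- y)).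
  by rewrite /= in_itv/= xp x1 => /(_ isT); have := small x1; lra.
have := rE [set x | `[1, +oo[%classic (- x)] (fun y => pw (2 * alpha - 3) (- y)).
by rewrite /= in_itv/= (ltW x1) => /(_ isT); lra.
Qed.

End weight.

Section coefficient.
Context {R : realType}.
Local Notation mu := (@lebesgue_measure R).
Variable tau : R -> R.
Hypothesis htau : admissible_tau tau.

Lemma expansion_within (D : set R) (f : R -> R) (x e : R) :
  derivable_within D f x -> 0 < e -> exists2 d, 0 < d & forall y, D y ->
    `|y - x| < d ->
    `|f y - f x - (y - x) * derive_within D f x| <= e * `|y - x|.
Proof.
move=> df e0; have : diff_quotient f x y @[y --> within D x^'] -->
  derive_within D f x by exact: df.
move=> /cvgrPdist_le /(_ _ e0).
rewrite near_withinE => /nbhs_ballP[d /= d0 hd].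
exists d => // y Dy yd; have [->|yx] := eqVneq y x.
  by rewrite !subrr mul0r subrr normr0 mulr0.
have := hd y; rewrite /ball/= distrC => /(_ yd yx Dy).
rewrite /diff_quotient => h.
have y0 : y - x != 0 by rewrite subr_eq0.
have -> : f y - f x - (y - x) * derive_within D f x =
    - ((y - x) * (derive_within D f x - (f y - f x) / (y - x))).
  by field.
by rewrite normrN normrM mulrC ler_wpM2r.
Qed.

Lemma tau_gt0 x : 0 < x <= 1 -> 0 < tau x.
Proof. by have [[_ _ _ h] _] := htau; exact: h. Qed.

Lemma tau_bounded : exists M, forall x, 0 <= x <= 1 -> tau x <= M.
Proof.
have [[c _ _ _] _] := htau.
have [//|y _ hy] := @EVT_max R tau 0 1 _ c.
by exists (tau y) => x x01; apply: hy; rewrite in_itv.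
Qed.

Lemma measurable_tau : measurable_fun (I01 : set R) tau.
Proof.
have [[c _ _ _] _] := htau.
have h : measurable_fun (`[0, 1]%classic : set R) tau.
  by apply: subspace_continuous_measurable_fun => //; exact: measurable_itv.
apply: measurable_funS h; first exact: measurable_itv.
by apply: subset_itv => //; rewrite bnd_simp.
Qed.

Lemma m_tau_ge x : 0 < x <= 1 ->
  ((x * `|derive_within `]0, 1]%classic tau x| / tau x)%:E <= m_tau tau)%E.
Proof.
by move=> x01; apply: ereal_sup_ubound; exists x => //=; rewrite in_itv.
Qed.

(** If [m_tau < 1], then [tau x / x^m_tau] is nonincreasing, so that
    [1 / tau] is dominated by an integrable power. *)
Lemma intg_inv_tau : (m_tau tau < 1%:E)%E -> intg I01 (fun x => (tau x)^-1).
Proof.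
move=> m1; have [[_ [_ dt _] _ _] _] := htau.
have h1 : 0 < (1 : R) <= 1 by rewrite ltr01 lexx.
have mfin : m_tau tau \is a fin_num.
  by rewrite fin_numElt (lt_le_trans (ltNyr _) (m_tau_ge h1)) (lt_trans m1 (ltry 1)).
have [m hm] : exists m, m_tau tau = m%:E.
  by exists (fine (m_tau tau)); rewrite fineK.
rewrite hm lte_fin in m1.
have bm (x : R) : 0 < x <= 1 -> x * `|derive_within `]0, 1]%classic tau x| <= m * tau x.
  move=> x01; have := m_tau_ge x01; rewrite hm lee_fin ler_pdivrMr//.
  exact: tau_gt0.
have dtau (x : R) : 0 < x < 1 ->
    is_derive x (1 : R) tau (derive_within `]0, 1]%classic tau x).
  move=> /andP[x0 x1]; apply: is_derive_of_expansion => e e0.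
  have Dx : `]0, 1]%classic x by rewrite /= in_itv/= x0 ltW.
  have [d d0 hd] := expansion_within (dt _ Dx) e0.
  exists (Num.min d (Num.min x (1 - x))).
    by rewrite !lt_min d0 x0 subr_gt0.
  move=> y; rewrite !lt_min => /and3P[yd yx y1]; apply: hd => //.
  move: yx y1; rewrite !ltr_norml /= in_itv/= => /andP[? ?] /andP[? ?].
  by apply/andP; split; lra.
pose g x := tau x * pw (- m) x.
have gd (x : R) : 0 < x < 1 -> is_derive x (1 : R) g
    (derive_within `]0, 1]%classic tau x * pw (- m) x - m * tau x * pw (- m - 1) x).
  move=> x01; have x0 : 0 < x by case/andP: x01.
  have := @is_deriveM R R _ _ x 1 _ _ (dtau x x01) (pw_derive (- m) x0).
  rewrite /GRing.scale /=; move=> h.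
  have := h; congr (is_derive _ _ _ _); ring.
have gneg (x : R) : 0 < x <= 1 ->
   derive_within `]0, 1]%classic tau x * pw (- m) x - m * tau x * pw (- m - 1) x <= 0.
  move=> x01; have x0 : 0 < x by case/andP: x01.
  have -> : pw (- m) x = x * pw (- m - 1) x.
    have e : - m = 1 + (- m - 1) by ring.
    by rewrite [in LHS]e pwD pw1.
  rewrite mulrA -mulrBl pmulr_lle0 ?pw_gt0// subr_le0.
  apply: le_trans (bm x x01); rewrite mulrC ler_wpM2l ?(ltW x0)//.
  exact: ler_norm.
have gmono (x : R) : 0 < x -> x <= 1 / 2 -> g (1 / 2) <= g x.
  move=> x0 x1.
  have in01 y : y \in `[x, 1 / 2] -> 0 < y < 1.
    by rewrite in_itv/= => /andP[h2 h3]; apply/andP; split; lra.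
  have [y|| c cx e] := @MVT_segment _ g (fun x =>
    derive_within `]0, 1]%classic tau x * pw (- m) x - m * tau x * pw (- m - 1) x)
    x (1 / 2) x1.
  - by move=> hy; apply: gd; apply: in01; exact: subset_itv_oo_cc hy.
  - by apply: derivable_within_continuous => y /in01 /gd h; exact: ex_derive.
  rewrite -subr_le0 e mulr_le0_ge0 ?subr_ge0//; apply: gneg.
  by have /andP[-> /ltW] := in01 _ cx.
have g2 : 0 < g (1 / 2).
  by rewrite mulr_gt0 ?pw_gt0// tau_gt0//; apply/andP; split; lra.
have ct : {within `[1 / 2, 1], continuous tau}.
  have [[c _ _ _] _] := htau; apply: continuous_subspaceW c.
  by apply: subset_itv => //; rewrite bnd_simp; lra.
have [|y y01 hy] := @EVT_min R tau (1 / 2) 1 _ ct; first lra.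
have ty : 0 < tau y.
  by apply: tau_gt0; move: y01; rewrite in_itv/= => /andP[? ?]; apply/andP; split; lra.
have [iP _] := @intg_pw_01 R (- m) ltac:(lra).
have mI : measurable (I01 : set R) by exact: measurable_itv.
have sub : (I01 : set R) `<=` `]0, 1]%classic.
  by apply: subset_itv => //; rewrite bnd_simp.
have iP' := intgS (measurable_itv _) mI sub iP.
have i1 : intg (I01 : set R) (fun=> 1).
  apply/integrableP; split; first exact: measurable_cst.
  rewrite integral_cst//= [X in (_ * X)%E](lebesgue_measure_itv `]0, 1[)/=.
  by rewrite lte_fin; case: ifP => _; rewrite ?mule0 ?ltry//= -EFinN -EFinD normr1 mul1e ltry.
have I := intgD mI (intgZ mI (g (1 / 2))^-1 iP') (intgZ mI (tau y)^-1 i1).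
apply: (intg_le mI _ I); first apply: measurable_inv_ge0.
  - move=> x; rewrite /I01 /= in_itv/= => /andP[x0 x1].
    by rewrite ltW// tau_gt0// x0 ltW.
  - exact: measurable_tau.
move=> x; rewrite /I01 /= in_itv/= => /andP[x0 x1].
have tx : 0 < tau x by apply: tau_gt0; rewrite x0 ltW.
rewrite gtr0_norm ?invr_gt0// mulr1.
have px := pw_gt0 (- m) x.
have [xl|xg] := leP x (1 / 2).
  rewrite ler_wpDr ?invr_ge0 ?(ltW ty)//.
  have h' : g (1 / 2) <= tau x * pw (- m) x by exact: gmono.
  have h2 : g (1 / 2) / tau x <= pw (- m) x by rewrite ler_pdivrMr// [leRHS]mulrC.
  rewrite -[leLHS](mulKf (lt0r_neq0 g2)) ler_wpM2l// invr_ge0 ltW//.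
rewrite ler_wpDl ?mulr_ge0 ?invr_ge0 ?(ltW g2) ?(ltW px)//.
rewrite lef_pV2 ?posrE//; apply: hy.
by rewrite in_itv/=; apply/andP; split; lra.
Qed.

(** If [m_tau >= 1], then [tau] is differentiable at the origin. *)
Lemma tau_le_linear : ~ (m_tau tau < 1%:E)%E -> exists2 C, 0 < C &
  forall x, 0 < x <= 1 -> tau x <= C * x.
Proof.
move=> m1; have [[_ _ t0 _] [m2 ck]] := htau.
have m1' : (1%:E <= m_tau tau)%E by rewrite leNgt; apply/negP.
have [m hm] : exists m, m_tau tau = m%:E.
  exists (fine (m_tau tau)); rewrite fineK//.
  by rewrite fin_numElt (lt_le_trans (ltNyr _) m1') (lt_trans m2 (ltry _)).
rewrite hm !lee_fin in m1'; rewrite hm lte_fin in m2.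
have : Num.truncn (fine (m_tau tau)) = 1%N.
  by rewrite hm /=; apply/truncn_def; rewrite m1' -natr1 m2.
move=> tr; rewrite tr /= in ck; have [_ dt _] := ck.
have D0 : `[0, 1]%classic (0 : R) by rewrite /= in_itv/= lexx ler01.
have [d d0 hd] := expansion_within (dt _ D0) ltr01.
have [M hM] := tau_bounded.
have M0 : 0 < M by apply: lt_le_trans (hM 1 _); rewrite ?tau_gt0 ?ltr01 ?lexx ?ler01.
pose L := derive_within `[0, 1]%classic tau 0.
have Md : 0 < M / d by exact: divr_gt0.
exists (`|L| + 1 + M / d); first by have := normr_ge0 L; lra.
move=> x /andP[x0 x1]; have [xd|dx] := ltP x d.
  have := hd x; rewrite /= in_itv/= (ltW x0) x1 subr0 gtr0_norm// t0 subr0.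
  move=> /(_ isT xd); rewrite mul1r -/L ler_norml => /andP[_ h].
  have := ler_wpM2r (ltW x0) (ler_norm L); have := mulr_gt0 Md x0; lra.
have h1 : tau x <= M by apply: hM; rewrite (ltW x0).
have h2 : M <= M / d * x by rewrite mulrAC ler_pdivlMr// ler_wpM2l// ltW.
have := mulr_ge0 (normr_ge0 L) (ltW x0); lra.
Qed.

End coefficient.

(** * Absolute continuity and equality almost everywhere *)

Section AC_regularity.
Context {R : realType}.
Local Notation mu := (@lebesgue_measure R).
Implicit Types (f g : R -> R) (a b : R).

Lemma AC_modulus a b f e : AC a b f -> 0 < e -> exists2 d, 0 < d & forall x y,
  a <= x <= b -> a <= y <= b -> `|x - y| < d -> `|f x - f y| < e.
Proof.
move=> h e0; have [d d0 hd] := AC_unif h e0; exists d => // x y.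
move=> /andP[ax xb] /andP[ay yb] xy; have [xy'|yx] := leP x y.
  rewrite distrC; apply: hd => //.
  by apply: le_lt_trans (ler_norm _) _; rewrite distrC.
by apply: hd => //; [exact: ltW|exact: le_lt_trans (ler_norm _) xy].
Qed.

Lemma AC_continuous_at a b f x : AC a b f -> a < x < b -> {for x, continuous f}.
Proof.
move=> h /andP[ax xb]; apply/cvgrPdist_lt => e e0.
have [d d0 hd] := AC_modulus h e0.
have x1 : a <= x <= b by rewrite !ltW.
near=> y.
have y1 : a < y < b.
  apply/andP; split.
    by near: y; exact: lt_nbhsr.
  by near: y; exact: lt_nbhsl.
have yd : `|x - y| < d by near: y; exact: cvgr_dist_lt.
by apply: hd => //; case/andP: y1 => ? ?; rewrite !ltW.
Unshelve. all: by end_near. Qed.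

(** Local absolute continuity on [(a, b]] is enough. *)
Lemma measurable_open_AC a b f :
  (forall c, a < c -> c < b -> AC c b f) -> measurable_fun `]a, b[ f.
Proof.
move=> h; apply: open_continuous_measurable_fun; first exact: interval_open.
move=> x; rewrite inE /= in_itv/= => /andP[ax xb].
have ac : a < (a + x) / 2 by lra.
have cb : (a + x) / 2 < b by lra.
by apply: AC_continuous_at (h _ ac cb) _; apply/andP; split; lra.
Qed.

Lemma AC_measurable a b f : AC a b f -> measurable_fun `]a, b[ f.
Proof.
by move=> h; apply: measurable_open_AC => c ac _; apply: AC_sub h => //; exact: ltW.
Qed.

Lemma ae1 (P Q : R -> Prop) : (forall x, P x -> Q x) ->
  {ae mu, forall x, P x} -> {ae mu, forall x, Q x}.
Proof. move=> h; apply: (@filterS _ _ (ae_filter_ringOfSetsType mu)); exact: h. Qed.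

Lemma ae2 (P Q S : R -> Prop) : (forall x, P x -> Q x -> S x) ->
  {ae mu, forall x, P x} -> {ae mu, forall x, Q x} -> {ae mu, forall x, S x}.
Proof. move=> h; apply: (@filterS2 _ _ (ae_filter_ringOfSetsType mu)); exact: h. Qed.

Lemma intg_cst a b (c : R) : intg `]a, b[ (fun=> c).
Proof.
apply/integrableP; split; first exact: measurable_cst.
rewrite integral_cst//= [X in (_ * X)%E](lebesgue_measure_itv `]a, b[)/=.
by rewrite lte_fin; case: ifP => _; rewrite ?mule0 ?ltry//= -EFinN -EFinD -EFinM ltry.
Qed.

Lemma int_cst a b (c : R) : a <= b -> \int[mu]_(t in `]a, b[) c = (b - a) * c.
Proof.
move=> ab; apply: etrans (Rintegral_cst mu (measurable_itv `]a, b[) c) _.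
rewrite mulrC [X in fine X](lebesgue_measure_itv `]a, b[)/= lte_fin.
by move: ab; rewrite le_eqVlt => /predU1P[<-|->]; rewrite ?ltxx ?subrr.
Qed.

Lemma ae_exists (P : R -> Prop) a b : a < b -> {ae mu, forall x, P x} ->
  exists2 x, a < x < b & P x.
Proof.
move=> ab [A [mA A0 hA]]; apply: contrapT => h.
have sub : (`]a, b[%classic : set R) `<=` A.
  move=> x; rewrite /= in_itv/= => xab; apply: hA => /= Px.
  by apply: h; exists x.
have := @le_measure _ _ _ mu `]a, b[%classic A.
rewrite !inE => /(_ (measurable_itv _) mA sub).
rewrite [X in (_ <= X)%E]A0 [X in (X <= _)%E](lebesgue_measure_itv `]a, b[)/=.
by rewrite lte_fin ab -EFinB lee_fin leNgt subr_gt0 ab.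
Qed.

Lemma AC_ae0 a b f : AC a b f -> ae_eq mu `]a, b[%classic f (fun=> 0) ->
  a < b -> forall x, a <= x <= b -> f x = 0.
Proof.
move=> h f0 ab x x1; apply/eqP; rewrite -normr_eq0 eq_le normr_ge0 andbT.
apply/ler_addgt0Pr => e e0; rewrite add0r.
have [d d0 hd] := AC_modulus h e0.
have [y y1 y0] : exists2 y, Num.max a (x - d / 2) < y < Num.min b (x + d / 2) &
    (`]a, b[%classic y -> f y = 0).
  apply: ae_exists => //.
  by move: x1 => /andP[? ?]; rewrite lt_min !gt_max; apply/andP; split; apply/andP; split; lra.
move: y1; rewrite lt_min gt_max => /andP[/andP[ay xy] /andP[yb yx]].
have yx' : `|x - y| < d by rewrite ltr_norml; apply/andP; split; lra.
have yab : a <= y <= b by rewrite !ltW.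
have := hd _ _ x1 yab yx'; rewrite y0 ?subr0 => [/ltW //|].
by rewrite /= in_itv/= ay yb.
Qed.

Lemma is_derive_uniq (f : R -> R) (x l l' : R) : is_derive x (1 : R) f l -> is_derive x (1 : R) f l' ->
  l = l'.
Proof. by move=> [_ <-] [_ <-]. Qed.

Lemma AC_ae0_derivative a b f g : AC a b f -> ae_eq mu `]a, b[%classic f (fun=> 0) ->
  {ae mu, forall x, x \in `]a, b[ -> is_derive x (1 : R) f (g x)} ->
  ae_eq mu `]a, b[%classic g (fun=> 0).
Proof.
move=> h f0; apply: filterS; first exact: (ae_filter_ringOfSetsType mu).
move=> x dx xab.
have /andP[ax xb] : a < x < b by move: xab; rewrite /= in_itv.
have ab : a < b by exact: lt_trans xb.
have z := AC_ae0 h f0 ab.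
apply: is_derive_uniq (dx _) _ => //.
apply: is_derive_of_expansion => e e0.
exists (Num.min (x - a) (b - x)); first by rewrite lt_min !subr_gt0 ax.
move=> y; rewrite lt_min !ltr_norml => /andP[/andP[? ?] /andP[? ?]].
have -> : f y = 0 by apply: z; apply/andP; split; lra.
rewrite z ?(ltW ax) ?(ltW xb)// mulr0 !subr0 normr0 mulr_ge0//; exact: ltW.
Qed.

Lemma ae_itv_exhaust (P : R -> Prop) :
  (forall a, 0 < a -> a < 1 -> {ae mu, forall x, `]a, 1[%classic x -> P x}) ->
  {ae mu, forall x, (I01 : set R) x -> P x}.
Proof.
move=> h.
have h2 n : {ae mu, forall x, `]n.+2%:R^-1, 1[%classic x -> P x}.
  by apply: h; [rewrite invr_gt0|rewrite invf_lt1// ltr1n].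
have /(@ae_foralln _ _ _ mu) := h2.
apply: filterS => x hx; rewrite /I01 /= in_itv/= => /andP[x0 x1].
have x2 : 0 < x / 2 by lra.
have [n hn] := natS_small x2.
apply: (hx n); rewrite /= in_itv/= x1 andbT.
by apply: le_lt_trans hn _; lra.
Qed.

End AC_regularity.

Lemma l2_intg (R : realType) (a b : R) (f : R -> R) : l2 `]a, b[ f -> intg `]a, b[ f.
Proof.
have mD : measurable (`]a, b[%classic : set R) by exact: measurable_itv.
move=> [mf f2]; apply: (intg_le mD mf (intgD mD (intg_cst a b 1) f2)) => x _.
by rewrite -(real_normK (num_real _)); have := sqr_ge0 (`|f x| - 1); nra.
Qed.

Section ae_transfer.
Context {R : realType}.
Local Notation mu := (@lebesgue_measure R).
Variables (D : set R) (mD : measurable D).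

Lemma intg_ae (f g : R -> R) : measurable_fun D g -> ae_eq mu D f g ->
  intg D f -> intg D g.
Proof.
move=> mg fg hf; have [mf f2] := integrableP _ _ _ hf.
apply/integrableP; split; first exact/measurable_EFinP.
apply: le_lt_trans f2; rewrite le_eqVlt; apply/orP; left; apply/eqP.
apply: ge0_ae_eq_integral => //.
- by do 2 apply: measurableT_comp => //.
- by apply: measurableT_comp.
- by apply: filterS fg => x h Dx /=; rewrite h.
Qed.

Lemma l2_ae (f g : R -> R) : measurable_fun D g -> ae_eq mu D f g ->
  l2 D f -> l2 D g.
Proof.
move=> mg fg [mf f2]; split => //; apply: intg_ae f2.
  exact: measurable_funX.
by apply: filterS fg => x h Dx /=; rewrite h.
Qed.

End ae_transfer.

(** * Green's identity for the degenerate operator *)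

Section flux.
Context {R : realType}.
Local Notation mu := (@lebesgue_measure R).
Variable tau : R -> R.
Hypothesis htau : admissible_tau tau.
Local Notation mI := (measurable_itv `]0 : R, 1[).
Implicit Types p q w dw : R -> R.

Definition vanishes p := forall e : R, 0 < e -> exists2 d, 0 < d &
  forall x, 0 < x -> x < d -> `|p x| < e.

(** One real component of an element [p] of the domain, with [q = p'],
    [w = tau p'] and [dw = w']. *)
Record flux p q w dw : Prop := Flux {
  flux_l2 : l2 I01 p;
  flux_AC : forall a, 0 < a -> a < 1 -> AC a 1 p;
  flux_der : {ae mu, forall x, I01 x -> is_derive x (1 : R) p (q x)};
  flux_energy : l2 I01 (fun x => Num.sqrt (tau x) * q x);
  flux_eq : ae_eq mu I01 w (fun x => tau x * q x);
  flux_ACw : AC 0 1 w;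
  flux_derw : {ae mu, forall x, I01 x -> is_derive x (1 : R) w (dw x)};
  flux_l2dw : l2 I01 dw;
  flux_bc : (m_tau tau < 1%:E)%E -> vanishes p
}.

Lemma is_derive_lin c (f g : R -> R) (x df dg : R) : is_derive x (1 : R) f df ->
  is_derive x (1 : R) g dg -> is_derive x (1 : R) (fun y => c * f y + g y) (c * df + dg).
Proof. by move=> hf hg; apply: is_deriveD; apply: is_deriveZ. Qed.

Lemma is_derive_mul (f g : R -> R) (x df dg : R) : is_derive x (1 : R) f df ->
  is_derive x (1 : R) g dg ->
  is_derive x (1 : R) (fun y => f y * g y) (f x * dg + g x * df).
Proof. by move=> hf hg; exact: is_deriveM. Qed.

Lemma flux_lin c p q w dw p' q' w' dw' : flux p q w dw -> flux p' q' w' dw' ->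
  flux (fun x => c * p x + p' x) (fun x => c * q x + q' x)
       (fun x => c * w x + w' x) (fun x => c * dw x + dw' x).
Proof.
move=> [a1 a2 a3 a4 a5 a6 a7 a8 a9] [b1 b2 b3 b4 b5 b6 b7 b8 b9]; split.
- exact: (l2_lin mI).
- by move=> a a0 al; apply: AC_lin; [exact: a2|exact: b2].
- move: a3 b3; apply: ae2 => x h h' Ix; exact: is_derive_lin (h Ix) (h' Ix).
- have := l2_lin mI c a4 b4; congr (l2 _ _); apply/funext => x; ring.
- move: a5 b5; apply: ae2 => x h h' Ix; rewrite h// h'//; ring.
- exact: AC_lin.
- move: a7 b7; apply: ae2 => x h h' Ix; exact: is_derive_lin (h Ix) (h' Ix).
- exact: (l2_lin mI).
- move=> m1 e e0.
  have c0 : 0 < `|c| + 1 by rewrite ltr_wpDl.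
  have e2 : 0 < e / 2 / (`|c| + 1) by rewrite !divr_gt0.
  have e3 : 0 < e / 2 by rewrite divr_gt0.
  have [d d0 hd] := a9 m1 _ e2; have [d' d'0 hd'] := b9 m1 _ e3.
  exists (Num.min d d'); first by rewrite lt_min d0.
  move=> x x0; rewrite lt_min => /andP[xd xd'].
  apply: le_lt_trans (ler_normD _ _) _; rewrite normrM.
  have h1 := hd _ x0 xd; have h2 := hd' _ x0 xd'.
  have : (`|c| + 1) * `|p x| < e / 2 by rewrite mulrC -ltr_pdivlMr.
  by have := normr_ge0 (p x); lra.
Qed.

(** When [1 / tau] is not integrable the flux has to vanish at 0, because
    [w^2 / tau] is integrable, and as [w' \in L^2] it does so like [sqrt x]. *)
Lemma flux_small p q w dw : ~ (m_tau tau < 1%:E)%E -> flux p q w dw ->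
  exists2 K, 0 < K & forall x, 0 < x -> x <= 1 -> `|w x| <= K * Num.sqrt x.
Proof.
move=> m1 [_ _ _ [_ e2] weq wAC wder [mdw dw2] _].
have [C C0 hC] := tau_le_linear htau m1.
have w0 : w 0 = 0.
  apply/eqP; apply: contrapT => /negP w00.
  have c0 : 0 < `|w 0| / 2 by rewrite divr_gt0// normr_gt0.
  have [d d0 hd] := AC_modulus wAC c0.
  pose d' := Num.min d 1.
  have d'0 : 0 < d' by rewrite lt_min d0 ltr01.
  have d'1 : d' <= 1 by rewrite ge_min lexx orbT.
  have d'd : d' <= d by rewrite ge_min lexx.
  have sub : (`]0, d'[%classic : set R) `<=` I01.
    by apply: subset_itv => //; rewrite bnd_simp.
  have md' : measurable (`]0, d'[%classic : set R) by exact: measurable_itv.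
  apply: (not_intg_inv d'0).
  have i1 : intg I01 (fun x => w x ^+ 2 / tau x).
    apply: (intg_ae mI _ _ e2).
    - apply: measurable_funM.
        by apply: measurable_funX; apply: AC_measurable wAC.
      apply: measurable_inv_ge0; last exact: measurable_tau.
      move=> x; rewrite /I01 /= in_itv/= => /andP[x0 x1].
      by rewrite ltW// tau_gt0// x0 ltW.
    - move: weq; apply: ae1 => x h Ix; rewrite h//.
      move: Ix; rewrite /I01 /= in_itv/= => /andP[x0 x1].
      have t0 : 0 < tau x by rewrite tau_gt0// x0 ltW.
      rewrite !exprMn sqr_sqrtr ?(ltW t0)//; field; exact: lt0r_neq0.
  have i2 := intgS (measurable_itv _) md' sub i1.
  apply: (intg_le md' _ (intgZ md' (C / (`|w 0| / 2) ^+ 2) i2)).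
    by apply: measurable_inv_ge0 => // x; rewrite /= in_itv/= => /andP[/ltW].
  move=> x; rewrite /= in_itv/= => /andP[x0 xd].
  have x1 : x <= 1 by rewrite (le_trans (ltW xd)).
  have t0 : 0 < tau x by rewrite tau_gt0// x0.
  have tx : tau x <= C * x by apply: hC; rewrite x0.
  have wx : `|w 0| / 2 <= `|w x|.
    have := hd x 0; rewrite (ltW x0) x1 lexx ler01 subr0 gtr0_norm// => /(_ isT isT).
    move=> /(_ (lt_le_trans xd d'd)) h; have := ler_norm (`|w 0| - `|w x|).
    by have := lerB_dist (w 0) (w x); rewrite distrC; lra.
  move: (`|w 0| / 2) c0 wx => b c0 wx.
  have wx2 : b ^+ 2 <= w x ^+ 2.
    by rewrite -(real_normK (num_real (w x))) lerXn2r ?nnegrE ?(ltW c0).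
  rewrite gtr0_norm ?invr_gt0//.
  have -> : C / b ^+ 2 * (w x ^+ 2 / tau x) = (w x ^+ 2 / b ^+ 2) * (C / tau x).
    by field; rewrite (lt0r_neq0 t0) (lt0r_neq0 c0).
  have : x^-1 <= C / tau x by rewrite ler_pdivlMr// mulrC ler_pdivrMr.
  have b2 : 0 < b ^+ 2 by rewrite exprn_gt0.
  have : 1 <= w x ^+ 2 / b ^+ 2 by rewrite ler_pdivlMr// mul1r.
  have : 0 < x^-1 by rewrite invr_gt0.
  move: (C / tau x) (w x ^+ 2 / b ^+ 2) (x^-1) => A B D h1 h2 h3.
  have := ler_wpM2r (le_trans (ltW h1) h3) h2; lra.
have [F [FAC _ FE]] := AC_antiderivative ler01 dw2.
have [M hM] := AC_bounded FAC ler01.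
exists (1 + `|M|) => [|x x0 x1]; first by rewrite ltr_pwDl.
have s0 : 0 < Num.sqrt x by rewrite sqrtr_gt0.
have xE : x = Num.sqrt x ^+ 2 by rewrite sqr_sqrtr// ltW.
have mx : measurable (`]0, x[%classic : set R) by exact: measurable_itv.
have sub : (`]0, x[%classic : set R) `<=` I01.
  by apply: subset_itv => //; rewrite bnd_simp.
have i1 := intgS (measurable_itv _) mx sub dw2.
have idw : intg I01 dw by exact: l2_intg.
have iw := intgS (measurable_itv _) mx sub idw.
have wE : w x = \int[mu]_(t in `]0, x[) dw t.
  rewrite -(AC_FTC (ltW x0) (AC_sub _ _ wAC) _ iw)// ?w0 ?subr0//.
  by move: wder; apply: ae1 => y h yx; apply: h; exact: sub.
set s := Num.sqrt x in s0 xE *.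
have FM : \int[mu]_(t in `]0, x[) (dw t ^+ 2) <= 2 * `|M|.
  rewrite -FE ?(ltW x0)//.
  have h1 : `|F 0| <= M by apply: hM; rewrite lexx ler01.
  have h2 : `|F x| <= M by apply: hM; rewrite ltW.
  have := ler_norm (F x); have := ler_norm (- F 0); rewrite normrN.
  by have := ler_norm M; lra.
(* [s^-1] is the weight that balances [int_0^x 1] against [sqrt x] *)
have young (u : R) : u <= (s^-1 + s * u ^+ 2) / 2.
  have : 0 <= s^-1 * (s * u - 1) ^+ 2.
    by rewrite mulr_ge0 ?sqr_ge0// invr_ge0 ltW.
  have -> : s^-1 * (s * u - 1) ^+ 2 = s * u ^+ 2 - 2 * u + s^-1.
    by field; exact: lt0r_neq0.
  lra.
have ig : intg `]0, x[ (fun t => (s^-1 + s * dw t ^+ 2) / 2).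
  have := intgZ mx 2^-1 (intgD mx (intg_cst 0 x s^-1) (intgZ mx s i1)).
  by congr (intg _ _); apply/funext => t; rewrite mulrC.
have igE : \int[mu]_(t in `]0, x[) ((s^-1 + s * dw t ^+ 2) / 2) <=
    (1 + `|M|) * s.
  have -> : \int[mu]_(t in `]0, x[) ((s^-1 + s * dw t ^+ 2) / 2) =
     2^-1 * (x * s^-1 + s * \int[mu]_(t in `]0, x[) (dw t ^+ 2)).
    have c1 := int_cst s^-1 (ltW x0); rewrite subr0 in c1.
    rewrite -(intZ mx _ i1) -c1.
    rewrite -(intD mx (intg_cst _ _ _) (intgZ mx s i1)).
    rewrite -(intZ mx _ (intgD mx (intg_cst 0 x s^-1) (intgZ mx s i1))).
    by apply: eq_int => // t _; rewrite mulrC.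
  have -> : x * s^-1 = s by rewrite xE expr2 mulfK// lt0r_neq0.
  have := ler_wpM2l (ltW s0) FM; lra.
rewrite wE; apply/ler_normlP; split; last first.
  by apply: le_trans igE; apply: int_le.
rewrite -mulN1r -(intZ mx _ iw); apply: le_trans igE; apply: int_le => //.
  exact: intgZ.
by move=> t _; rewrite mulN1r (le_trans (young _))// sqrrN.
Qed.

Lemma flux_mul p q w dw p' q' w' dw' : flux p q w dw -> flux p' q' w' dw' ->
  forall a, 0 < a -> a < 1 -> AC a 1 (fun x => w x * p' x).
Proof.
move=> [_ _ _ _ _ wAC _ _ _] [_ pAC _ _ _ _ _ _ _] a a0 a1.
apply: AC_mul; [exact: ltW| |exact: pAC].
by apply: AC_sub wAC => //; exact: ltW.
Qed.

(** Integration by parts for the pair of real components: the boundary term at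
    0 has a limit since its derivative is integrable, and this limit is 0:
    either [p] tends to 0, or the flux is [O(sqrt x)] and a nonzero limit would
    make [p ^ 2] comparable to the nonintegrable [1 / x]. *)
Theorem green p1 q1 w1 d1 p2 q2 w2 d2 :
  flux p1 q1 w1 d1 -> flux p2 q2 w2 d2 ->
  \int[mu]_(x in I01) (d1 x * p2 x - d2 x * p1 x) = w1 1 * p2 1 - w2 1 * p1 1.
Proof.
move=> F1 F2.
have [l1 A1 D1 E1 W1 AW1 DW1 L1 B1] := F1.
have [l2' A2 D2 E2 W2 AW2 DW2 L2 B2] := F2.
have ik : intg I01 (fun x => d1 x * p2 x - d2 x * p1 x).
  exact: (intgB mI (l2_mul mI L1 l2') (l2_mul mI L2 l1)).
pose g x := -1 * (w2 x * p1 x) + w1 x * p2 x.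
have gAC a : 0 < a -> a < 1 -> AC a 1 g.
  move=> a0 a1; apply: AC_lin; first exact: flux_mul F2 F1 _ a0 a1.
  exact: flux_mul F1 F2 _ a0 a1.
have gder : {ae mu, forall x, I01 x ->
    is_derive x (1 : R) g (d1 x * p2 x - d2 x * p1 x)}.
  have H : {ae mu, forall x, I01 x ->
    is_derive x (1 : R) g (d1 x * p2 x - d2 x * p1 x + (w1 x * q2 x - w2 x * q1 x))}.
    move: (ae2 (fun x h h' Ix => is_derive_mul (h Ix) (h' Ix)) DW1 D2).
    move: (ae2 (fun x h h' Ix => is_derive_mul (h Ix) (h' Ix)) DW2 D1).
    apply: ae2 => x h h' Ix.
    have := is_derive_lin (-1) (h Ix) (h' Ix).
    by congr (is_derive _ _ _ _); ring.
  have W : ae_eq mu I01 (fun x => w1 x * q2 x - w2 x * q1 x) (fun=> 0).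
    by move: W1 W2; apply: ae2 => x h h' Ix; rewrite h// h'//; ring.
  by move: H W; apply: ae2 => x h h' Ix; rewrite -[X in is_derive _ _ _ X]addr0 -(h' Ix); exact: h.
have [F [FAC _ FE]] := AC_antiderivative ler01 ik.
have mono (a x : R) : 0 < a -> (`]a, 1[%classic : set R) x -> I01 x.
  by move=> a0; rewrite /I01 /= !in_itv/= => /andP[ax ->]; rewrite (lt_trans a0).
have gF a : 0 < a -> a < 1 -> g 1 - g a = F 1 - F a.
  move=> a0 a1; rewrite FE ?(ltW a0) ?(ltW a1)//; apply: AC_FTC; [exact: ltW|exact: gAC| |].
    by move: gder; apply: ae1 => x h ax; apply: h; exact: mono ax.
  by apply: (intgS mI (measurable_itv _) _ ik) => x; exact: mono.
rewrite -FE//; have -> : w1 1 * p2 1 - w2 1 * p1 1 = g 1 by rewrite /g; ring.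
(* [L] is the limit of [g] at 0 *)
set L := g 1 - (F 1 - F 0).
suff L0 : L = 0 by rewrite /L in L0; lra.
have gL e : 0 < e -> exists2 d, 0 < d & forall a, 0 < a -> a < d -> a < 1 ->
    `|g a - L| < e.
  move=> e0; have [d d0 hd] := AC_modulus FAC e0; exists d => // a a0 ad a1.
  have -> : g a - L = F a - F 0 by have := gF a a0 a1; rewrite /L; lra.
  by apply: hd; rewrite ?lexx ?ler01 ?(ltW a0) ?(ltW a1)// subr0 gtr0_norm.
have gle (K x : R) : `|w1 x| <= K -> `|w2 x| <= K ->
    `|g x| <= K * (`|p1 x| + `|p2 x|).
  move=> h1 h2; rewrite /g mulN1r; apply: le_trans (ler_normD _ _) _.
  rewrite normrN !normrM mulrDr.
  by apply: lerD; apply: ler_wpM2r.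
clear D1 D2 E1 E2 W1 W2 DW1 DW2 ik gAC gder FE FAC mono gF.
have [m1|m1] := boolP (m_tau tau < 1%:E)%E.
  have [M1 hM1] := AC_bounded AW1 ler01; have [M2 hM2] := AC_bounded AW2 ler01.
  pose K := Num.max 1 (Num.max M1 M2).
  have K0 : 0 < K by rewrite lt_max ltr01.
  apply/eqP; rewrite -normr_eq0 eq_le normr_ge0 andbT; apply/ler_addgt0Pr => e e0.
  rewrite add0r.
  have e3 : 0 < e / 3 by rewrite divr_gt0.
  have e4 : 0 < e / 3 / K by rewrite divr_gt0.
  have [d d0 hd] := gL _ e3.
  have [d' d'0 hd'] := B1 m1 _ e4; have [d'' d''0 hd''] := B2 m1 _ e4.
  pose a := (Num.min (Num.min d 1) (Num.min d' d'')) / 2.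
  have a0' : 0 < Num.min (Num.min d 1) (Num.min d' d'') by rewrite !lt_min d0 d'0 d''0 ltr01.
  have a0 : 0 < a by rewrite divr_gt0.
  have : a < Num.min (Num.min d 1) (Num.min d' d'') by rewrite /a; lra.
  rewrite !lt_min => /andP[/andP[ad a1] /andP[ad' ad'']].
  have a01 : 0 <= a <= 1 by rewrite (ltW a0) (ltW a1).
  have h1 : `|w1 a| <= K by rewrite (le_trans (hM1 _ a01))// !le_max lexx orbT.
  have h2 : `|w2 a| <= K by rewrite (le_trans (hM2 _ a01))// !le_max lexx !orbT.
  have h3 := gle _ _ h1 h2; have h4 := hd _ a0 ad a1.
  have h5 : K * `|p1 a| < e / 3 by rewrite mulrC -ltr_pdivlMr//; exact: hd'.
  have h6 : K * `|p2 a| < e / 3 by rewrite mulrC -ltr_pdivlMr//; exact: hd''.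
  rewrite mulrDr in h3.
  have := ler_normB (g a) (g a - L); rewrite opprB addrCA subrr addr0.
  move: h3 h4 h5 h6; clear; lra.
move/negP in m1.
have [K1 K10 hK1] := flux_small m1 F1; have [K2 K20 hK2] := flux_small m1 F2.
apply: contrapT => /eqP L0.
have L2' : 0 < `|L| / 2 by rewrite divr_gt0// normr_gt0.
have [d d0 hd] := gL _ L2'.
pose d' := Num.min d 1.
have d'0 : 0 < d' by rewrite lt_min d0 ltr01.
have d'1 : d' <= 1 by rewrite ge_min lexx orbT.
have d'd : d' <= d by rewrite ge_min lexx.
have sub : (`]0, d'[%classic : set R) `<=` I01.
  by apply: subset_itv => //; rewrite bnd_simp.
have md' : measurable (`]0, d'[%classic : set R) by exact: measurable_itv.
have i2 := intgS mI md' sub (intgD mI (proj2 l1) (proj2 l2')).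
apply: (not_intg_inv d'0).
apply: (intg_le md' _ (intgZ md' (2 * ((K1 + K2) / (`|L| / 2)) ^+ 2) i2)).
  by apply: measurable_inv_ge0 => // x; rewrite /= in_itv/= => /andP[/ltW].
move=> x; rewrite /= in_itv/= => /andP[x0 xd].
have x1 : x < 1 by rewrite (lt_le_trans xd).
have h1 : `|w1 x| <= (K1 + K2) * Num.sqrt x.
  by rewrite (le_trans (hK1 _ x0 (ltW x1)))// ler_wpM2r ?sqrtr_ge0// lerDl ltW.
have h2 : `|w2 x| <= (K1 + K2) * Num.sqrt x.
  by rewrite (le_trans (hK2 _ x0 (ltW x1)))// ler_wpM2r ?sqrtr_ge0// lerDr ltW.
have h3 := gle _ _ h1 h2; have h4 := hd _ x0 (lt_le_trans xd d'd) x1.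
have h5 : `|L| / 2 <= (K1 + K2) * Num.sqrt x * (`|p1 x| + `|p2 x|).
  have := ler_normB (g x) (g x - L); rewrite opprB addrCA subrr addr0.
  by move: h3 h4; clear; lra.
have K0 : 0 < K1 + K2 by rewrite addr_gt0.
have s0 : 0 < Num.sqrt x by rewrite sqrtr_gt0.
have xE : x = Num.sqrt x ^+ 2 by rewrite sqr_sqrtr// ltW.
rewrite gtr0_norm ?invr_gt0// [X in X^-1]xE.
rewrite -(real_normK (num_real (p1 x))) -(real_normK (num_real (p2 x))).
move: (`|L| / 2) (K1 + K2) (Num.sqrt x) `|p1 x| `|p2 x| h5 L2' K0 s0.
clear=> l K s a b h l0 K0 s0.
have {}h : s^-1 <= K / l * (a + b).
  have ln : l != 0 by rewrite lt0r_neq0.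
  rewrite -div1r ler_pdivrMr//.
  have -> : K / l * (a + b) * s = K * s * (a + b) / l by field.
  by rewrite ler_pdivlMr// mul1r.
have : s^-1 ^+ 2 <= (K / l * (a + b)) ^+ 2.
  have s1 : 0 <= s^-1 by rewrite invr_ge0 ltW.
  by rewrite lerXn2r ?nnegrE ?(le_trans s1 h).
rewrite exprVn => /le_trans; apply; rewrite exprMn.
have ab : (a + b) ^+ 2 <= 2 * (a ^+ 2 + b ^+ 2) by have := sqr_ge0 (a - b); nra.
by have := ler_wpM2l (sqr_ge0 (K / l)) ab; move: ((K / l) ^+ 2) => k; nra.
Qed.

End flux.

(** * Regularity of weak solutions *)

Section weak_solutions.
Context {R : realType}.
Local Notation mu := (@lebesgue_measure R).
Implicit Types (f g : R -> R).

Lemma AC_eq (a b : R) f g : (forall x, a <= x <= b -> f x = g x) -> AC a b f -> AC a b g.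
Proof.
move=> fg h e e0; have [d d0 hd] := h e e0; exists d => // n l r lr tr sd.
rewrite -(eq_bigr _ (fun i _ => _ : `|f (r i) - f (l i)| = _)).
  exact: hd.
move=> i _; have [al lri rb] := lr i.
by rewrite !fg// ?al ?rb ?(le_trans lri rb)// ?(le_trans al lri).
Qed.

Lemma is_derive_eq_on (a b : R) f g (x l : R) : (forall y, a < y < b -> f y = g y) ->
  a < x < b -> is_derive x (1 : R) f l -> is_derive x (1 : R) g l.
Proof.
move=> fg xab df; apply: is_derive_of_expansion => e e0.
have [d d0 hd] := expansion_of_is_derive df e0.
exists (Num.min d (Num.min (x - a) (b - x))).
  by move: xab => /andP[? ?]; rewrite !lt_min d0 !subr_gt0 /=; apply/andP; split.
move=> y; rewrite !lt_min !ltr_norml => /andP[/andP[h1 h2] /andP[/andP[h3 h4] /andP[h5 h6]]].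
rewrite -!fg//; first by apply: hd; rewrite ltr_norml h1.
by apply/andP; split; lra.
Qed.

Lemma intg_bounded (D : set R) (M : R) f g : measurable D -> measurable_fun D f ->
  (forall x, D x -> `|f x| <= M) -> intg D g -> intg D (fun x => f x * g x).
Proof.
move=> mD mf fM ig.
have ia : intg D (fun x => `|g x|) by exact: (integrable_norm ig).
apply: (intg_le mD _ (intgZ mD M ia)).
  exact: measurable_funM mf (intg_meas ig).
by move=> x Dx; rewrite normrM ler_wpM2r// fM.
Qed.

(** The value at [x] of the antiderivative of [- f] that vanishes at 1. *)
Definition tail f (x : R) : R := \int[mu]_(t in `]x, 1[) f t.

Lemma tail_antiderivative (a : R) f : a <= 1 -> intg `]a, 1[ f -> exists F,
  [/\ AC a 1 F, {ae mu, forall x, x \in `]a, 1[ -> is_derive x (1 : R) F (f x)} &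
      forall x, a <= x <= 1 -> tail f x = F 1 - F x].
Proof.
move=> a1 /(AC_antiderivative a1)[F [h1 h2 h3]]; exists F; split=> // x /andP[ax x1].
by rewrite h3.
Qed.

(** Removing from the domain of integration a part where [f] vanishes. *)
Lemma tail_support (a b : R) f : 0 <= b -> b <= a -> a < 1 -> intg I01 f ->
  (forall x, 0 < x -> x < a -> f x = 0) -> tail f b = tail f a.
Proof.
move=> b0 ba a1 i0 f0; have [F [_ _ FE]] := AC_antiderivative ler01 i0.
have a0 := le_trans b0 ba; have b1 := le_lt_trans ba a1.
rewrite /tail -!FE ?(ltW a1) ?(ltW b1)//.
suff : F a - F b = 0 by lra.
rewrite FE ?(ltW a1)// (@eq_int _ _ _ (fun=> 0)); last first.
  by move=> x; rewrite /= in_itv/= => /andP[bx xa]; apply: f0 => //; exact: le_lt_trans bx.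
by rewrite int_cst ?mulr0.
Qed.

Variable tau : R -> R.
Hypothesis htau : admissible_tau tau.
Local Notation mI := (measurable_itv `]0 : R, 1[).

Lemma tau_gt0_01 (x : R) : I01 x -> 0 < tau x.
Proof. by rewrite /I01 /= in_itv/= => /andP[x0 x1]; rewrite tau_gt0// x0 ltW. Qed.

Lemma tau_away0 (a : R) : 0 < a -> a < 1 -> exists2 m, 0 < m &
  forall x, a <= x <= 1 -> m <= tau x.
Proof.
move=> a0 a1; have [[c _ _ _] _] := htau.
have c' : {within `[a, 1], continuous tau}.
  by apply: continuous_subspaceW c => x; rewrite /= !in_itv/= => /andP[ax ->]; rewrite (le_trans (ltW a0)).
have [y yin hy] := EVT_min (ltW a1) c'.
move: yin; rewrite in_itv/= => /andP[ay y1].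
by exists (tau y); [rewrite tau_gt0// (lt_le_trans a0)|move=> x xa; apply: hy; rewrite in_itv].
Qed.

Lemma measurable_inv_tau : measurable_fun (I01 : set R) (fun x => (tau x)^-1).
Proof.
apply: measurable_inv_ge0 (measurable_tau htau) => x /tau_gt0_01; exact: ltW.
Qed.

Lemma measurable_inv_sqrt_tau :
  measurable_fun (I01 : set R) (fun x => (Num.sqrt (tau x))^-1).
Proof.
apply: measurable_inv_ge0 (measurable_sqrt (measurable_tau htau)) => x _.
exact: sqrtr_ge0.
Qed.

Lemma sub_I01 (a : R) : 0 < a -> (`]a, 1[%classic : set R) `<=` I01.
Proof.
by move=> a0 x; rewrite /I01 /= !in_itv/= => /andP[ax ->]; rewrite (lt_trans a0).
Qed.

Lemma intg_inv_tau_away0 (a : R) : 0 < a -> a < 1 ->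
  intg `]a, 1[ (fun x => (tau x)^-1).
Proof.
move=> a0 a1; have [m m0 hm] := tau_away0 a0 a1.
have ma : measurable (`]a, 1[%classic : set R) by exact: measurable_itv.
apply: (intg_le ma _ (intg_cst a 1 m^-1)).
  exact: measurable_funS mI (sub_I01 a0) measurable_inv_tau.
move=> x xa; have t0 := tau_gt0_01 (sub_I01 a0 xa).
rewrite gtr0_norm ?invr_gt0// lef_pV2 ?posrE//.
by apply: hm; move: xa; rewrite /= in_itv/= => /andP[? ?]; rewrite !ltW.
Qed.

(** The closed constraint [sqrt tau * v = c - int_x^1 u], that is,
    [v = chi / sqrt tau] for the function [chi] with [chi' = u], [chi(1) = c]. *)
Definition testfun (c : R) u v :=
  ae_eq mu I01 (fun x => Num.sqrt (tau x) * v x) (fun x => c - tail u x).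

(** If [psi] satisfies the weak form of [sqrt tau * psi' = v], [psi(1) = P], then
    integrating [v / sqrt tau] back from 1 gives a function [p] with the
    regularity required by the domain.  Testing against the antiderivative of
    [(psi - p) 1_(a, 1)] shows [psi = p], and testing against 1, which is allowed
    when [1 / tau] is integrable, gives [p(0) = 0]. *)
Theorem weak_to_strong psi (P c : R) u v : l2 I01 psi -> l2 I01 u -> l2 I01 v ->
  testfun c u v ->
  (forall tc tu tv, l2 I01 tu -> l2 I01 tv -> testfun tc tu tv ->
     \int[mu]_(x in I01) (psi x * tu x) + \int[mu]_(x in I01) (v x * tv x) = P * tc) ->
  exists p q w, [/\ flux tau p q w u, ae_eq mu I01 p psi, p 1 = P & w 1 = c].
Proof.
move=> hpsi hu hv huv weak.
have [F [FAC dF FE]] := tail_antiderivative ler01 (l2_intg hu).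
pose w x := 1 * F x + (c - F 1).
have cst_AC (a k : R) : AC a 1 (fun=> k).
  by move=> e e0; exists 1 => // n l r _ _ _; rewrite big1// => i _; rewrite subrr normr0.
have wAC : AC 0 1 w by apply: AC_lin.
have dw : {ae mu, forall x, I01 x -> is_derive x (1 : R) w (u x)}.
  move: dF; apply: ae1 => x h Ix.
  have := is_derive_lin 1 (h Ix) (is_derive_cst (c - F 1) x (1 : R)).
  by rewrite mul1r addr0.
have w1 : w 1 = c by rewrite /w; ring.
have wE x : I01 x -> c - tail u x = w x.
  by rewrite /I01 /= in_itv/= => /andP[x0 x1]; rewrite FE ?(ltW x0) ?(ltW x1)// /w; ring.
have mw : measurable_fun I01 w by exact: AC_measurable wAC.
have [M hM] := AC_bounded wAC ler01.
have hMI x : I01 x -> `|w x| <= M.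
  by rewrite /I01 /= in_itv/= => /andP[x0 x1]; rewrite hM// !ltW.
pose q x := w x * (tau x)^-1.
have sqt x : I01 x -> Num.sqrt (tau x) != 0.
  by move=> /tau_gt0_01 t0; rewrite sqrtr_eq0 -ltNge.
have sqE x : I01 x -> Num.sqrt (tau x) ^+ 2 = tau x.
  by move=> /tau_gt0_01 t0; rewrite sqr_sqrtr// ltW.
have mq : measurable_fun I01 q.
  by apply: measurable_funM mw measurable_inv_tau.
have vE : ae_eq mu I01 v (fun x => Num.sqrt (tau x) * q x).
  move: huv; apply: ae1 => x h Ix; have h1 := h Ix; rewrite wE// in h1.
  rewrite /q -h1; move: (sqt x Ix) (sqE x Ix); move: (Num.sqrt (tau x)) => s s0 <-.
  by field.
have henergy : l2 I01 (fun x => Num.sqrt (tau x) * q x).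
  apply: (l2_ae mI _ vE hv); apply: measurable_funM mq.
  exact: measurable_sqrt (measurable_tau htau).
have iq a : 0 < a -> a < 1 -> intg `]a, 1[ q.
  move=> a0 a1; apply: (intg_bounded (M:=M)) (intg_inv_tau_away0 a0 a1).
  - exact: measurable_itv.
  - exact: measurable_funS mI (sub_I01 a0) mw.
  - by move=> x xa; apply: hMI; exact: sub_I01 xa.
pose p x := P - tail q x.
have pAC a : 0 < a -> a < 1 -> AC a 1 p.
  move=> a0 a1; have [Q [QAC _ QE]] := tail_antiderivative (ltW a1) (iq a a0 a1).
  apply: AC_eq (AC_lin 1 QAC (cst_AC a (P - Q 1))) => x xa.
  by rewrite /p QE//; ring.
have dp : {ae mu, forall x, I01 x -> is_derive x (1 : R) p (q x)}.
  apply: ae_itv_exhaust => a a0 a1.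
  have [Q [_ dQ QE]] := tail_antiderivative (ltW a1) (iq a a0 a1).
  move: dQ; apply: ae1 => x h xa.
  have {}h := is_derive_lin 1 (h xa) (is_derive_cst (P - Q 1) x (1 : R)).
  rewrite mul1r addr0 in h.
  move: xa; rewrite /= in_itv/= => xa.
  apply: is_derive_eq_on xa h => y /andP[ay y1].
  by rewrite /p QE ?(ltW ay) ?(ltW y1)// /cst/=; ring.
have mp : measurable_fun I01 p by apply: measurable_open_AC => a a0 a1; exact: pAC.
have p1 : p 1 = P.
  have h0 : 0 < 2^-1 :> R by rewrite invr_gt0.
  have h1 : 2^-1 < 1 :> R by rewrite invf_lt1// ltr1n.
  have [Q [_ _ QE]] := tail_antiderivative (ltW h1) (iq _ h0 h1).
  by rewrite /p QE ?(ltW h1) ?lexx// subrr subr0.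
have ppsi : ae_eq mu I01 p psi.
  apply: ae_itv_exhaust => a a0 a1.
  have ma : measurable (`]a, 1[%classic : set R) by exact: measurable_itv.
  have a01 : (a <= 1)%R by exact: ltW.
  have [Mp hMp] := AC_bounded (pAC a a0 a1) a01.
  have mpa : measurable_fun `]a, 1[ p by exact: measurable_funS mI (sub_I01 a0) mp.
  (* the test function is the antiderivative [chi] of [(psi - p) 1_(a, 1)] that
     vanishes at [a], so that [chi / sqrt tau] is bounded *)
  pose ind := \1_(`]a, 1[%classic : set R) : R -> R.
  have indE x : (`]a, 1[%classic : set R) x -> ind x = 1.
    by move=> xa; rewrite /ind indicE mem_set.
  have ind0 x : x <= a -> ind x = 0.
    by move=> xa; rewrite /ind indicE memNset//= in_itv/= ltNge xa.
  pose tu x := ind x * (psi x - p x).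
  have mtu : measurable_fun I01 tu.
    apply: measurable_funM; first exact: measurable_indic.
    exact: measurable_funB hpsi.1 mp.
  have htu : l2 I01 tu.
    have hb : l2 I01 (fun x => ind x * p x).
      split; first by apply: measurable_funM => //; exact: measurable_indic.
      apply: (intg_le mI _ (intg_cst 0 1 (Mp ^+ 2))).
        by apply: measurable_funX; apply: measurable_funM => //; exact: measurable_indic.
      move=> x Ix; have [xa|ax] := leP x a.
        by rewrite ind0// mul0r expr0n normr0 sqr_ge0.
      have xa : (`]a, 1[%classic : set R) x.
        by move: Ix; rewrite /I01 /= !in_itv/= ax => /andP[].
      rewrite indE// mul1r ger0_norm ?sqr_ge0//.
      move: xa; rewrite /= in_itv/= => /andP[_ x1].
      have := hMp x; rewrite (ltW ax) (ltW x1) => /(_ isT) h.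
      rewrite -(real_normK (num_real (p x))) lerXn2r ?nnegrE//.
      exact: le_trans h.
    have hc : l2 I01 (fun x => ind x * psi x).
      split; first by apply: measurable_funM; [exact: measurable_indic|exact: hpsi.1].
      apply: (intg_le mI _ hpsi.2).
        by apply: measurable_funX; apply: measurable_funM; [exact: measurable_indic|exact: hpsi.1].
      move=> x _; rewrite ger0_norm ?sqr_ge0// exprMn /ind indicE.
      by case: (_ \in _); rewrite ?expr1n ?mul1r// expr0n mul0r sqr_ge0.
    have := l2_lin mI (-1) hb hc; congr (l2 _ _); apply/funext => x.
    by rewrite /tu; ring.
  have itu := l2_intg htu.
  have [X [XAC dX XE]] := tail_antiderivative ler01 itu.
  pose chi x := 1 * X x + (- X 0).
  have chiAC : AC 0 1 chi by exact: AC_lin.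
  have chi_a : chi a = 0.
    have h0 : tail tu 0 = tail tu a.
      apply: tail_support itu _ => // [|x _ xa]; first exact: ltW.
      by rewrite /tu ind0 ?mul0r// ltW.
    by move: h0; rewrite !XE ?lexx ?ler01 ?(ltW a0) ?(ltW a1)// /chi; lra.
  have chi0 x : 0 < x -> x <= a -> chi x = 0.
    move=> x0 xa; have : tail tu x = tail tu a.
      apply: tail_support itu _ => // [|y _ ya]; first exact: ltW.
      by rewrite /tu ind0 ?mul0r// ltW.
    by move: chi_a; rewrite !XE ?(ltW a0) ?(ltW a1) ?(ltW x0) ?(le_trans xa (ltW a1))// /chi; lra.
  have [Mc hMc] := AC_bounded chiAC ler01.
  pose tv x := chi x * (Num.sqrt (tau x))^-1.
  have mchi : measurable_fun I01 chi by exact: AC_measurable chiAC.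
  have [m m0 hm] := tau_away0 a0 a1.
  have htv : l2 I01 tv.
    have mtv : measurable_fun I01 tv.
      by apply: measurable_funM => //; exact: measurable_inv_sqrt_tau.
    split=> //; apply: (intg_le mI _ (intg_cst 0 1 (Mc ^+ 2 / m))).
      exact: measurable_funX.
    move=> x Ix; rewrite ger0_norm ?sqr_ge0// /tv.
    move: (Ix); rewrite /I01 /= in_itv/= => /andP[x0 x1].
    have [xa|ax] := leP x a.
      by rewrite chi0// mul0r expr0n divr_ge0 ?sqr_ge0 ?ltW.
    rewrite exprMn exprVn sqE//; apply: ler_pM; rewrite ?sqr_ge0//.
    - by rewrite invr_ge0 ltW// tau_gt0_01.
    - have := hMc x; rewrite (ltW x0) (ltW x1) => /(_ isT) h.
      by rewrite -(real_normK (num_real (chi x))) lerXn2r ?nnegrE// (le_trans _ h).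
    - by rewrite lef_pV2 ?posrE ?tau_gt0_01// hm// !ltW.
  have tt : testfun (X 1 - X 0) tu tv.
    apply: aeW => x Ix; rewrite /tv mulrCA mulfV ?mulr1 ?sqt//.
    move: Ix; rewrite /I01 /= in_itv/= => /andP[x0 x1].
    by rewrite XE ?(ltW x0) ?(ltW x1)// /chi; ring.
  have := weak _ _ _ htu htv tt.
  have i1 := l2_mul mI hpsi htu; have i2 := l2_mul mI hv htv.
  have support f : intg I01 f -> (forall x, 0 < x -> x < a -> f x = 0) ->
      \int[mu]_(x in I01) f x = \int[mu]_(x in `]a, 1[) f x.
    by move=> fi f0; apply: (tail_support _ _ a1 fi f0) => //; exact: ltW.
  rewrite (support _ i1) => [|x _ xa]; last by rewrite /tu ind0 ?mul0r ?mulr0// ltW.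
  rewrite (support _ i2) => [|x x0 xa]; last by rewrite /tv chi0 ?mul0r ?mulr0// ltW.
  have sub := sub_I01 a0.
  have j1 := intgS mI ma sub i1; have j2 := intgS mI ma sub i2.
  have j3 : intg `]a, 1[ (fun x => p x * tu x).
    apply: (intg_bounded ma mpa _ (intgS mI ma sub itu)) => x xa.
    by apply: hMp; move: xa; rewrite /= in_itv/= => /andP[? ?]; rewrite !ltW.
  have j4 : intg `]a, 1[ (fun x => chi x * q x).
    apply: (intg_bounded ma (measurable_funS mI sub mchi) _ (iq a a0 a1)) => x xa.
    apply: hMc; move: xa; rewrite /= in_itv/= => /andP[ax x1].
    by rewrite (ltW x1) ltW// (lt_trans a0).
  have parts : p 1 * chi 1 - p a * chi a =
      \int[mu]_(x in `]a, 1[) (p x * tu x + chi x * q x).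
    apply: (@AC_FTC _ a 1 (fun x => p x * chi x)) (intgD ma j3 j4) => //.
      by apply: AC_mul => //; [exact: pAC|apply: AC_sub chiAC => //; exact: ltW].
    move: dX dp; apply: ae2 => x h h' xa; have Ix := sub _ xa.
    have := is_derive_lin 1 (h Ix) (is_derive_cst (- X 0) x (1 : R)).
    by rewrite mul1r addr0 => k; exact: is_derive_mul (h' Ix) k.
  move: parts; rewrite chi_a mulr0 subr0 (intD ma j3 j4) p1.
  have -> : chi 1 = X 1 - X 0 by rewrite /chi; ring.
  have -> : \int[mu]_(x in `]a, 1[) (v x * tv x) = \int[mu]_(x in `]a, 1[) (chi x * q x).
    apply: int_ae_eq => //; move: vE; apply: ae1 => x h xa; have Ix := sub _ xa.
    by rewrite h// /tv; move: (sqt x Ix) => s0; field.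
  move=> -> eqI.
  have i0 : \int[mu]_(x in `]a, 1[) (psi x * tu x - p x * tu x) = 0.
    by rewrite (intB ma j1 j3); move: eqI; lra.
  have sqe x : (`]a, 1[%classic : set R) x ->
      psi x * tu x - p x * tu x = (psi x - p x) ^+ 2.
    by move=> xa; rewrite /tu indE//; ring.
  have := int0_ae ma (intgB ma j1 j3) _ i0.
  have pos x : (`]a, 1[%classic : set R) x -> 0 <= psi x * tu x - p x * tu x.
    by move=> xa; rewrite sqe// sqr_ge0.
  move=> /(_ pos); apply: ae1 => x h xa; have := h xa; rewrite sqe//.
  by move/eqP; rewrite sqrf_eq0 subr_eq0 => /eqP.
exists p, q, w; split=> //; split=> //.
- apply: (l2_ae mI mp _ hpsi); move: ppsi; apply: ae1 => x h Ix; exact/esym/h.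
- apply: aeW => x Ix; rewrite /q mulrCA mulfV ?mulr1//.
  exact/lt0r_neq0/tau_gt0_01.
- move=> m1 e e0.
  have iqI : intg I01 q.
    exact: (intg_bounded mI mw hMI (intg_inv_tau htau m1)).
  have [Q [QAC _ QE]] := tail_antiderivative ler01 iqI.
  have hs : l2 I01 (fun x => (Num.sqrt (tau x))^-1).
    split; first exact: measurable_inv_sqrt_tau.
    apply: (intg_ae mI _ _ (intg_inv_tau htau m1)).
      by apply: measurable_funX; exact: measurable_inv_sqrt_tau.
    by apply: aeW => x Ix; rewrite exprVn sqE.
  (* [chi = 1] is admissible because [1 / tau] is integrable *)
  have t1 : testfun 1 (fun=> 0) (fun x => (Num.sqrt (tau x))^-1).
    apply: aeW => x Ix; rewrite mulfV ?sqt// /tail.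
    move: Ix; rewrite /I01 /= in_itv/= => /andP[x0 x1].
    by rewrite int_cst ?(ltW x1)// mulr0 subr0.
  have := weak _ _ _ (l2_0 mI) hs t1.
  have -> : \int[mu]_(x in I01) (psi x * 0) = 0.
    rewrite (@eq_int _ _ _ (fun=> 0)) => [|x _]; last by rewrite mulr0.
    by rewrite /I01 int_cst ?mulr0.
  have -> : \int[mu]_(x in I01) (v x * (Num.sqrt (tau x))^-1) = tail q 0.
    apply: (int_ae_eq mI (l2_mul mI hv hs) iqI).
    move: vE; apply: ae1 => x h Ix; rewrite h// mulrAC mulfV ?mul1r ?sqt//.
  rewrite add0r mulr1 QE ?lexx ?ler01// => PE.
  have [d d0 hd] := AC_modulus QAC e0.
  exists (Num.min d 1); first by rewrite lt_min d0 ltr01.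
  move=> x x0; rewrite lt_min => /andP[xd x1].
  rewrite /p QE ?(ltW x0) ?(ltW x1)// -PE.
  have -> : Q 1 - Q 0 - (Q 1 - Q x) = Q x - Q 0 by ring.
  by apply: hd; rewrite ?lexx ?ler01 ?(ltW x0) ?(ltW x1)// subr0 gtr0_norm.
Qed.

End weak_solutions.

(** * The generator on pairs of real functions *)

Section boundary_variable.
Context {R : realType}.
Local Notation mu := (@lebesgue_measure R).
Local Notation mT := (@measurableT _ R).
Variables (alpha wp : R).
Hypotheses (alpha01 : 0 < alpha < 1) (wp_ge0 : 0 <= wp).
Implicit Types (th f : R -> R) (c : R).

Definition memory th c xi : R := - (xi ^+ 2 + wp) * th xi + eta alpha xi * c.

(** The conditions that the domain puts on one real component [th] of the second
    variable when [psi(1) = c], together with the value [f] of the operator. *)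
Definition boundary th c f :=
  [/\ l2 setT (memory th c), l2 setT (fun xi => `|xi| * th xi) &
      ae_eq mu setT f (memory th c)].

Lemma measurable_memory th c : measurable_fun setT th ->
  measurable_fun setT (memory th c).
Proof.
move=> mth; apply: measurable_funD.
  apply: measurable_funM => //; apply: measurableT_comp => //.
  by apply: measurable_funD => //; exact: measurable_funX.
by apply: measurable_funM => //; exact: measurable_eta.
Qed.

(** [eta] itself is not square integrable, but [eta^2 / (1 + xi^2)] and
    [(1 + xi^2) theta^2] are integrable. *)
Lemma intg_eta_mul th : l2 setT th -> l2 setT (fun xi => `|xi| * th xi) ->
  intg setT (fun xi => eta alpha xi * th xi).
Proof.
move=> [mth h1] [_ h2].
apply: (intg_le mT _ (intgD mT (intg_eta alpha01) (intgD mT h1 h2))).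
  by apply: measurable_funM => //; exact: measurable_eta.
move=> xi _; rewrite normrM (ger0_norm (eta_ge0 _ _)) exprMn real_normK ?num_real//.
rewrite -(real_normK (num_real (th xi))).
have x2 : 0 < 1 + xi ^+ 2 by have := sqr_ge0 xi; lra.
have := eta_ge0 alpha xi; have := normr_ge0 (th xi).
move: `|th xi| (eta alpha xi) (xi ^+ 2) x2 => t e s x2 t0 e0.
have -> : e ^+ 2 / (1 + s) + (t ^+ 2 + s * t ^+ 2) =
    (1 + s) * ((e / (1 + s)) ^+ 2 + t ^+ 2) by field; exact: lt0r_neq0.
have -> : e * t = (1 + s) * (e / (1 + s) * t) by field; exact: lt0r_neq0.
rewrite ler_pM2l//; move: (e / (1 + s)) => a.
by have := sqr_ge0 (a - t); have := sqr_ge0 a; have := sqr_ge0 t; nra.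
Qed.

Lemma boundary_lin a th c f th' c' f' : boundary th c f -> boundary th' c' f' ->
  boundary (fun x => a * th x + th' x) (a * c + c') (fun x => a * f x + f' x).
Proof.
move=> [a1 a2 a3] [b1 b2 b3]; split.
- have := l2_lin mT a a1 b1; congr (l2 _ _); apply/funext => x.
  by rewrite /memory; ring.
- by have := l2_lin mT a a2 b2; congr (l2 _ _); apply/funext => x; ring.
- move: a3 b3; apply: ae2 => x h h' Ix; rewrite h// h'// /memory; ring.
Qed.

Lemma boundary_ext th c f th' f' : measurable_fun setT th' ->
  ae_eq mu setT th th' -> ae_eq mu setT f f' ->
  boundary th c f -> boundary th' c f'.
Proof.
move=> mth' tt ff [a1 a2 a3].
have E : ae_eq mu setT (memory th c) (memory th' c).
  by move: tt; apply: ae1 => x h Ix; rewrite /memory h.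
split.
- exact: (l2_ae mT (measurable_memory c mth') E a1).
- apply: (l2_ae mT _ _ a2).
    by apply: measurable_funM => //; exact: normr_measurable.
  by move: tt; apply: ae1 => x h Ix; rewrite h.
- exact: ae_eq_trans (ae_eq_sym ff) (ae_eq_trans a3 E).
Qed.

(** The term [- (xi^2 + wp) theta^2] is dropped. *)
Lemma boundary_dissipative th c f : l2 setT th -> l2 setT f -> boundary th c f ->
  \int[mu]_(x in setT) (th x * f x) <= c * \int[mu]_(x in setT) (eta alpha x * th x).
Proof.
move=> hth hf [a1 a2 a3].
have i1 := intg_eta_mul hth a2; have i2 := l2_mul mT hth a1.
rewrite -(intZ mT _ i1).
have -> : \int[mu]_(x in setT) (th x * f x) = \int[mu]_(x in setT) (th x * memory th c x).
  apply: (int_ae_eq mT (l2_mul mT hth hf) i2).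
  by move: a3; apply: ae1 => x h Tx; rewrite h.
apply: (int_le mT i2 (intgZ mT c i1)) => x _; rewrite /memory.
have : 0 <= (x ^+ 2 + wp) * (th x) ^+ 2 by rewrite mulr_ge0 ?sqr_ge0 ?addr_ge0 ?sqr_ge0.
move: (eta alpha x) (th x) (x ^+ 2 + wp) => e t s; lra.
Qed.

Lemma boundary_fun th c f : ae_eq mu setT th (fun=> 0) -> c = 0 -> boundary th c f ->
  ae_eq mu setT f (fun=> 0).
Proof.
move=> t0 -> [_ _]; move: t0; apply: ae2 => x h h' Tx.
by rewrite h'// /memory h// !mulr0 addr0.
Qed.

End boundary_variable.

Section generator.
Context {R : realType}.
Local Notation mu := (@lebesgue_measure R).
Variables (rho alpha wp : R) (tau : R -> R).
Hypotheses (rho_gt0 : 0 < rho) (alpha01 : 0 < alpha < 1) (wp_ge0 : 0 <= wp)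
  (htau : admissible_tau tau).
Local Notation mI := (measurable_itv `]0 : R, 1[).
Local Notation mT := (@measurableT _ R).
Local Notation zeta := (zeta rho alpha).

Lemma zeta_gt0 : 0 < zeta.
Proof.
have /andP[a0 a1] := alpha01.
rewrite /Defs.zeta mulr_gt0// ?divr_gt0 ?pi_gt0// sin_gt0_pi//.
by rewrite mulr_gt0 ?pi_gt0//= gtr_pMl ?pi_gt0.
Qed.

(** Real and imaginary parts of the two components of a state. *)
Local Notation realified := ((l2t mI * l2t mI) * (l2t mT * l2t mT))%type.

Definition realified_hilbert : hilbert realified :=
  prod_hilbert (prod_hilbert (l2_hilbert mI) (l2_hilbert mI))
    (scale_hilbert zeta_gt0 (prod_hilbert (l2_hilbert mT) (l2_hilbert mT))).

Local Notation hs := realified_hilbert.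
Local Notation N := (nrm hs).

Definition ae_same (u v : realified) :=
  [/\ ae_eq mu I01 (val u.1.1) (val v.1.1), ae_eq mu I01 (val u.1.2) (val v.1.2),
      ae_eq mu setT (val u.2.1) (val v.2.1) & ae_eq mu setT (val u.2.2) (val v.2.2)].

Lemma nrm_prod0 (Ha Hb : lmodType R) (ha : hilbert Ha) (hb : hilbert Hb) x :
  nrm (prod_hilbert ha hb) x = 0 <-> nrm ha x.1 = 0 /\ nrm hb x.2 = 0.
Proof.
split=> [x0|[x0 y0]].
  split; apply/eqP; rewrite eq_le nrm_ge0 andbT -x0; [exact: nrm_fst|exact: nrm_snd].
apply/eqP; rewrite -sqrf_eq0 nrm_sq /= /prod_ip -!nrm_sq x0 y0 expr0n addr0//.
Qed.

Lemma nrm_scale0 (H : lmodType R) (h : hilbert H) c (c0 : 0 < c) x :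
  nrm (scale_hilbert c0 h) x = 0 <-> nrm h x = 0.
Proof.
have E : nrm (scale_hilbert c0 h) x ^+ 2 = c * nrm h x ^+ 2 by rewrite !nrm_sq.
split=> x0; apply/eqP; rewrite -sqrf_eq0.
  by move/eqP: E; rewrite x0 expr0n/= eq_sym mulf_eq0 (gt_eqF c0).
by rewrite E x0 expr0n mulr0.
Qed.

Lemma nrmB_same u v : N (u - v) = 0 <-> ae_same u v.
Proof.
have sub D (mD : measurable D) (f g : l2t mD) :
    nrm (l2_hilbert mD) (f - g) = 0 <-> ae_eq mu D (val f) (val g).
  rewrite l2_nrm0; split; apply: filterS => x h Dx.
    by apply/eqP; rewrite -subr_eq0; apply/eqP/(h Dx).
  by have -> : val (f - g) x = val f x - val g x by []; rewrite h// subrr.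
have [P1 P2] := nrm_prod0 (prod_hilbert (l2_hilbert mI) (l2_hilbert mI))
  (scale_hilbert zeta_gt0 (prod_hilbert (l2_hilbert mT) (l2_hilbert mT))) (u - v).
have [I1 I2] := nrm_prod0 (l2_hilbert mI) (l2_hilbert mI) (u - v).1.
have [T1 T2] := nrm_prod0 (l2_hilbert mT) (l2_hilbert mT) (u - v).2.
have [S1 S2] := nrm_scale0 (prod_hilbert (l2_hilbert mT) (l2_hilbert mT)) zeta_gt0 (u - v).2.
split=> [e|[e1 e2 e3 e4]].
  have [/I1[h1 h2] /S1/T1[h3 h4]] := P1 e.
  split.
  - exact: (proj1 (sub _ mI u.1.1 v.1.1) h1).
  - exact: (proj1 (sub _ mI u.1.2 v.1.2) h2).
  - exact: (proj1 (sub _ mT u.2.1 v.2.1) h3).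
  - exact: (proj1 (sub _ mT u.2.2 v.2.2) h4).
have g1 := proj2 (sub _ mI u.1.1 v.1.1) e1.
have g2 := proj2 (sub _ mI u.1.2 v.1.2) e2.
have g3 := proj2 (sub _ mT u.2.1 v.2.1) e3.
have g4 := proj2 (sub _ mT u.2.2 v.2.2) e4.
exact: (P2 (conj (I2 (conj g1 g2)) (S2 (T2 (conj g3 g4))))).
Qed.

Lemma val_lin D (mD : measurable D) c (x y : l2t mD) :
  val (c *: x + y) = (fun t : R => c * val x t + val y t).
Proof. by []. Qed.

Definition generator (u v : realified) :=
  exists p1 q1 w1 d1 p2 q2 w2 d2,
  [/\ flux tau p1 q1 w1 d1, flux tau p2 q2 w2 d2,
      ae_eq mu I01 p1 (val u.1.1) & ae_eq mu I01 p2 (val u.1.2)] /\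
  [/\ w1 1 = - zeta * \int[mu]_(x in setT) (eta alpha x * val u.2.2 x),
      w2 1 = zeta * \int[mu]_(x in setT) (eta alpha x * val u.2.1 x),
      boundary alpha wp (val u.2.1) (p1 1) (val v.2.1) &
      boundary alpha wp (val u.2.2) (p2 1) (val v.2.2)] /\
  ae_eq mu I01 (val v.1.1) (fun x => - d2 x) /\ ae_eq mu I01 (val v.1.2) d1.

Lemma generator_lin c x y x' y' : generator x y -> generator x' y' ->
  generator (c *: x + x') (c *: y + y').
Proof.
move=> [p1[q1[w1[d1[p2[q2[w2[d2[[F1 F2 E1 E2][[B1 B2 B3 B4][V1 V2]]]]]]]]]]].
move=> [p1'[q1'[w1'[d1'[p2'[q2'[w2'[d2'[[F1' F2' E1' E2'][[B1' B2' B3' B4'][V1' V2']]]]]]]]]]].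
have lin D f f' g g' : ae_eq mu D f g -> ae_eq mu D f' g' ->
    ae_eq mu D (fun x => c * f x + f' x) (fun x => c * g x + g' x).
  by apply: filterS2 => z h h' Dz; rewrite h// h'.
have it (th th' : l2t mT) c1 f1 c1' f1' : boundary alpha wp (val th) c1 f1 ->
    boundary alpha wp (val th') c1' f1' ->
    \int[mu]_(x in setT) (eta alpha x * (c * val th x + val th' x)) =
    c * \int[mu]_(x in setT) (eta alpha x * val th x) +
    \int[mu]_(x in setT) (eta alpha x * val th' x).
  move=> [_ h1 _] [_ h2 _]; have i1 := intg_eta_mul alpha01 (l2tP th) h1.
  have i2 := intg_eta_mul alpha01 (l2tP th') h2.
  rewrite -(intZ mT _ i1) -(intD mT (intgZ mT c i1) i2).
  by apply: eq_int => z _; ring.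
exists (fun x => c * p1 x + p1' x), (fun x => c * q1 x + q1' x),
  (fun x => c * w1 x + w1' x), (fun x => c * d1 x + d1' x),
  (fun x => c * p2 x + p2' x), (fun x => c * q2 x + q2' x),
  (fun x => c * w2 x + w2' x), (fun x => c * d2 x + d2' x).
split; [split|split; [split|split]].
- exact: flux_lin.
- exact: flux_lin.
- have := lin _ _ _ _ _ E1 E1'; rewrite -val_lin; exact.
- have := lin _ _ _ _ _ E2 E2'; rewrite -val_lin; exact.
- rewrite B1 B1' (it _ _ _ _ _ _ B4 B4'); ring.
- rewrite B2 B2' (it _ _ _ _ _ _ B3 B3'); ring.
- have := boundary_lin c B3 B3'; rewrite -!val_lin; exact.
- have := boundary_lin c B4 B4'; rewrite -!val_lin; exact.
- have := lin _ _ _ _ _ V1 V1'; rewrite -val_lin.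
  by apply: ae1 => z h Dz; apply: (etrans (h Dz)); ring.
- have := lin _ _ _ _ _ V2 V2'; rewrite -val_lin; exact.
Qed.

Lemma generator_ext x y x' y' : N (x - x') = 0 -> N (y - y') = 0 ->
  generator x y -> generator x' y'.
Proof.
move=> /nrmB_same[X1 X2 X3 X4] /nrmB_same[Y1 Y2 Y3 Y4].
move=> [p1[q1[w1[d1[p2[q2[w2[d2[[F1 F2 E1 E2][[B1 B2 B3 B4][V1 V2]]]]]]]]]]].
have mval (f : l2t mT) : measurable_fun setT (val f) by have [] := l2tP f.
have B3' := boundary_ext (mval x'.2.1) X3 Y3 B3.
have B4' := boundary_ext (mval x'.2.2) X4 Y4 B4.
have it (th th' : l2t mT) c1 f1 c1' f1' : boundary alpha wp (val th) c1 f1 ->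
    boundary alpha wp (val th') c1' f1' -> ae_eq mu setT (val th) (val th') ->
    \int[mu]_(x in setT) (eta alpha x * val th x) =
    \int[mu]_(x in setT) (eta alpha x * val th' x).
  move=> [_ h1 _] [_ h2 _] E; have i1 := intg_eta_mul alpha01 (l2tP th) h1.
  have i2 := intg_eta_mul alpha01 (l2tP th') h2.
  by apply: int_ae_eq => //; move: E; apply: ae1 => z h Tz; rewrite h.
exists p1, q1, w1, d1, p2, q2, w2, d2; split; [split=> //|split; [split=> //|]].
- exact: ae_eq_trans X1.
- exact: ae_eq_trans X2.
- by rewrite B1 (it _ _ _ _ _ _ B4 B4').
- by rewrite B2 (it _ _ _ _ _ _ B3 B3').
- split; first exact: ae_eq_trans (ae_eq_sym Y1) V1.
  exact: ae_eq_trans (ae_eq_sym Y2) V2.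
Qed.

(** The boundary term of Green's identity cancels against the coupling term of
    the second component; what is left is [- (xi^2 + wp) |theta|^2]. *)
Lemma generator_dissipative u v : generator u v -> ip hs u v <= 0.
Proof.
move=> [p1[q1[w1[d1[p2[q2[w2[d2[[F1 F2 E1 E2][[B1 B2 B3 B4][V1 V2]]]]]]]]]]].
have mval (f : l2t mI) : l2 I01 (val f) := l2tP f.
have gr := green htau F1 F2.
have k1 := l2_mul mI (mval u.1.1) (mval v.1.1).
have k2 := l2_mul mI (mval u.1.2) (mval v.1.2).
have i1 := l2_mul mI (flux_l2dw F1) (flux_l2 F2).
have i2 := l2_mul mI (flux_l2dw F2) (flux_l2 F1).
have E : \int[mu]_(x in I01) (val u.1.1 x * val v.1.1 x) +
    \int[mu]_(x in I01) (val u.1.2 x * val v.1.2 x) =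
    w1 1 * p2 1 - w2 1 * p1 1.
  rewrite -gr -(intD mI k1 k2).
  apply: (int_ae_eq mI (intgD mI k1 k2) (intgB mI i1 i2)).
  have H1 : ae_eq mu I01 (fun x => val u.1.1 x * val v.1.1 x) (fun x => - (d2 x * p1 x)).
    by move: E1 V1; apply: ae2 => x h h' Ix; rewrite -h// h'//; ring.
  have H2 : ae_eq mu I01 (fun x => val u.1.2 x * val v.1.2 x) (fun x => d1 x * p2 x).
    by move: E2 V2; apply: ae2 => x h h' Ix; rewrite -h// h'//; ring.
  by move: H1 H2; apply: ae2 => x h h' Ix; rewrite h// h'//; ring.
have D1 := boundary_dissipative alpha01 wp_ge0 (l2tP u.2.1) (l2tP v.2.1) B3.
have D2 := boundary_dissipative alpha01 wp_ge0 (l2tP u.2.2) (l2tP v.2.2) B4.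
rewrite B1 B2 in E.
rewrite /hs /= /prod_ip /= /scale_ip /= /prod_ip /= /l2_ip E.
have z0 := zeta_gt0.
have D3 := ler_wpM2l (ltW z0) (lerD D1 D2).
have alg (z A1 A2 I1 I2 c1 c2 : R) : z * (A1 + A2) <= z * (c1 * I1 + c2 * I2) ->
  - z * I2 * c2 - z * I1 * c1 + z * (A1 + A2) <= 0 by lra.
exact: alg D3.
Qed.

(** If [psi] vanishes almost everywhere then so do [psi_x] and the flux, and
    [psi(1) = 0]: the operator is well defined on classes of functions. *)
Lemma generator_fun u v : generator u v -> N u = 0 -> N v = 0.
Proof.
move=> [p1[q1[w1[d1[p2[q2[w2[d2[[F1 F2 E1 E2][[B1 B2 B3 B4][V1 V2]]]]]]]]]]].
move=> u0; have /nrmB_same[U1 U2 U3 U4] : N (u - 0) = 0 by rewrite subr0.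
rewrite -[v]subr0; apply/nrmB_same.
have fl p q w dw (f : R -> R) : flux tau p q w dw -> ae_eq mu I01 p f ->
    ae_eq mu I01 f (fun=> 0) -> p 1 = 0 /\ ae_eq mu I01 dw (fun=> 0).
  move=> F pf f0; have p0 := ae_eq_trans pf f0.
  have pa a : 0 < a -> ae_eq mu (`]a, 1[%classic : set R) p (fun=> 0).
    by move=> a0; move: p0; apply: ae1 => x h xa; apply: h; exact: sub_I01 xa.
  have q0 : ae_eq mu I01 q (fun=> 0).
    apply: ae_itv_exhaust => a a0 a1; apply: (AC_ae0_derivative (flux_AC F a0 a1) (pa a a0)).
    by have := flux_der F; apply: ae1 => x h xa; apply: h; exact: sub_I01 xa.
  split.
    have h0 : 0 < 2^-1 :> R by rewrite invr_gt0.
    have h1 : 2^-1 < 1 :> R by rewrite invf_lt1// ltr1n.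
    by apply: (AC_ae0 (flux_AC F h0 h1) (pa _ h0)) => //; rewrite (ltW h1) lexx.
  apply: (AC_ae0_derivative (flux_ACw F) _ (flux_derw F)).
  by have := flux_eq F; move: q0; apply: ae2 => x h h' Ix; rewrite h'// h// mulr0.
have [P1 D1] := fl _ _ _ _ _ F1 E1 U1; have [P2 D2] := fl _ _ _ _ _ F2 E2 U2.
split.
- by move: D2 V1; apply: ae2 => x h h' Ix; rewrite h'// h// oppr0.
- exact: ae_eq_trans V2 D1.
- exact: boundary_fun U3 P1 B3.
- exact: boundary_fun U4 P2 B4.
Qed.

End generator.

(** * The resolvent equation *)

Section memory_resolvent.
Context {R : realType}.
Local Notation mu := (@lebesgue_measure R).
Local Notation mT := (@measurableT _ R).
Variables (alpha wp h : R).
Hypotheses (alpha01 : 0 < alpha < 1) (wp_ge0 : 0 <= wp) (h_gt0 : 0 < h).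

Definition resolvent_symbol (x : R) : R := 1 + h * (x ^+ 2 + wp).
Local Notation d := resolvent_symbol.

(** [h] times this weight is the coefficient of [psi(1)] in the boundary integral
    [int eta theta] of the solution [theta] of the resolvent equation. *)
Definition resolvent_weight : R := \int[mu]_(x in setT) (eta alpha x ^+ 2 / d x).
Local Notation kappa := resolvent_weight.

Lemma symbol_ge1 x : 1 <= d x.
Proof. by rewrite lerDl mulr_ge0 ?(ltW h_gt0)// addr_ge0// sqr_ge0. Qed.

Lemma symbol_gt0 x : 0 < d x.
Proof. exact: lt_le_trans (symbol_ge1 x). Qed.

Lemma measurable_symbolV : measurable_fun setT (fun x => (d x)^-1).
Proof.
apply: measurable_inv_ge0 => [x _|]; first exact/ltW/symbol_gt0.
apply: measurable_funD => //; apply: measurable_funM => //.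
by apply: measurable_funD => //; exact: measurable_funX.
Qed.

Lemma intg_weight : intg setT (fun x => eta alpha x ^+ 2 / d x).
Proof.
apply: (intg_le mT _ (intgZ mT (1 + h^-1) (intg_eta alpha01))).
  apply: measurable_funM measurable_symbolV.
  by apply: measurable_funX; exact: measurable_eta.
move=> x _; rewrite ger0_norm ?divr_ge0 ?sqr_ge0 ?(ltW (symbol_gt0 x))//.
rewrite mulrCA ler_wpM2l ?sqr_ge0//.
have x2 : 0 < 1 + x ^+ 2 by have := sqr_ge0 x; lra.
rewrite ler_pdivlMr// mulrC ler_pdivrMr ?symbol_gt0// /resolvent_symbol.
have -> : (1 + h^-1) * (1 + h * (x ^+ 2 + wp)) =
    1 + x ^+ 2 + (h * (x ^+ 2 + wp) + h^-1 + wp) by field; exact: lt0r_neq0.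
rewrite lerDl !addr_ge0 ?invr_ge0 ?mulr_ge0 ?addr_ge0 ?sqr_ge0 ?(ltW h_gt0)//.
Qed.

Lemma weight_gt0 : 0 < kappa.
Proof.
have pos x : (setT : set R) x -> 0 <= eta alpha x ^+ 2 / d x.
  by move=> _; rewrite divr_ge0 ?sqr_ge0 ?(ltW (symbol_gt0 x)).
rewrite lt_neqAle; apply/andP; split; last by apply: Rintegral_ge0.
apply/eqP => /esym k0; have := int0_ae mT intg_weight pos k0.
move=> /(@ae_exists _ _ 0 1 ltr01)[x /andP[x0 x1]] /(_ I) /eqP.
rewrite mulf_eq0 invr_eq0 (gt_eqF (symbol_gt0 x)) orbF eta_sqE ?(gt_eqF x0)//.
by rewrite (gt_eqF (pw_gt0 _ _)).
Qed.

Lemma l2_eta_symbol : l2 setT (fun x => eta alpha x / d x).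
Proof.
have m : measurable_fun setT (fun x => eta alpha x / d x).
  by apply: measurable_funM measurable_symbolV; exact: measurable_eta.
split=> //; apply: (intg_le mT (measurable_funX _ m) intg_weight) => x _.
rewrite ger0_norm ?sqr_ge0// exprMn ler_wpM2l ?sqr_ge0// expr2.
by rewrite ger_pMl ?invr_gt0 ?symbol_gt0// invf_le1 ?symbol_gt0// symbol_ge1.
Qed.

(** The solution is [(f + h eta P) / (1 + h (xi^2 + wp))].  That [xi theta] is
    square integrable follows from [h xi^2 theta^2 <= (f + h P eta) theta], whose
    right-hand side is integrable by the explicit form of [theta]. *)
Lemma memory_resolvent f P : l2 setT f -> exists th,
  [/\ l2 setT th, l2 setT (memory alpha wp th P), l2 setT (fun x => `|x| * th x),
      forall x, th x - h * memory alpha wp th P x = f x &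
      \int[mu]_(x in setT) (eta alpha x * th x) =
      \int[mu]_(x in setT) (eta alpha x / d x * f x) + h * P * kappa].
Proof.
move=> hf; have dn x : d x != 0 by rewrite lt0r_neq0 ?symbol_gt0.
have hn : h != 0 by rewrite lt0r_neq0.
pose th x := h * P * (eta alpha x / d x) + f x / d x.
have hfd : l2 setT (fun x => f x / d x).
  have m : measurable_fun setT (fun x => f x / d x).
    exact: measurable_funM hf.1 measurable_symbolV.
  split=> //; apply: (intg_le mT (measurable_funX _ m) hf.2) => x _.
  rewrite ger0_norm ?sqr_ge0// exprMn ler_piMr ?sqr_ge0// exprVn.
  by rewrite invf_le1 ?exprn_gt0 ?symbol_gt0// expr_ge1 ?symbol_ge1 ?(ltW (symbol_gt0 x)).
have hth : l2 setT th by exact: (l2_lin mT (h * P) l2_eta_symbol hfd).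
have thE x : d x * th x = f x + h * eta alpha x * P.
  by rewrite /th; move: (dn x) => ?; field.
have mE x : memory alpha wp th P x = h^-1 * (th x - f x).
  rewrite /memory; have := thE x; rewrite /resolvent_symbol.
  move=> e; apply: (mulfI hn); rewrite mulrA mulfV// mul1r; move: e; lra.
have ief : intg setT (fun x => eta alpha x / d x * f x) := l2_mul mT l2_eta_symbol hf.
have eE x : eta alpha x * th x =
    eta alpha x / d x * f x + h * P * (eta alpha x ^+ 2 / d x).
  by rewrite /th; move: (dn x) => ?; field.
have iw := intgZ mT (h * P) intg_weight.
have iE : intg setT (fun x => eta alpha x * th x).
  by have := intgD mT ief iw; congr (intg _ _); apply/funext => x; rewrite eE.
exists th; split=> //.
- have := l2_lin mT h^-1 (l2_lin mT (-1) hf hth) (l2_0 mT).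
  by congr (l2 _ _); apply/funext => x; rewrite mE; ring.
- split; first by apply: measurable_funM hth.1; exact: normr_measurable.
  have i1 := intgZ mT h^-1 (intgD mT (l2_mul mT hf hth) (intgZ mT (h * P) iE)).
  apply: (intg_le mT _ i1).
    by apply: measurable_funX; apply: measurable_funM hth.1; exact: normr_measurable.
  move=> x _; rewrite ger0_norm ?sqr_ge0// exprMn real_normK ?num_real//.
  rewrite [leRHS]mulrC ler_pdivlMr//.
  have -> : f x * th x + h * P * (eta alpha x * th x) = d x * th x * th x.
    by rewrite thE; ring.
  rewrite /resolvent_symbol.
  have := sqr_ge0 (th x); have : 0 <= h * wp * th x ^+ 2.
    by rewrite mulr_ge0 ?sqr_ge0// mulr_ge0// ltW.
  lra.
- by move=> x; rewrite mE mulrA mulfV// mul1r; ring.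
- rewrite -(intZ mT _ intg_weight) -(intD mT ief iw).
  by apply: eq_int => x _; exact: eE.
Qed.

End memory_resolvent.

(** * The space of test functions *)

Section constraint_space.
Context {R : realType}.
Local Notation mu := (@lebesgue_measure R).
Variable tau : R -> R.
Hypothesis htau : admissible_tau tau.
Local Notation mI := (measurable_itv `]0 : R, 1[).
Local Notation LI := (l2t mI).

Lemma tail_lin c (u u' : R -> R) x : l2 I01 u -> l2 I01 u' -> 0 < x -> x < 1 ->
  tail (fun t => c * u t + u' t) x = c * tail u x + tail u' x.
Proof.
move=> hu hu' x0 x1; have mx : measurable (`]x, 1[%classic : set R) by exact: measurable_itv.
have i1 := intgS mI mx (sub_I01 x0) (l2_intg hu).
have i2 := intgS mI mx (sub_I01 x0) (l2_intg hu').
by rewrite /tail (intD mx (intgZ mx c i1) i2) (intZ mx _ i1).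
Qed.

Lemma testfun_lin a c c' (u u' v v' : R -> R) : l2 I01 u -> l2 I01 u' ->
  testfun tau c u v -> testfun tau c' u' v' ->
  testfun tau (a * c + c') (fun x => a * u x + u' x) (fun x => a * v x + v' x).
Proof.
move=> hu hu'; apply: ae2 => x h h' Ix; move: (Ix); rewrite /I01 /= in_itv/= => /andP[x0 x1].
by rewrite tail_lin// mulrDr mulrCA h// h'//; ring.
Qed.

(** It vanishes almost everywhere exactly when [testfun] holds. *)
Definition defect (c : R) (u v : R -> R) x : R :=
  Num.sqrt (tau x) * v x - (c - tail u x).

Lemma measurable_tail (u : R -> R) : l2 I01 u -> measurable_fun I01 (tail u).
Proof.
move=> /l2_intg/(tail_antiderivative ler01)[F [FAC _ FE]].
have : AC 0 1 (tail u).
  have c1 : AC 0 1 (fun=> F 1).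
    by move=> e e0; exists 1 => // n l r _ _ _; rewrite big1// => i _; rewrite subrr normr0.
  by apply: AC_eq (AC_lin (-1) FAC c1) => x x01; rewrite FE//; ring.
exact: AC_measurable.
Qed.

Lemma tail_sq_le (u : R -> R) x : l2 I01 u -> 0 < x -> x < 1 ->
  tail u x ^+ 2 <= \int[mu]_(t in I01) (u t ^+ 2).
Proof.
move=> hu x0 x1; have mx : measurable (`]x, 1[%classic : set R) by exact: measurable_itv.
have iu := intgS mI mx (sub_I01 x0) (l2_intg hu).
have iu2 := intgS mI mx (sub_I01 x0) hu.2.
set m := tail u x.
have ic := intg_cst x 1 (m ^+ 2).
(* the integral of [(u - m)^2], as in the proof of the Cauchy-Schwarz inequality *)
have : 0 <= \int[mu]_(t in `]x, 1[) ((-2 * m) * u t + u t ^+ 2 + m ^+ 2).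
  by apply: Rintegral_ge0 => t _; have := sqr_ge0 (u t - m); lra.
rewrite (intD mx (intgD mx (intgZ mx _ iu) iu2) ic) (intD mx (intgZ mx _ iu) iu2).
rewrite (intZ mx _ iu) -/(tail u x) -/m int_cst ?(ltW x1)//.
have [F [_ _ FE]] := AC_antiderivative ler01 hu.2.
have e1 : \int[mu]_(t in `]x, 1[) (u t ^+ 2) = F 1 - F x by rewrite FE// ltW.
have e2 : \int[mu]_(t in I01) (u t ^+ 2) = F 1 - F 0 by rewrite FE.
rewrite e1 e2.
have : 0 <= F x - F 0.
  by rewrite FE ?lexx ?ler01 ?(ltW x0) ?(ltW x1)//; apply: Rintegral_ge0 => t _; exact: sqr_ge0.
have : 0 <= x * m ^+ 2 by rewrite mulr_ge0 ?sqr_ge0 ?ltW.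
clearbody m; lra.
Qed.

Lemma defect_bound : exists2 K, 0 <= K & forall c u v, l2 I01 u -> l2 I01 v ->
  l2 I01 (defect c u v) /\
  \int[mu]_(x in I01) (defect c u v x ^+ 2) <= K * (c ^+ 2 +
    \int[mu]_(x in I01) (u x ^+ 2) + \int[mu]_(x in I01) (v x ^+ 2)).
Proof.
have [M hM] := tau_bounded htau.
have M0 : 0 < M.
  by have := hM 1; rewrite ler01 lexx => /(_ isT); apply: lt_le_trans; rewrite tau_gt0// ltr01 lexx.
exists (3 * (M + 1)) => [|c u v hu hv]; first by rewrite mulr_ge0// addr_ge0// ltW.
set S := \int[mu]_(x in I01) (u x ^+ 2).
have S0 : 0 <= S by apply: Rintegral_ge0 => t _; exact: sqr_ge0.
have md : measurable_fun I01 (defect c u v).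
  apply: measurable_funB.
    by apply: measurable_funM hv.1; exact: measurable_sqrt (measurable_tau htau).
  by apply: measurable_funB => //; exact: measurable_tail.
have le x : I01 x -> defect c u v x ^+ 2 <= 3 * (M + 1) * v x ^+ 2 + 3 * (c ^+ 2 + S).
  move=> Ix; move: (Ix); rewrite /I01 /= in_itv/= => /andP[x0 x1].
  have h1 : tau x <= M by apply: hM; rewrite !ltW.
  have h2 := tail_sq_le hu x0 x1.
  have h3 : (Num.sqrt (tau x) * v x) ^+ 2 <= (M + 1) * v x ^+ 2.
    rewrite exprMn sqr_sqrtr; last exact/ltW/tau_gt0_01.
    by rewrite ler_wpM2r ?sqr_ge0// (le_trans h1)// lerDl.
  rewrite /defect; move: (Num.sqrt _ * _) (tail u x) h2 h3 => a b h2 h3.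
  have := sqr_ge0 (a + c); have := sqr_ge0 (a - b); have := sqr_ge0 (c + b).
  rewrite -/S in h2; nra.
have i1 := intgZ mI (3 * (M + 1)) hv.2; have i2 := intg_cst 0 1 (3 * (c ^+ 2 + S)).
have hd : l2 I01 (defect c u v).
  split=> //; apply: (intg_le mI (measurable_funX _ md) (intgD mI i1 i2)) => x Ix.
  by rewrite ger0_norm ?sqr_ge0// le.
split=> //; apply: le_trans (int_le mI hd.2 (intgD mI i1 i2) le) _.
rewrite (intD mI i1 i2) (intZ mI _ hv.2) /I01 int_cst// -/I01 -/S.
have : 0 <= M * (c ^+ 2 + S) by rewrite mulr_ge0 ?addr_ge0 ?sqr_ge0 ?(ltW M0).
lra.
Qed.

Variables (c0 h : R).
Hypotheses (c0_gt0 : 0 < c0) (h_gt0 : 0 < h).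

(** The factors that carry [w(1)] and [w'].  The weight [h] comes from the
    resolvent equation, and [c0] from eliminating the second component. *)
Definition constraint_left : hilbert (R^o * LI)%type :=
  prod_hilbert (scale_hilbert c0_gt0 real_hilbert)
               (scale_hilbert h_gt0 (l2_hilbert mI)).

Local Notation hab := (prod_hilbert constraint_left (l2_hilbert mI)).

Definition constraint (z : (R^o * LI) * LI) : Prop :=
  testfun tau z.1.1 (val z.1.2) (val z.2).

Lemma constraint_subspace : subspace constraint.
Proof.
split.
  apply: aeW => x Ix; rewrite mulr0 /tail.
  move: Ix; rewrite /I01 /= in_itv/= => /andP[x0 x1].
  by rewrite int_cst ?ltW// mulr0 subr0.
move=> a x y Vx Vy.
have := testfun_lin a (l2tP x.1.2) (l2tP y.1.2) Vx Vy; rewrite -!val_lin; exact.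
Qed.

(** The defect is bounded in [L^2] by the norm and depends only on the difference
    to an element of the constraint space. *)
Lemma constraint_closed : closed_in hab constraint.
Proof.
move=> z y Vz zy; have [K K0 hK] := defect_bound.
pose D (x : (R^o * LI) * LI) := defect x.1.1 (val x.1.2) (val x.2).
have alg (a b c : R) : 0 <= a -> 0 <= b -> 0 <= c ->
    K * (a + b + c) <= (K * (c0^-1 + h^-1 + 1) + 1) * (c0 * a + h * b + c).
  move=> a1 b1 c1.
  have ci : 0 < c0^-1 by rewrite invr_gt0.
  have hi : 0 < h^-1 by rewrite invr_gt0.
  have ca : c0^-1 * c0 = 1 by rewrite mulVf// lt0r_neq0.
  have ha : h^-1 * h = 1 by rewrite mulVf// lt0r_neq0.
  have : a + b + c <= (c0^-1 + h^-1 + 1) * (c0 * a + h * b + c).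
    have -> : (c0^-1 + h^-1 + 1) * (c0 * a + h * b + c) =
      (c0^-1 * c0) * a + (h^-1 * h) * b + c + (c0^-1 * (h * b + c)
        + h^-1 * (c0 * a + c) + (c0 * a + h * b)) by ring.
    rewrite ca ha !mul1r lerDl.
    by rewrite !addr_ge0 ?mulr_ge0 ?addr_ge0 ?mulr_ge0 ?(ltW ci) ?(ltW hi) ?(ltW c0_gt0) ?(ltW h_gt0).
  move=> /(ler_wpM2l K0) /le_trans; apply.
  rewrite mulrA mulrDl mul1r lerDl.
  by rewrite !addr_ge0 ?mulr_ge0 ?(ltW c0_gt0) ?(ltW h_gt0).
have K1 : exists2 K1, 0 < K1 & forall x, l2 I01 (D x) /\
    \int[mu]_(t in I01) (D x t ^+ 2) <= K1 * nrm hab x ^+ 2.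
  exists (K * (c0^-1 + h^-1 + 1) + 1).
    by rewrite ltr_pwDr// mulr_ge0// !addr_ge0// invr_ge0 ltW.
  move=> x; have [l b] := hK x.1.1 _ _ (l2tP x.1.2) (l2tP x.2); split=> //.
  have N2 : nrm hab x ^+ 2 = c0 * x.1.1 ^+ 2 +
      h * \int[mu]_(t in I01) (val x.1.2 t ^+ 2) + \int[mu]_(t in I01) (val x.2 t ^+ 2).
    by rewrite nrm_sq.
  rewrite N2; apply: le_trans b _; apply: alg; first exact: sqr_ge0.
    by apply: Rintegral_ge0 => t _; exact: sqr_ge0.
  by apply: Rintegral_ge0 => t _; exact: sqr_ge0.
have {K1 hK}[K1 K10 hK] := K1.
have Dn n : \int[mu]_(t in I01) (D y t ^+ 2) <= K1 * nrm hab (z n - y) ^+ 2.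
  rewrite nrmBC; have [l b] := hK (y - z n); apply: le_trans b.
  rewrite le_eqVlt; apply/orP; left; apply/eqP.
  apply: (int_ae_eq mI (hK y).1.2 l.2).
  have := Vz n; apply: ae1 => t ht It.
  have t01 := It; rewrite /I01 /= in_itv/= in t01; have /andP[t0 t1] := t01.
  have E : D (y - z n) t = D y t.
    transitivity (Num.sqrt (tau t) * (val y.2 t - val (z n).2 t) -
      (y.1.1 - (z n).1.1 - tail (fun s => -1 * val (z n).1.2 s + val y.1.2 s) t)).
      rewrite /D /defect; congr (_ - (_ - tail _ t)).
      by apply/funext => s; rewrite mulN1r addrC.
    rewrite tail_lin//; [|exact: l2tP|exact: l2tP].
    have := ht It; rewrite /D /defect; move: (Num.sqrt (tau t)) => s e.
    by rewrite mulrBr e; ring.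
  exact: (congr1 (fun r => r ^+ 2) (esym E)).
have D0 : \int[mu]_(t in I01) (D y t ^+ 2) = 0.
  apply/eqP; rewrite eq_le; apply/andP; split; last first.
    by apply: Rintegral_ge0 => t _; exact: sqr_ge0.
  apply/ler_addgt0Pr => e e0; rewrite add0r.
  have e1 : 0 < Num.sqrt (e / K1) by rewrite sqrtr_gt0 divr_gt0.
  have [n hn] := zy _ e1.
  apply: le_trans (Dn n) _; rewrite mulrC -ler_pdivlMr//.
  rewrite -(@sqr_sqrtr _ (e / K1)) ?(ltW (divr_gt0 e0 K10))//.
  by rewrite lerXn2r ?nnegrE ?nrm_ge0 ?sqrtr_ge0// ltW// hn.
have := int0_ae mI (hK y).1.2 (fun t _ => sqr_ge0 _) D0.
apply: ae1 => t ht It; have /eqP := ht It.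
by rewrite sqrf_eq0 subr_eq0 => /eqP.
Qed.

End constraint_space.

(** * Maximality *)

Section resolvent.
Context {R : realType}.
Local Notation mu := (@lebesgue_measure R).
Variables (rho alpha wp : R) (tau : R -> R).
Hypotheses (rho_gt0 : 0 < rho) (alpha01 : 0 < alpha < 1) (wp_ge0 : 0 <= wp)
  (htau : admissible_tau tau).
Local Notation mI := (measurable_itv `]0 : R, 1[).
Local Notation mT := (@measurableT _ R).
Local Notation LI := (l2t mI).
Local Notation LT := (l2t mT).
Local Notation zeta := (zeta rho alpha).
Local Notation Gen := (generator rho alpha wp tau).
Local Notation hs := (realified_hilbert rho_gt0 alpha01).

Lemma int_lin D (mD : measurable D) c (f g k : R -> R) : l2 D f -> l2 D g -> l2 D k ->
  \int[mu]_(x in D) ((c * f x + g x) * k x) =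
  c * \int[mu]_(x in D) (f x * k x) + \int[mu]_(x in D) (g x * k x).
Proof.
move=> hf hg hk; have i1 := l2_mul mD hf hk; have i2 := l2_mul mD hg hk.
rewrite -(intZ mD c i1) -(intD mD (intgZ mD c i1) i2).
by apply: eq_int => x _; ring.
Qed.

(** The weak form of the resolvent equation, with [w(1) = ca + i cb],
    [w' = ua + i ub] and [w / sqrt tau = va + i vb].  The two equations are coupled
    only through [psi = f + i h w'] and through the boundary condition. *)
Lemma weak_system (h G1 G2 c0 : R) (f1 f2 : LI) : 0 < h -> 0 < c0 ->
  exists (ca cb : R) (ua ub va vb : LI),
  [/\ testfun tau ca (val ua) (val va), testfun tau cb (val ub) (val vb) &
   forall tc tu tv, l2 I01 tu -> l2 I01 tv -> testfun tau tc tu tv ->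
    \int[mu]_(x in I01) ((- h * val ub x + val f1 x) * tu x) +
    \int[mu]_(x in I01) (val va x * tv x) = c0 * (cb - G1) * tc /\
    \int[mu]_(x in I01) ((h * val ua x + val f2 x) * tu x) +
    \int[mu]_(x in I01) (val vb x * tv x) = - c0 * (ca + G2) * tc].
Proof.
move=> h0 c00; pose ha := constraint_left c00 h0; pose hb := l2_hilbert mI.
pose a1 : (R^o * LI)%type := (- G1, - h^-1 *: f1).
pose a2 : (R^o * LI)%type := (- G2, - h^-1 *: f2).
pose C := nrm ha a1 + nrm ha a2.
have bnd a (z : (R^o * LI) * LI) : ip ha a z.1 <= nrm ha a * nrm (prod_hilbert ha hb) z.
  by apply: le_trans (ip_le _ _ _) _; rewrite ler_wpM2l ?nrm_ge0// nrm_fst.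
have lf a : linear_form (fun z : (R^o * LI) * LI => ip ha a z.1).
  by move=> k x y; rewrite ipDr ipZr.
have b1 z : ip ha a1 z.1 <= C * nrm (prod_hilbert ha hb) z.
  by apply: le_trans (bnd a1 z) _; rewrite ler_wpM2r ?nrm_ge0// lerDl nrm_ge0.
have b2 z : ip ha a2 z.1 <= C * nrm (prod_hilbert ha hb) z.
  by apply: le_trans (bnd a2 z) _; rewrite ler_wpM2r ?nrm_ge0// lerDr nrm_ge0.
have [x [y [Vx Vy e]]] := complex_riesz (constraint_subspace tau)
  (constraint_closed htau (c0_gt0 := c00) (h_gt0 := h0)) (lf a1) (lf a2) b1 b2.
exists x.1.1, y.1.1, x.1.2, y.1.2, x.2, y.2; split=> // tc tu tv htu htv tt.
pose t : (R^o * LI) * LI := ((tc, l2_of mI tu), l2_of mI tv).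
have Vt : constraint tau t by rewrite /constraint /= !l2_ofK.
have [e1 e2] := e t Vt.
have tuK : val t.1.2 = tu := l2_ofK mI htu.
have tvK : val t.2 = tv := l2_ofK mI htv.
have hE (p : (R^o * LI)%type) :
    ip ha p t.1 = c0 * (p.1 * tc) + h * \int[mu]_(s in I01) (val p.2 s * tu s).
  by rewrite -tuK.
have bE (p : LI) : ip hb p t.2 = \int[mu]_(s in I01) (val p s * tv s).
  by rewrite -tvK.
have sE (G : R) (f : LI) : ip ha (- G, - h^-1 *: f) t.1 =
    - (c0 * G * tc) - \int[mu]_(s in I01) (val f s * tu s).
  have -> : ip ha (- G, - h^-1 *: f) t.1 =
    c0 * (- G * tc) + h * ip hb (- h^-1 *: f) t.1.2 by [].
  have -> : \int[mu]_(s in I01) (val f s * tu s) = ip hb f t.1.2 by rewrite -tuK.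
  by rewrite ipZl mulrA mulrN mulfV ?lt0r_neq0//; ring.
have s1 : ip ha a1 t.1 = _ := sE G1 f1.
have s2 : ip ha a2 t.1 = _ := sE G2 f2.
rewrite bE (hE y.1) s1 in e1; rewrite bE (hE x.1) s2 in e2.
rewrite (int_lin mI (- h) (l2tP y.1.2) (l2tP f1) htu).
rewrite (int_lin mI h (l2tP x.1.2) (l2tP f2) htu).
split; [move: e1|move: e2]; clear=> e1; lra.
Qed.

(** By [memory_resolvent] the boundary condition at 1 is an affine relation
    between [w(1)] and [psi(1)]; solved for [psi(1)] it has the slope
    [c0 = 1 / (zeta h kappa)] up to the factor [- i], and the weak form takes this
    value of [psi(1)] as its boundary datum. *)
Lemma generator_max h f : 0 < h -> exists x y, Gen x y /\ nrm hs (f - (x - h *: y)) = 0.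
Proof.
move=> h0; pose kappa := resolvent_weight alpha wp h.
have k0 : 0 < kappa := weight_gt0 alpha01 wp_ge0 h0.
have z0 : 0 < zeta := zeta_gt0 rho_gt0 alpha01.
have c00 : 0 < (zeta * h * kappa)^-1 by rewrite invr_gt0; exact: mulr_gt0 (mulr_gt0 z0 h0) k0.
pose G (g : LT) := \int[mu]_(x in setT) (eta alpha x / resolvent_symbol wp h x * val g x).
have [ca [cb [ua [ub [va [vb [Va Vb W]]]]]]] :=
  weak_system (zeta * G f.2.1) (zeta * G f.2.2) f.1.1 f.1.2 h0 c00.
have zn := lt0r_neq0 z0; have hn := lt0r_neq0 h0; have kn := lt0r_neq0 k0.
have [p1 [q1 [w1 [F1 E1 P1 W1]]]] := weak_to_strong htau
  (l2_lin mI (- h) (l2tP ub) (l2tP f.1.1)) (l2tP ua) (l2tP va) Va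
  (fun tc tu tv hu hv t => (W tc tu tv hu hv t).1).
have [p2 [q2 [w2 [F2 E2 P2 W2]]]] := weak_to_strong htau
  (l2_lin mI h (l2tP ua) (l2tP f.1.2)) (l2tP ub) (l2tP vb) Vb
  (fun tc tu tv hu hv t => (W tc tu tv hu hv t).2).
have [t1 [T1 M1 N1 R1 I1]] := memory_resolvent alpha01 wp_ge0 h0 (p1 1) (l2tP f.2.1).
have [t2 [T2 M2 N2 R2 I2]] := memory_resolvent alpha01 wp_ge0 h0 (p2 1) (l2tP f.2.2).
pose x : ((LI * LI) * (LT * LT))%type :=
  ((- h *: ub + f.1.1, h *: ua + f.1.2), (l2_of mT t1, l2_of mT t2)).
pose y : ((LI * LI) * (LT * LT))%type := ((- ub, ua),
  (l2_of mT (memory alpha wp t1 (p1 1)), l2_of mT (memory alpha wp t2 (p2 1)))).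
exists x, y; split.
  exists p1, q1, w1, (val ua), p2, q2, w2, (val ub).
  split; [by split|split; [split|]].
  - rewrite /= l2_ofK// I2 -/(G f.2.2) P2 W1 -/kappa.
    by field; rewrite zn hn kn.
  - rewrite /= l2_ofK// I1 -/(G f.2.1) P1 W2 -/kappa.
    by field; rewrite zn hn kn.
  - by rewrite /= !l2_ofK//; split=> //; exact: ae_eq_refl.
  - by rewrite /= !l2_ofK//; split=> //; exact: ae_eq_refl.
  - by split; exact: ae_eq_refl.
apply/nrmB_same; split; apply: aeW => s _.
- have -> : val (x - h *: y).1.1 s = - h * val ub s + val f.1.1 s - h * - val ub s by [].
  ring.
- have -> : val (x - h *: y).1.2 s = h * val ua s + val f.1.2 s - h * val ua s by [].
  ring.
- have -> : val (x - h *: y).2.1 s = val x.2.1 s - h * val y.2.1 s by [].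
  by rewrite /= !l2_ofK// R1.
- have -> : val (x - h *: y).2.2 s = val x.2.2 s - h * val y.2.2 s by [].
  by rewrite /= !l2_ofK// R2.
Qed.

Theorem generator_maximal_dissipative : maximal_dissipative hs Gen.
Proof.
split.
- move=> c x y x' y'; exact: generator_lin.
- exact: generator_ext.
- exact: generator_dissipative.
- move=> h f; exact: generator_max.
- exact: generator_fun.
Qed.

End resolvent.

(** * Complex functions as pairs of real functions *)

Section complex_parts.
Context {R : realType}.
Local Notation C := R[i].
Local Notation mu := (@lebesgue_measure R).
Implicit Types (f g : R -> C) (D : set R).

Definition re f x : R := complex.Re (f x).
Definition im f x : R := complex.Im (f x).
Definition pair_up (p q : R -> R) x : C := Complex (p x) (q x).

Lemma pair_upK f : pair_up (re f) (im f) = f.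
Proof. by apply/funext => x; rewrite /pair_up /re /im; case: (f x). Qed.

Lemma cabs_sq (z : C) : cabs z ^+ 2 = complex.Re z ^+ 2 + complex.Im z ^+ 2.
Proof.
by case: z => a b; rewrite /cabs /= sqr_sqrtr// addr_ge0 ?sqr_ge0.
Qed.

Lemma cabs_ge0 (z : C) : 0 <= cabs z.
Proof. by case: z => a b; rewrite /cabs sqrtr_ge0. Qed.

Lemma Re_le_cabs (z : C) : `|complex.Re z| <= cabs z.
Proof.
rewrite -(@ler_pXn2r _ 2%N)// ?nnegrE ?cabs_ge0// cabs_sq real_normK ?num_real//.
by rewrite lerDl sqr_ge0.
Qed.

Lemma Im_le_cabs (z : C) : `|complex.Im z| <= cabs z.
Proof.
rewrite -(@ler_pXn2r _ 2%N)// ?nnegrE ?cabs_ge0// cabs_sq real_normK ?num_real//.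
by rewrite lerDr sqr_ge0.
Qed.

Lemma cabs_le (z : C) : cabs z <= `|complex.Re z| + `|complex.Im z|.
Proof.
rewrite -(@ler_pXn2r _ 2%N)// ?nnegrE ?cabs_ge0 ?addr_ge0// cabs_sq.
rewrite -(real_normK (num_real (complex.Re z))) -(real_normK (num_real (complex.Im z))).
by have := mulr_ge0 (normr_ge0 (complex.Re z)) (normr_ge0 (complex.Im z)); nra.
Qed.

Lemma ReB (z w : C) : complex.Re (z - w) = complex.Re z - complex.Re w.
Proof. by case: z w => a b [c d]. Qed.

Lemma ImB (z w : C) : complex.Im (z - w) = complex.Im z - complex.Im w.
Proof. by case: z w => a b [c d]. Qed.

Lemma ReD (z w : C) : complex.Re (z + w) = complex.Re z + complex.Re w.
Proof. by case: z w => a b [c d]. Qed.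

Lemma ImD (z w : C) : complex.Im (z + w) = complex.Im z + complex.Im w.
Proof. by case: z w => a b [c d]. Qed.

Lemma ReZ (a : R) (z : C) : complex.Re (a%:C%C * z) = a * complex.Re z.
Proof. by case: z => c d /=; rewrite mul0r subr0. Qed.

Lemma ImZ (a : R) (z : C) : complex.Im (a%:C%C * z) = a * complex.Im z.
Proof. by case: z => c d /=; rewrite mul0r addr0. Qed.

Lemma Re_i (z : C) : complex.Re ('i%C * z) = - complex.Im z.
Proof. by case: z => c d /=; rewrite mul0r mul1r sub0r. Qed.

Lemma Im_i (z : C) : complex.Im ('i%C * z) = complex.Re z.
Proof. by case: z => c d /=; rewrite mul0r mul1r add0r. Qed.

Lemma L2P D f (mD : measurable D) : L2 D f <-> l2 D (re f) /\ l2 D (im f).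
Proof.
have sqE : (fun x => (cabs (f x) ^+ 2)%:E) =
    (fun x => (re f x ^+ 2 + im f x ^+ 2)%:E).
  by apply/funext => x; rewrite cabs_sq.
split=> [[mr mi]|[[mr ir] [mi ii]]].
  rewrite sqE => fin.
  have m2 : measurable_fun D (EFin \o (fun x => re f x ^+ 2 + im f x ^+ 2)).
    by apply/measurable_EFinP; apply: measurable_funD; exact: measurable_funX.
  split; apply: sq_intg => //; apply: le_lt_trans fin; apply: ge0_le_integral => //.
  - by move=> x _; rewrite lee_fin sqr_ge0.
  - by apply/measurable_EFinP; exact: measurable_funX.
  - by move=> x _; rewrite lee_fin lerDl sqr_ge0.
  - by move=> x _; rewrite lee_fin sqr_ge0.
  - by apply/measurable_EFinP; exact: measurable_funX.
  - by move=> x _; rewrite lee_fin lerDr sqr_ge0.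
by split=> //; rewrite sqE -(EFin_int mD (intgD mD ir ii)) ltry.
Qed.

Lemma ACP (a b : R) f :
  abs_continuous a b f <-> AC a b (re f) /\ AC a b (im f).
Proof.
split=> [h|[hr hi]].
  split=> e e0; have [d d0 hd] := h e e0; exists d => // n l r lr tr sd;
    apply: le_lt_trans (hd n l r lr tr sd); apply: ler_sum => i _.
    by rewrite /re -ReB Re_le_cabs.
  by rewrite /im -ImB Im_le_cabs.
move=> e e0; have e2 : 0 < e / 2 by rewrite divr_gt0.
have [d1 d10 h1] := hr _ e2; have [d2 d20 h2] := hi _ e2.
exists (Num.min d1 d2); first by rewrite lt_min d10.
move=> n l r lr tr; rewrite lt_min => /andP[s1 s2].
have := ltrD (h1 n l r lr tr s1) (h2 n l r lr tr s2).
rewrite -splitr -big_split/=; apply: le_lt_trans; apply: ler_sum => i _.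
by rewrite /re /im -ReB -ImB cabs_le.
Qed.

Lemma ae_derivativeP D f f' : ae_derivative D f f' <->
  {ae mu, forall x, D x -> is_derive x (1 : R) (re f) (re f' x)} /\
  {ae mu, forall x, D x -> is_derive x (1 : R) (im f) (im f' x)}.
Proof.
split=> [h|[h1 h2]]; last by move: h1 h2; apply: ae2 => x h h' Dx; split; [exact: h|exact: h'].
by split; move: h; apply: ae1 => x h Dx; have [] := h Dx.
Qed.

Lemma ae_eqP D f g : ae_eq mu D f g <->
  ae_eq mu D (re f) (re g) /\ ae_eq mu D (im f) (im g).
Proof.
split=> [h|[h1 h2]].
  by split; move: h; apply: ae1 => x h Dx; rewrite /re /im h.
move: h1 h2; apply: ae2 => x h h' Dx; move: (h Dx) (h' Dx); rewrite /re /im.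
by case: (f x) (g x) => a b [c d] /= -> ->.
Qed.

Lemma vanishesP f : cabs (f x) @[x --> 0^'+] --> (0 : R) <->
  vanishes (re f) /\ vanishes (im f).
Proof.
split=> [/cvgrPdist_lt h|[h1 h2]].
  have H e : 0 < e -> exists2 d, 0 < d & forall x, 0 < x -> x < d -> cabs (f x) < e.
    move=> e0; have := h e e0; rewrite near_withinE => /nbhs_ballP[d /= d0 hd].
    exists d => // x x0 xd; have := hd x; rewrite /ball/= sub0r normrN (gtr0_norm x0).
    by move=> /(_ xd x0); rewrite sub0r normrN ger0_norm ?cabs_ge0.
  by split=> e /H[d d0 hd]; exists d => // x x0 xd; apply: le_lt_trans (hd x x0 xd);
    [exact: Re_le_cabs|exact: Im_le_cabs].
apply/cvgrPdist_lt => e e0; have e2 : 0 < e / 2 by rewrite divr_gt0.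
have [d1 d10 hd1] := h1 _ e2; have [d2 d20 hd2] := h2 _ e2.
rewrite near_withinE; apply/nbhs_ballP; exists (Num.min d1 d2) => /=.
  by rewrite lt_min d10.
move=> x; rewrite /ball/= sub0r normrN => xd x0; move: xd.
rewrite gtr0_norm// lt_min => /andP[x1 x2].
rewrite sub0r normrN ger0_norm ?cabs_ge0//; apply: le_lt_trans (cabs_le _) _.
by rewrite [ltRHS]splitr ltrD// ?hd1 ?hd2.
Qed.

Variable tau : R -> R.
Local Notation mI := (measurable_itv `]0 : R, 1[).

Lemma flux_of_domain psi w dw : H2tau_der tau psi w dw -> W1tau tau psi ->
  exists q1 q2, flux tau (re psi) q1 (re w) (re dw) /\
                flux tau (im psi) q2 (im w) (im dw).
Proof.
move=> [q [[/(L2P _ mI)[l1 l2] lac /ae_derivativeP[d1 d2] /(L2P _ mI)[e1 e2]]]].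
move=> /ae_eqP[w1 w2] [/ACP[ac1 ac2] /ae_derivativeP[dw1 dw2] /(L2P _ mI)[m1 m2]] hW.
have bc : (m_tau tau < 1%:E)%E -> vanishes (re psi) /\ vanishes (im psi).
  by move=> lt1; move: hW; rewrite /W1tau lt1 => -[_ /vanishesP].
have ac a : 0 < a -> a < 1 -> AC a 1 (re psi) /\ AC a 1 (im psi).
  by move=> a0 a1; apply/ACP; exact: lac.
have rZ (k : R -> R) : re (fun x => (k x)%:C%C * q x) = (fun x => k x * re q x).
  by apply/funext => x; rewrite /re ReZ.
have iZ (k : R -> R) : im (fun x => (k x)%:C%C * q x) = (fun x => k x * im q x).
  by apply/funext => x; rewrite /im ImZ.
rewrite rZ in e1; rewrite rZ in w1; rewrite iZ in e2; rewrite iZ in w2.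
exists (re q), (im q); split; split=> //.
- by move=> a a0 a1; have [] := ac a a0 a1.
- by move=> /bc[].
- by move=> a a0 a1; have [] := ac a a0 a1.
- by move=> /bc[].
Qed.

Lemma domain_of_flux p1 q1 w1 d1 p2 q2 w2 d2 :
  flux tau p1 q1 w1 d1 -> flux tau p2 q2 w2 d2 ->
  H2tau_der tau (pair_up p1 p2) (pair_up w1 w2) (pair_up d1 d2) /\
  W1tau tau (pair_up p1 p2).
Proof.
move=> [a1 a2 a3 a4 a5 a6 a7 a8 a9] [b1 b2 b3 b4 b5 b6 b7 b8 b9].
have rE (f g : R -> R) : re (pair_up f g) = f by [].
have iE (f g : R -> R) : im (pair_up f g) = g by [].
have rZ (k : R -> R) : re (fun x => (k x)%:C%C * pair_up q1 q2 x) = (fun x => k x * q1 x).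
  by apply/funext => x; rewrite /re ReZ.
have iZ (k : R -> R) : im (fun x => (k x)%:C%C * pair_up q1 q2 x) = (fun x => k x * q2 x).
  by apply/funext => x; rewrite /im ImZ.
have H : H1tau_der tau (pair_up p1 p2) (pair_up q1 q2).
  split.
  - by apply/(L2P _ mI).
  - move=> a b a0 ab bl; apply/ACP; rewrite rE iE.
    by split; apply: (AC_sub (lexx a) bl); [apply: a2|apply: b2] => //; exact: lt_le_trans ab bl.
  - by apply/ae_derivativeP.
  - by apply/(L2P _ mI); rewrite rZ iZ.
split.
  exists (pair_up q1 q2); split=> //.
    by apply/ae_eqP; rewrite rZ iZ.
  by split; [apply/ACP|apply/ae_derivativeP|apply/(L2P _ mI)].
rewrite /W1tau; case: ifP => [lt1|_]; last by exists (pair_up q1 q2).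
split; first by exists (pair_up q1 q2).
by apply/vanishesP; split; [exact: a9|exact: b9].
Qed.

End complex_parts.

(** * States as elements of the real Hilbert space *)

Section states.
Context {R : realType}.
Local Notation C := R[i].
Local Notation mu := (@lebesgue_measure R).
Variables (rho alpha wp : R) (tau : R -> R).
Hypotheses (rho_gt0 : 0 < rho) (alpha01 : 0 < alpha < 1) (wp_ge0 : 0 <= wp)
  (htau : admissible_tau tau).
Local Notation mI := (measurable_itv `]0 : R, 1[).
Local Notation mT := (@measurableT _ R).
Local Notation LI := (l2t mI).
Local Notation LT := (l2t mT).
Local Notation HS := ((LI * LI) * (LT * LT))%type.
Local Notation Gen := (generator rho alpha wp tau).
Local Notation hs := (realified_hilbert rho_gt0 alpha01).
Local Notation N := (nrm hs).

Definition state_of (u : HS) : state R :=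
  (pair_up (val u.1.1) (val u.1.2), pair_up (val u.2.1) (val u.2.2)).

Definition lift (U : state R) : HS :=
  ((l2_of mI (re U.1), l2_of mI (im U.1)), (l2_of mT (re U.2), l2_of mT (im U.2))).

Lemma inH_state_of u : inH (state_of u).
Proof.
split; first by apply/(L2P _ mI); split; exact: l2tP.
by apply/(L2P _ mT); split; exact: l2tP.
Qed.

(** States are functions and not classes, so this is an equality. *)
Lemma liftK U : inH U -> state_of (lift U) = U.
Proof.
move=> [/(L2P _ mI)[h1 h2] /(L2P _ mT)[h3 h4]].
by rewrite /state_of /lift /= !l2_ofK// !pair_upK; case: U {h1 h2 h3 h4}.
Qed.

Lemma state_of_lin a u v :
  a%:C%C *: state_of u + state_of v = state_of (a *: u + v).
Proof.
congr (_, _); apply/funext => x; rewrite /pair_up.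
  apply/eqP; rewrite eq_complex; apply/andP; split; apply/eqP.
    by rewrite ReD ReZ.
  by rewrite ImD ImZ.
apply/eqP; rewrite eq_complex; apply/andP; split; apply/eqP.
  by rewrite ReD ReZ.
by rewrite ImD ImZ.
Qed.

Lemma state_ofB u v : state_of u - state_of v = state_of (u - v).
Proof. by congr (_, _). Qed.

Lemma state_ofN u : - state_of u = state_of (- u).
Proof. by congr (_, _). Qed.

Lemma state_of_sum n (a : nat -> R) (u : nat -> HS) (V : nat -> state R) :
  (forall k, (k < n)%N -> V k = state_of (u k)) ->
  \sum_(k < n) (a k)%:C%C *: V k = state_of (\sum_(k < n) a k *: u k).
Proof.
move=> VE; elim: n VE => [|n IH] VE.
  rewrite !big_ord0; congr (_, _); apply/funext => x; rewrite /pair_up; exact/eqP.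
rewrite !big_ord_recr /= IH => [|k kn]; last by apply: VE; exact: ltnW.
rewrite (VE n)// addrC state_of_lin; congr state_of; exact: addrC.
Qed.

Lemma int_normE (D : set R) (mD : measurable D) (p q : l2t mD) :
  complex.Re (Cintegral D (fun x => pair_up (val p) (val q) x * (pair_up (val p) (val q) x)^*%C)) =
  nrm (l2_hilbert mD) p ^+ 2 + nrm (l2_hilbert mD) q ^+ 2.
Proof.
rewrite !nrm_sq /= /l2_ip.
have i1 := l2_mul mD (l2tP p) (l2tP p); have i2 := l2_mul mD (l2tP q) (l2tP q).
by rewrite -(intD mD i1 i2); apply: eq_int => x _; rewrite /pair_up /=; ring.
Qed.

Lemma normH_state u : normH rho alpha (state_of u) = N u.
Proof.
rewrite /normH /nrm; congr Num.sqrt; rewrite /innerH ReD ReZ !int_normE !nrm_sq.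
by [].
Qed.

Lemma eqH_state u v : eqH (state_of u) (state_of v) <-> N (u - v) = 0.
Proof.
split=> [[/ae_eqP[h1 h2] /ae_eqP[h3 h4]]|/nrmB_same[h1 h2 h3 h4]].
  by apply/nrmB_same; split.
by split; apply/ae_eqP.
Qed.

Lemma re_A2 (th : R -> C) c : re (A2 alpha wp th c) = memory alpha wp (re th) (complex.Re c).
Proof.
apply/funext => x; rewrite /re /memory /A2 ReD ReZ; congr (_ + _).
by case: (th x) => a b /=; rewrite oppr0 mul0r subr0.
Qed.

Lemma im_A2 (th : R -> C) c : im (A2 alpha wp th c) = memory alpha wp (im th) (complex.Im c).
Proof.
apply/funext => x; rewrite /im /memory /A2 ImD ImZ; congr (_ + _).
by case: (th x) => a b /=; rewrite oppr0 mul0r addr0.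
Qed.

Lemma re_realM (k : R -> R) (f : R -> C) :
  re (fun x => (k x)%:C%C * f x) = (fun x => k x * re f x).
Proof. by apply/funext => x; rewrite /re ReZ. Qed.

Lemma im_realM (k : R -> R) (f : R -> C) :
  im (fun x => (k x)%:C%C * f x) = (fun x => k x * im f x).
Proof. by apply/funext => x; rewrite /im ImZ. Qed.

Lemma Re_flux_at_1 (th : R -> C) :
  complex.Re ('i%C * (zeta rho alpha)%:C%C *
    Cintegral setT (fun xi => (eta alpha xi)%:C%C * th xi)) =
  - zeta rho alpha * \int[mu]_(x in setT) (eta alpha x * im th x).
Proof. by rewrite -mulrA Re_i ImZ mulNr -im_realM. Qed.

Lemma Im_flux_at_1 (th : R -> C) :
  complex.Im ('i%C * (zeta rho alpha)%:C%C *
    Cintegral setT (fun xi => (eta alpha xi)%:C%C * th xi)) =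
  zeta rho alpha * \int[mu]_(x in setT) (eta alpha x * re th x).
Proof. by rewrite -mulrA Im_i ReZ -re_realM. Qed.

Lemma re_iM (f : R -> C) : re (fun x => 'i%C * f x) = (fun x => - im f x).
Proof. by apply/funext => x; rewrite /re Re_i. Qed.

Lemma im_iM (f : R -> C) : im (fun x => 'i%C * f x) = re f.
Proof. by apply/funext => x; rewrite /im Im_i. Qed.

Lemma graph_state u v : graphA rho alpha wp tau (state_of u) (state_of v) <-> Gen u v.
Proof.
split.
  move=> [psi [w [dw [[[uH /ae_eqP[E1 E2] h2 hW] [w1 hA hx]] [_ /ae_eqP[V1 V2] /ae_eqP[V3 V4]]]]]].
  have [q1 [q2 [F1 F2]]] := flux_of_domain h2 hW.
  move: hA => /(L2P _ mT); rewrite re_A2 im_A2 => -[A1 A2].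
  move: hx => /(L2P _ mT); rewrite re_realM im_realM => -[X1 X2].
  rewrite re_A2 in V3; rewrite im_A2 in V4; rewrite re_iM in V1; rewrite im_iM in V2.
  exists (re psi), q1, (re w), (re dw), (im psi), q2, (im w), (im dw).
  split; [by split|split; [split|by split]].
  - by rewrite /re w1 Re_flux_at_1.
  - by rewrite /im w1 Im_flux_at_1.
  - by split.
  - by split.
move=> [p1[q1[w1[d1[p2[q2[w2[d2[[F1 F2 E1 E2][[B1 B2 [M1 X1 Y1] [M2 X2 Y2]][V1 V2]]]]]]]]]]].
have [h2 hW] := domain_of_flux F1 F2.
exists (pair_up p1 p2), (pair_up w1 w2), (pair_up d1 d2).
split; [split; split=> //|split].
- exact: inH_state_of.
- by apply/ae_eqP; split.
- apply/eqP; rewrite eq_complex; apply/andP; split; apply/eqP.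
    by rewrite Re_flux_at_1.
  by rewrite Im_flux_at_1.
- by apply/(L2P _ mT); rewrite re_A2 im_A2.
- by apply/(L2P _ mT); rewrite re_realM im_realM.
- exact: inH_state_of.
- by apply/ae_eqP; rewrite re_iM im_iM; split.
- by apply/ae_eqP; rewrite re_A2 im_A2; split.
Qed.

End states.

(** * Solutions of the evolution problem *)

Section limits.
Context {R : realType}.
Implicit Types (f : R -> R) (t : R).

Lemma within_Rplus_cvg0 f t : f s @[s --> within Rplus (nbhs t)] --> (0 : R) <->
  forall e, 0 < e -> exists2 d, 0 < d & forall s, 0 <= s -> `|s - t| < d -> `|f s| < e.
Proof.
split=> [/cvgrPdist_lt h e e0|h].
  have := h e e0; rewrite near_withinE => /nbhs_ballP[d /= d0 hd].
  exists d => // s s0 st; have := hd s; rewrite /ball/= distrC => /(_ st s0).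
  by rewrite sub0r normrN.
apply/cvgrPdist_lt => e e0; have [d d0 hd] := h e e0.
rewrite near_withinE; apply/nbhs_ballP; exists d => //= s.
by rewrite /ball/= distrC => st s0; rewrite sub0r normrN; exact: hd.
Qed.

Lemma within_Rplus_dnbhs_cvg0 f t : f s @[s --> within Rplus t^'] --> (0 : R) <->
  forall e, 0 < e -> exists2 d, 0 < d &
    forall s, 0 <= s -> s != t -> `|s - t| < d -> `|f s| < e.
Proof.
split=> [/cvgrPdist_lt h e e0|h].
  have := h e e0; rewrite near_withinE => /nbhs_ballP[d /= d0 hd].
  exists d => // s s0 nst st; have := hd s; rewrite /ball/= distrC => /(_ st nst s0).
  by rewrite sub0r normrN.
apply/cvgrPdist_lt => e e0; have [d d0 hd] := h e e0.
rewrite near_withinE; apply/nbhs_ballP; exists d => //= s.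
by rewrite /ball/= distrC => st nst s0; rewrite sub0r normrN; exact: hd.
Qed.

End limits.

Section evolution.
Context {R : realType}.
Variables (rho alpha wp : R) (tau : R -> R).
Hypotheses (rho_gt0 : 0 < rho) (alpha01 : 0 < alpha < 1) (wp_ge0 : 0 <= wp)
  (htau : admissible_tau tau).
Local Notation mI := (measurable_itv `]0 : R, 1[).
Local Notation mT := (@measurableT _ R).
Local Notation HS := ((l2t mI * l2t mI) * (l2t mT * l2t mT))%type.
Local Notation Gen := (generator rho alpha wp tau).
Local Notation hs := (realified_hilbert rho_gt0 alpha01).
Local Notation N := (nrm hs).
Implicit Types (U V : R -> state R) (u v : R -> HS) (t : R).

Definition represents U u := forall s, 0 <= s -> U s = state_of (u s).

Lemma normHB U u s t : represents U u -> 0 <= s -> 0 <= t ->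
  normH rho alpha (U s - U t) = N (u s - u t).
Proof. by move=> Uu s0 t0; rewrite !Uu// state_ofB (normH_state rho_gt0 alpha01). Qed.

Lemma C0H_contH U u : represents U u ->
  C0H rho alpha U <-> forall t, 0 <= t -> contH hs u t.
Proof.
move=> Uu; split=> [h t t0 e e0|h t t0].
  have [_ /within_Rplus_cvg0 /(_ e e0)[d d0 hd]] := h t t0.
  exists d => // s s0 st; have := hd s s0 st.
  by rewrite (normHB Uu)// ger0_norm ?nrm_ge0.
split; first by rewrite Uu//; exact: inH_state_of.
apply/within_Rplus_cvg0 => e e0; have [d d0 hd] := h t t0 e e0.
by exists d => // s s0 st; rewrite (normHB Uu)// ger0_norm ?nrm_ge0// hd.
Qed.

Lemma derivH_derH U u t (w : HS) : represents U u -> 0 <= t ->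
  derivH rho alpha U t (state_of w) <-> derH hs u t w.
Proof.
move=> Uu t0.
have E s : 0 <= s -> s != t ->
    normH rho alpha ((s - t)^-1%:C%C *: (U s - U t) - state_of w) * `|s - t| =
    N (u s - u t - (s - t) *: w).
  move=> s0 st; have st0 : s - t != 0 by rewrite subr_eq0.
  rewrite !Uu// state_ofB state_ofN state_of_lin (normH_state rho_gt0 alpha01).
  rewrite mulrC -nrmZ scalerDr scalerA mulfV// scale1r scalerN.
  by [].
split=> [/within_Rplus_dnbhs_cvg0 h e e0|h].
  have [d d0 hd] := h e e0; exists d => // s s0 sd.
  have [->|st] := eqVneq s t; first by rewrite !subrr scale0r !subr0 nrm0 normr0 mulr0.
  rewrite -E// ler_wpM2r// ltW//; apply: le_lt_trans (hd s s0 st sd); exact: ler_norm.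
apply/within_Rplus_dnbhs_cvg0 => e e0.
have e2 : 0 < e / 2 by rewrite divr_gt0.
have [d d0 hd] := h _ e2; exists d => // s s0 st sd.
have p : 0 < `|s - t| by rewrite normr_gt0 subr_eq0.
have := hd s s0 sd; rewrite -E// ler_pM2r// => le.
by rewrite ger0_norm ?sqrtr_ge0//; apply: le_lt_trans le _; lra.
Qed.

Lemma RintegralH_rint U u t j : represents U u -> 0 <= t ->
  is_RintegralH rho alpha U t (state_of j) <-> is_rint hs u t j.
Proof.
move=> Uu t0.
have E n p c e : tagged n p c e t ->
    normH rho alpha (\sum_(k < n) (p k.+1 - p k)%:C%C *: U (c k) - state_of j) =
    N (rsum n p c u - j).
  move=> [p0 pt h].
  rewrite (@state_of_sum R n (fun k => p k.+1 - p k) (fun k => u (c k)) (fun k => U (c k))).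
    by rewrite state_ofB (normH_state rho_gt0 alpha01).
  move=> k kn; apply: Uu; have [/andP[pc _] _] := h k kn.
  apply: le_trans pc; rewrite -p0; apply: le_chain => i ik.
  by have [/andP[+ +] _] := h i (ltn_trans ik kn); exact: le_trans.
split=> h e e0; have [d d0 hd] := h e e0; exists d => //.
  move=> n p c ht; rewrite -(E n p c d ht); case: ht => p0 pt hk; exact: hd.
by move=> n p c p0 pt hk; rewrite (E n p c d)//; exact: hd.
Qed.

End evolution.

Theorem theorem3p1 (R : realType) (rho alpha wp : R) (tau : R -> R)
  (rho_gt0 : 0 < rho) (alpha01 : 0 < alpha < 1) (wp_ge0 : 0 <= wp)
  (htau : admissible_tau tau) (U0 : state R) (hU0 : inH U0) :
  exists U : R -> state R,
    [/\ mild_solution rho alpha wp tau U0 U,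
        forall V : R -> state R, mild_solution rho alpha wp tau U0 V ->
          forall t, 0 <= t -> eqH (V t) (U t) &
        domA rho alpha wp tau U0 ->
          classical_solution rho alpha wp tau U0 U /\
          forall V : R -> state R, classical_solution rho alpha wp tau U0 V ->
            forall t, 0 <= t -> eqH (V t) (U t)].
Proof.
pose hs := realified_hilbert rho_gt0 alpha01.
pose G := generator rho alpha wp tau.
have mG : maximal_dissipative hs G by exact: generator_maximal_dissipative.
have u0K : state_of (lift U0) = U0 by exact: liftK.
move: (lift U0) u0K => u0 u0K.
have [u [u_0 uC u_mild u_classical]] := abstract_evolution u0 mG.
pose U t := state_of (u t).
have Uu : represents U u := fun s _ => erefl.
have U_0 : eqH (U 0) U0 by rewrite -u0K; apply/(eqH_state rho_gt0 alpha01).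
have Vv V : C0H rho alpha V -> represents V (lift \o V).
  by move=> cV s s0; rewrite /= liftK//; have [] := cV s s0.
have inHA (W F : state R) : graphA rho alpha wp tau W F -> inH W /\ inH F.
  by move=> [psi [w [dw [[[h _ _ _] _] [h' _ _]]]]].
have GA (W F : state R) : graphA rho alpha wp tau W F -> G (lift W) (lift F).
  move=> g; have [h h'] := inHA _ _ g.
  by apply/graph_state; rewrite !liftK.
exists U; split.
- split; first exact/(C0H_contH rho_gt0 alpha01 Uu).
  split=> // t t0; have [j [hj gj]] := u_mild t t0.
  exists (state_of j); split; first exact/(RintegralH_rint rho_gt0 alpha01 _ Uu).
  by rewrite -u0K state_ofB; apply/graph_state.
- move=> V [cV [_ mV]] t t0; have vV := Vv V cV.
  rewrite (vV t t0); apply/(eqH_state rho_gt0 alpha01).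
  pose JP (v : R -> _) s := [set j | is_rint hs v s j /\ G j (v s - u0)].
  have ex1 s : 0 <= s -> exists j, JP u s j := u_mild s.
  have ex2 s : 0 <= s -> exists j, JP (lift \o V) s j.
    move=> s0; have [J [iJ gJ]] := mV s s0; exists (lift J).
    have [hJ hV] := inHA _ _ gJ; split.
      by apply/(RintegralH_rint rho_gt0 alpha01 _ vV s0); rewrite liftK.
    apply/graph_state; rewrite -state_ofB -(vV s s0) u0K.
    by rewrite liftK.
  have cv s : 0 <= s -> contH hs (lift \o V) s by exact: (proj1 (C0H_contH rho_gt0 alpha01 vV) cV s).
  apply: (mild_uniq mG (JU := fun s => xget 0 (JP (lift \o V) s))
    (JV := fun s => xget 0 (JP u s)) (u0 := u0) cv uC _ _ t0) => s s0.
    by have := xgetPex 0 (ex2 s s0).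
  by have := xgetPex 0 (ex1 s s0).
- move=> [psi [w [dw hdom]]].
  have [F0 gF0] : exists F, graphA rho alpha wp tau U0 F.
    have [[hU0' _ h2 _] [_ hA _]] := hdom.
    exists ((fun x => 'i%C * dw x), A2 alpha wp U0.2 (psi 1)).
    exists psi, w, dw; split=> //; split; [|exact: ae_eq_refl|exact: ae_eq_refl].
    split=> //; have [q [_ _ [_ _ /(L2P _ (measurable_itv _))[m1 m2]]]] := h2.
    apply/(L2P _ (measurable_itv _)); rewrite re_iM im_iM; split=> //.
    have -> : (fun x => - im dw x) = (fun x => -1 * im dw x + 0).
      by apply/funext => x; rewrite mulN1r addr0.
    by apply: l2_lin => //; exact: l2_0.
  have g0 : G u0 (lift F0).
    by apply/graph_state; rewrite u0K liftK//; have [] := inHA _ _ gF0.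
  have [f hf] := u_classical _ g0; pose F t := state_of (f t).
  have Ff : represents F f := fun s _ => erefl.
  have fC t : 0 <= t -> contH hs f t by move=> t0; have [] := hf t t0.
  have gr t : 0 <= t -> graphA rho alpha wp tau (U t) (F t).
    by move=> t0; apply/graph_state; have [] := hf t t0.
  have dU t : 0 <= t -> derivH rho alpha U t (F t).
    by move=> t0; apply/(derivH_derH rho_gt0 alpha01 _ Uu t0); have [] := hf t t0.
  split.
    split=> //.
    + exists F => t t0; split; first exact: gr.
      apply/within_Rplus_cvg0 => e e0; have e2 : 0 < e / 2 by rewrite divr_gt0.
      have [d d0 hd] := uC t t0 _ e2; have [d' d'0 hd'] := fC t t0 _ e2.
      exists (Num.min d d'); first by rewrite lt_min d0.
      move=> s s0; rewrite lt_min => /andP[sd sd'].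
      rewrite (normHB rho_gt0 alpha01 Uu)// (normHB rho_gt0 alpha01 Ff)//.
      rewrite ger0_norm; last exact: addr_ge0 (nrm_ge0 _ _) (nrm_ge0 _ _).
      rewrite [ltRHS]splitr; exact: ltrD (hd s s0 sd) (hd' s s0 sd').
    + split; first exact/(C0H_contH rho_gt0 alpha01 Uu).
      by exists F; split=> //; exact/(C0H_contH rho_gt0 alpha01 Ff).
    + by move=> t t0; exists (F t); split; [exact: gr|exact: dU].
  move=> V [_ [cV _] V_0 hV] t t0; have vV := Vv V cV.
  rewrite (vV t t0); apply/(eqH_state rho_gt0 alpha01).
  pose KP s := [set k | G (lift (V s)) k /\ derH hs (lift \o V) s k].
  have ex s : 0 <= s -> exists k, KP s k.
    move=> s0; have [K [gK dK]] := hV s s0; exists (lift K); split; first exact: GA.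
    apply/(derivH_derH rho_gt0 alpha01 _ vV s0); rewrite liftK//.
    by have [] := inHA _ _ gK.
  pose k s := xget 0 (KP s).
  have -> : (lift \o V) t - u t = (-1) *: u t + (lift \o V) t.
    by rewrite scaleN1r addrC.
  apply: (dissipative_uniq mG (W := fun s => (-1) *: u s + (lift \o V) s)
    (F := fun s => (-1) *: f s + k s) _ _ _ t0).
  + move=> s s0; have [h1 h2] := xgetPex 0 (ex s s0).
    by have [_ h _] := hf s s0; exact: (G_lin mG (-1) h h1).
  + move=> s s0; have [h1 h2] := xgetPex 0 (ex s s0).
    by have [_ _ h] := hf s s0; exact: (derH_lin (-1) h h2).
  + have -> : (-1) *: u 0 + (lift \o V) 0 = lift (V 0) - u 0 by rewrite scaleN1r addrC.
    apply/(eqH_state rho_gt0 alpha01); rewrite liftK; last by have [] := cV 0 (lexx 0).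
    split; first exact: ae_eq_trans V_0.1 (ae_eq_sym U_0.1).
    exact: ae_eq_trans V_0.2 (ae_eq_sym U_0.2).
Qed.
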